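(* Let $H,T\in\mathbb C^{2n\times2n}$ be Hamiltonian, let $\lambda\in\mathbb C$ be nonimaginary (nonzero real part), and suppose there is an invertible $\Phi=[\,\Xi\;\;\Xi_c\;\;\Phi_C\,]$ with $$H\Phi=\Phi\,\mathrm{diag}\big(\lambda I_p+N,\ -(\lambda I_p+N)^*,\ H_C\big),\qquad \Phi^*J_n\Phi=\mathrm{diag}(J_p,J_{n-p}),\qquad \lambda,-\bar\lambda\notin\Lambda(H_C).$$ With the notation of the context, assume $\Psi_1,\dots,\Psi_m$ are all invertible, and fix $\rho\in\{1,\dots,m\}$. Let $F,F^{(c)}\in\mathbb C^{\rho s_\rho\times\ell}$ be full column rank matrices, $\Omega\in\mathbb C^{\ell\times\ell}$, $Q,Q^{(c)}\in\mathbb C^{s_\rho\times\ell}$ with $$F=[Q^T\ (Q\Omega)^T\ \dots\ (Q\Omega^{\rho-1})^T]^T,\quad -\widehat S_\rho Q=Q\Omega^\rho,$$ $$F^{(c)}=[\Omega^{\rho-1}(Q^{(c)})^*\ \dots\ \Omega(Q^{(c)})^*\ \ (Q^{(c)})^*]^*,\quad -\widehat S_\rho^*Q^{(c)}=Q^{(c)}(\Omega^* )^\rho,$$ $$\Theta_\rho(-\widehat S_\rho)F=F\Omega,\quad \Theta_\rho(-\widehat S_\rho)^*F^{(c)}=F^{(c)}\Omega^*,\quad F^*F^{(c)}=I_\ell,$$ and $\Lambda(\Omega)\cap(\Lambda(\Theta_\rho(-\widehat S_\rho))\setminus\Lambda(\Omega))=\emptyset$. Then for $t>0$ sufficiently small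 there is a perturbed structured basis $(\widetilde\Xi_\rho(t),\widetilde\Xi_\rho^{(c)}(t),\widetilde\Theta_\rho^{(h)}(t))$ (defined in the context), and there exist matrices $\widetilde F(t)=F+O(t^{1/\rho})$, $\widetilde F^{(c)}(t)=F^{(c)}+O(t^{1/\rho})$, $\widetilde\Omega(t)=\Omega+O(t^{1/\rho})$ satisfying $$\widetilde\Theta_\rho^{(h)}(t)\widetilde F(t)=\widetilde F(t)\widetilde\Omega(t),\quad (\widetilde\Theta_\rho^{(h)}(t))^*\widetilde F^{(c)}(t)=\widetilde F^{(c)}(t)\widetilde\Omega^*(t),\quad \widetilde F^*(t)\widetilde F^{(c)}(t)=I_\ell,$$ such that $\widetilde\Phi_\Omega(t)=[\,L_\rho(t)\;\;L_\rho^{(c)}(t)\,]$ with $L_\rho(t)=\widetilde\Xi_\rho(t)\widetilde F(t)$, $L_\rho^{(c)}(t)=\widetilde\Xi_\rho^{(c)}(t)\widetilde F^{(c)}(t)$ satisfies $$(H+tT)\widetilde\Phi_\Omega(t)=\widetilde\Phi_\Omega(t)\begin{bmatrix}\lambda I_\ell+t^{1/\rho}\widetilde\Omega(t)&0\\0&-(\lambda I_\ell+t^{1/\rho}\widetilde\Omega(t))^*\end{bmatrix},\qquad \widetilde\Phi_\Omega^*(t)J_n\widetilde\Phi_\Omega(t)=t^{1-1/\rho}J_\ell,$$ and $$L_\rho(t)=\Upsilon_\rho\begin{bmatrix}I_{s_\rho}\\\widehat G_\rho\end{bmatrix}Q+\sum_{k=1}^m\Xi_kL_{k\rho}(t)+O(t),\qquad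 L_\rho^{(c)}(t)=\Upsilon_\rho^{(c)}\begin{bmatrix}I_{s_\rho}\\\widehat G_\rho^{(c)}\end{bmatrix}Q^{(c)}+\sum_{k=1}^m\Xi_k^{(c)}L_{k\rho}^{(c)}(t)+O(t),$$ where $L_{k\rho}(t)=O(\delta_k(t))$, $L_{k\rho}^{(c)}(t)=O(\delta_k^{c}(t))$ for $k\neq\rho$, and $$L_{\rho\rho}(t)=\big[\,0\ \ (Q(t^{1/\rho}\Omega))^T\ \dots\ (Q(t^{1/\rho}\Omega)^{\rho-1})^T\big]^T+O(\delta_\rho(t)),$$ $$L_{\rho\rho}^{(c)}(t)=\big[(t^{1/\rho}\Omega)^{\rho-1}(Q^{(c)})^*\ \dots\ (t^{1/\rho}\Omega)(Q^{(c)})^*\ \ 0\,\big]^*+O(\delta_\rho^{c}(t)).$$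
   Context: $J_k=\begin{bmatrix}0&I_k\\-I_k&0\end{bmatrix}$. $H\in\mathbb C^{2n\times2n}$ is Hamiltonian if $J_nH=(J_nH)^*$. $\Lambda(\cdot)$ is the spectrum; in the condition relating $\Lambda(\Omega)$ and $\Lambda(\Theta_\rho(-\widehat S_\rho))$ spectra are multisets (eigenvalues counted with algebraic multiplicity), so the condition says that no eigenvalue of $\Omega$ is among the remaining eigenvalues of $\Theta_\rho(-\widehat S_\rho)$. $^*$ is conjugate transpose; $A^{-*}=(A^{-1})^*$. Jordan structure: integers $m\ge1$, $s_1,\dots,s_{m-1}\ge0$, $s_m>0$, $p=\sum_{j=1}^m js_j$, $N=\mathrm{diag}(N_1,\dots,N_m)$, where $N_j$ is the $j\times j$ block matrix with blocks of size $s_j\times s_j$, having $I_{s_j}$ on the first block superdiagonal and zeros elsewhere ($N_1=0_{s_1}$). Partitions: $\Xi=[\Xi_1\ \dots\ \Xi_m]$, $\Xi_c=[\Xi_1^{(c)}\ \dots\ \Xi_m^{(c)}]$ with $\Xi_j,\Xi_j^{(c)}$ having $js_j$ columns, and $\Xi_j=[\Xi_{j1}\ \dots\ \Xi_{jj}]$, $\Xi_j^{(c)}=[\Xi_{j1}^{(c)}\ \dots\ \Xi_{jj}^{(c)}]$ with each block having $s_j$ columns. For $k=1,\dots,m$: $\Upsilon_k=[\Xi_{k1}\ \Xi_{k+1,1}\ \dots\ \Xi_{m1}]$, $\Upsilon_k^{(c)}=[\Xi_{kk}^{(c)}\ \Xi_{k+1,k+1}^{(c)}\ \dots\ \Xi_{mm}^{(c)}]$,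 $\Psi_k=(\Upsilon_k^{(c)})^*(J_nT)\Upsilon_k$. For $\rho<m$: $\widehat G_\rho=-\Psi_{\rho+1}^{-1}(\Upsilon_{\rho+1}^{(c)})^*J_nT\Xi_{\rho1}$, $\widehat G_\rho^{(c)}=-\Psi_{\rho+1}^{-*}\Upsilon_{\rho+1}^*J_nT\Xi_{\rho\rho}^{(c)}$, $\widehat S_\rho=(\Xi_{\rho\rho}^{(c)})^*J_nT(\Xi_{\rho1}+\Upsilon_{\rho+1}\widehat G_\rho)$. For $\rho=m$: $\widehat G_\rho,\widehat G_\rho^{(c)}$ are absent (empty) and $\widehat S_m=(\Xi_{mm}^{(c)})^*J_nT\Xi_{m1}$. $\Theta_\rho(S)$ is the $\rho\times\rho$ block matrix with $s_\rho\times s_\rho$ blocks, with $I_{s_\rho}$ on the first block superdiagonal, $S$ in the bottom-left block, zeros elsewhere ($\Theta_1(S)=S$). Order notation: $t>0$ is real and sufficiently small; $O(t^d)$ is a matrix with norm at most a constant (independent of $t$) times $t^d$ for all sufficiently small $t>0$. For a matrix with $k$ block rows, $O([t^{d_1}\ \dots\ t^{d_k}]^T)$ means the $i$th block row is $O(t^{d_i})$. For fixed $\rho$, $\delta_k(t)$ is the following vector of length $k$ (applied to matrices with $k$ block rows of height $s_k$): for $k<\rho$, $[t^{1-k/\rho}\ t^{1-(k-1)/\rho}\ \dots\ t^{1-1/\rho}]^T$; for $k=\rho$, $[t^{1/\rho}\ t^{2/\rho}\ \dots\ t]^T$; for $k>\rho$, $[t^{1/\rho}\ t^{1/\rho}\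 t^{2/\rho}\ \dots\ t\ \dots\ t]^T$, i.e. first entry $t^{1/\rho}$ and $i$th entry $t^{\min(i-1,\rho)/\rho}$ for $i\ge2$. $\delta_k^{c}(t)$ is $\delta_k(t)$ with entries in reverse order. Perturbed structured basis: a family (for all sufficiently small $t>0$) of matrices $\widetilde\Xi_\rho(t),\widetilde\Xi_\rho^{(c)}(t)\in\mathbb C^{2n\times\rho s_\rho}$, $\widetilde\Theta_\rho^{(h)}(t)=\Theta_\rho(-\widehat S_\rho)+O(t^{1/\rho})$ with $$\widetilde\Xi_\rho(t)=\Upsilon_\rho\begin{bmatrix}I_{s_\rho}&0\\\widehat G_\rho&0\end{bmatrix}+\sum_{k=1}^m\Xi_k\widetilde X_{k\rho}(t)+O(t),\quad \widetilde\Xi_\rho^{(c)}(t)=\Upsilon_\rho^{(c)}\begin{bmatrix}0&I_{s_\rho}\\0&\widehat G_\rho^{(c)}\end{bmatrix}+\sum_{k=1}^m\Xi_k^{(c)}\widetilde X_{k\rho}^{(c)}(t)+O(t),$$ where $\widetilde X_{k\rho}=O(\delta_k)$, $\widetilde X_{k\rho}^{(c)}=O(\delta_k^{c})$ for $k\ne\rho$, $\widetilde X_{\rho\rho}=\mathrm{diag}(0_{s_\rho},t^{1/\rho}I_{s_\rho},\dots,t^{1-1/\rho}I_{s_\rho})$, $\widetilde X_{\rho\rho}^{(c)}=\mathrm{diag}(t^{1-1/\rho}I_{s_\rho},\dots,t^{1/\rho}I_{s_\rho},0_{s_\rho})+O(\delta_\rho^{c})$, such that $\widetilde\Phi_\rho=[\widetilde\Xi_\rho\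 \widetilde\Xi_\rho^{(c)}]$ satisfies $(H+tT)\widetilde\Phi_\rho=\widetilde\Phi_\rho\,\mathrm{diag}\big(\lambda I+t^{1/\rho}\widetilde\Theta_\rho^{(h)},-(\lambda I+t^{1/\rho}\widetilde\Theta_\rho^{(h)})^*\big)$ and $\widetilde\Phi_\rho^*J_n\widetilde\Phi_\rho=t^{1-1/\rho}J_{\rho s_\rho}$. *)

(* Defs.v *)
From HB Require Import structures.
From mathcomp Require Export all_boot all_order all_algebra.
From mathcomp Require Export finmap multiset complex.
From mathcomp Require Export all_classical all_reals all_analysis.

Set Implicit Arguments.
Unset Strict Implicit.
Unset Printing Implicit Defensive.

Import Order.TTheory GRing.Theory Num.Theory numFieldNormedType.Exports.

Local Open Scope ring_scope.
Local Open Scope complex_scope.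
Local Open Scope sesquilinear_scope.
Local Open Scope classical_set_scope.

(* The complex field is R[i] for R : realType;
   A ^t* is the conjugate transpose.

   Indexing.  Families s, Xi, Xic, X ... are indexed by nat with the usual
   1-based indices 1 <= i <= j <= m; the values outside of this range are never
   used.  The columns of the bases are given directly by their blocks
   Xi j i : 'M_(n + n, s j), so that the partition of [Xi_1 ... Xi_m] is part
   of the data.  A block size k * s is written \sum_(i < k) s, which is the
   form that \mxblock, \mxrow and \mxcol produce. *)

Definition diag2 (R : pzRingType) (a b : nat) (A : 'M[R]_a) (B : 'M[R]_b) :
    'M[R]_(a + b) :=
  block_mx A 0 0 B.

Definition Jmx (R : pzRingType) (k : nat) : 'M[R]_(k + k) :=
  block_mx 0 1%:M (- 1%:M) 0.

Definition Hamiltonian (R : realType) (n : nat) (H : 'M[R[i]]_(n + n)) : Prop :=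
  Jmx _ n *m H = (Jmx _ n *m H) ^t*.

(* Two-sided invertibility, for matrices whose two dimensions need not be
   syntactically the same.  For Phi = [Xi Xi_c Phi_C], with 2 (n - p) columns in
   Phi_C (truncated subtraction), it forces p <= n. *)
Definition invertible_mx (R : pzRingType) (a b : nat) (A : 'M[R]_(a, b)) : Prop :=
  exists B : 'M[R]_(b, a), A *m B = 1%:M /\ B *m A = 1%:M.

(* Eigenvalues counted with algebraic multiplicity: the sequence of the roots
   of the characteristic polynomial. *)
Definition spectrum (R : realType) (n : nat) (A : 'M[R[i]]_n) : {mset R[i]}%mset :=
  seq_mset (sval (closed_field_poly_normal (char_poly A))).

Definition Nblock (R : pzRingType) (k r : nat) : 'M[R]_(\sum_(i < k) r) :=
  \mxblock_(a < k, b < k) (if b == a.+1 :> nat then 1%:M else 0 : 'M[R]_(r, r)).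

Definition Theta (R : pzRingType) (k r : nat) (S : 'M[R]_r) :
    'M[R]_(\sum_(i < k) r) :=
  \mxblock_(a < k, b < k)
    (if b == a.+1 :> nat then 1%:M
     else if (a.+1 == k :> nat) && (b == 0 :> nat) then S else 0 : 'M[R]_(r, r)).

Definition psize (m : nat) (s : nat -> nat) : nat :=
  \sum_(j < m) \sum_(i < j.+1) s j.+1.

Lemma psizeE (m : nat) (s : nat -> nat) :
  psize m s = (\sum_(1 <= j < m.+1) j * s j)%N.
Proof.
rewrite /psize big_add1 /= big_mkord; apply: eq_bigr => j _.
by rewrite sum_nat_const card_ord.
Qed.

Definition Nmx (R : pzRingType) (m : nat) (s : nat -> nat) : 'M[R]_(psize m s) :=
  \mxdiag_(j < m) Nblock R j.+1 (s j.+1).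

Definition grp (R : pzRingType) (r : nat) (s : nat -> nat)
    (Xi : forall j i : nat, 'M[R]_(r, s j)) (j : nat) :
    'M[R]_(r, \sum_(i < j) s j) :=
  \mxrow_(i < j) Xi j i.+1.

Definition allgrp (R : pzRingType) (r m : nat) (s : nat -> nat)
    (Xi : forall j i : nat, 'M[R]_(r, s j)) : 'M[R]_(r, psize m s) :=
  \mxrow_(j < m) grp Xi j.+1.

(* [B_k B_(k+1) ... B_(k+d-1)].  The recursion makes
   tail_row B k d.+1 = row_mx (B k) (tail_row B k.+1 d) hold by conversion, so
   that Upsilon_rho can be multiplied by col_mx 1%:M Ghat without a cast. *)
Fixpoint tail_dim (s : nat -> nat) (k d : nat) : nat :=
  if d is d'.+1 then (s k + tail_dim s k.+1 d')%N else 0%N.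

Fixpoint tail_row (R : pzRingType) (r : nat) (s : nat -> nat)
    (B : forall j : nat, 'M[R]_(r, s j)) (k d : nat) : 'M[R]_(r, tail_dim s k d) :=
  if d is d'.+1 then row_mx (B k) (tail_row B k.+1 d') else 0.

(* The argument d is the number of blocks: Upsilon_k is Ups Xi k (m - k).+1 for
   1 <= k <= m, and Upsilon_(k+1) is Ups Xi k.+1 (m - k), which has no column
   when k = m. *)
Definition Ups (R : pzRingType) (r : nat) (s : nat -> nat)
    (Xi : forall j i : nat, 'M[R]_(r, s j)) (k d : nat) : 'M[R]_(r, tail_dim s k d) :=
  tail_row (fun j => Xi j 1%N) k d.

Definition Upsc (R : pzRingType) (r : nat) (s : nat -> nat)
    (Xic : forall j i : nat, 'M[R]_(r, s j)) (k d : nat) : 'M[R]_(r, tail_dim s k d) :=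
  tail_row (fun j => Xic j j) k d.

Definition Psi (R : realType) (n : nat) (s : nat -> nat)
    (Xi Xic : forall j i : nat, 'M[R[i]]_(n + n, s j)) (T : 'M[R[i]]_(n + n))
    (k d : nat) : 'M[R[i]]_(tail_dim s k d) :=
  (Upsc Xic k d) ^t* *m (Jmx _ n *m T) *m Ups Xi k d.

(* When rho = m, the matrices Ghat and Ghatc have no row, and
   Shat is Xic_mm^* J T Xi_m1. *)
Definition Ghat (R : realType) (n m : nat) (s : nat -> nat)
    (Xi Xic : forall j i : nat, 'M[R[i]]_(n + n, s j)) (T : 'M[R[i]]_(n + n))
    (rho : nat) : 'M[R[i]]_(tail_dim s rho.+1 (m - rho), s rho) :=
  - (invmx (Psi Xi Xic T rho.+1 (m - rho))
     *m (Upsc Xic rho.+1 (m - rho)) ^t* *m Jmx _ n *m T *m Xi rho 1%N).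

Definition Ghatc (R : realType) (n m : nat) (s : nat -> nat)
    (Xi Xic : forall j i : nat, 'M[R[i]]_(n + n, s j)) (T : 'M[R[i]]_(n + n))
    (rho : nat) : 'M[R[i]]_(tail_dim s rho.+1 (m - rho), s rho) :=
  - ((invmx (Psi Xi Xic T rho.+1 (m - rho))) ^t*
     *m (Ups Xi rho.+1 (m - rho)) ^t* *m Jmx _ n *m T *m Xic rho rho).

Definition Shat (R : realType) (n m : nat) (s : nat -> nat)
    (Xi Xic : forall j i : nat, 'M[R[i]]_(n + n, s j)) (T : 'M[R[i]]_(n + n))
    (rho : nat) : 'M[R[i]]_(s rho) :=
  (Xic rho rho) ^t* *m Jmx _ n *m T
  *m (Xi rho 1%N + Ups Xi rho.+1 (m - rho) *m Ghat m Xi Xic T rho).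

Definition tpow (R : realType) (t d : R) : R[i] := (t `^ d)%:C.

(* M(t) = O(t^d) as t -> 0+, for the entrywise maximum norm. *)
Definition bigO (R : realType) (a b : nat) (M : R -> 'M[R[i]]_(a, b)) (d : R) : Prop :=
  exists c : R, \forall t \near 0^'+, forall i j, `|M t i j| <= c%:C * tpow t d.

Definition bigO_rows (R : realType) (k r b : nat)
    (M : R -> 'M[R[i]]_(\sum_(i < k) r, b)) (d : nat -> R) : Prop :=
  forall i : 'I_k, bigO (fun t => submxcol (M t) i) (d i).

(* Exponent of t in the entry number i (counted from 0, i < k) of delta_k and
   of the reversed vector delta_k^c. *)
Definition delta (R : realType) (rho k i : nat) : R :=
  if (k < rho)%N then 1 - (k - i)%:R / rho%:R
  else if k == rho then i.+1%:R / rho%:R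
  else if i == 0%N then 1 / rho%:R
  else (minn i rho)%:R / rho%:R.

Definition deltac (R : realType) (rho k i : nat) : R := delta R rho k (k - i.+1).

(* [ I 0 ; G 0 ] and [ 0 I ; 0 G ], of width k * r. *)
Definition lead_first (R : pzRingType) (k r q : nat) (G : 'M[R]_(q, r)) :
    'M[R]_(r + q, \sum_(i < k) r) :=
  \mxrow_(b < k) (if b == 0 :> nat then col_mx 1%:M G else 0 : 'M[R]_(r + q, r)).

Definition lead_last (R : pzRingType) (k r q : nat) (G : 'M[R]_(q, r)) :
    'M[R]_(r + q, \sum_(i < k) r) :=
  \mxrow_(b < k) (if b.+1 == k :> nat then col_mx 1%:M G else 0 : 'M[R]_(r + q, r)).

Definition Xdiag (R : realType) (rho r : nat) (t : R) : 'M[R[i]]_(\sum_(i < rho) r) :=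
  \mxdiag_(a < rho)
    (if a == 0 :> nat then 0 else (tpow t (a%:R / rho%:R))%:M : 'M[R[i]]_r).

Definition Xdiagc (R : realType) (rho r : nat) (t : R) : 'M[R[i]]_(\sum_(i < rho) r) :=
  \mxdiag_(a < rho)
    (if a.+1 == rho :> nat then 0
     else (tpow t ((rho - a.+1)%:R / rho%:R))%:M : 'M[R[i]]_r).

Definition perturbed_structured_basis (R : realType) (n m : nat) (s : nat -> nat)
    (H T : 'M[R[i]]_(n + n)) (lambda : R[i])
    (Xi Xic : forall j i : nat, 'M[R[i]]_(n + n, s j)) (rho : nat)
    (tXi tXic : R -> 'M[R[i]]_(n + n, \sum_(i < rho) s rho))
    (tTheta : R -> 'M[R[i]]_(\sum_(i < rho) s rho)) : Prop :=
  [/\ bigO (fun t => tTheta t - Theta rho (- Shat m Xi Xic T rho)) (1 / rho%:R),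
      exists X : forall k : nat, R -> 'M[R[i]]_(\sum_(i < k) s k, \sum_(i < rho) s rho),
        [/\ bigO (fun t => tXi t
                    - (Ups Xi rho (m - rho).+1
                         *m lead_first rho (Ghat m Xi Xic T rho)
                       + \sum_(k < m) grp Xi k.+1 *m X k.+1 t)) 1,
            forall k : nat, (1 <= k <= m)%N -> k <> rho ->
              bigO_rows (X k) (delta R rho k)
          & \forall t \near 0^'+, X rho t = Xdiag rho (s rho) t],
      exists Xc : forall k : nat, R -> 'M[R[i]]_(\sum_(i < k) s k, \sum_(i < rho) s rho),
        [/\ bigO (fun t => tXic t
                    - (Upsc Xic rho (m - rho).+1
                         *m lead_last rho (Ghatc m Xi Xic T rho)
                       + \sum_(k < m) grp Xic k.+1 *m Xc k.+1 t)) 1,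
            forall k : nat, (1 <= k <= m)%N -> k <> rho ->
              bigO_rows (Xc k) (deltac R rho k)
          & bigO_rows (fun t => Xc rho t - Xdiagc rho (s rho) t) (deltac R rho rho)],
      \forall t \near 0^'+,
        let P := row_mx (tXi t) (tXic t) in
        let A := lambda%:M + tpow t (1 / rho%:R) *: tTheta t in
        (H + t%:C *: T) *m P = P *m diag2 A (- A ^t*)
    & \forall t \near 0^'+,
        let P := row_mx (tXi t) (tXic t) in
        P ^t* *m Jmx _ n *m P = tpow t (1 - 1 / rho%:R) *: Jmx _ (\sum_(i < rho) s rho)].

(* [Q ; Q Omega ; ... ; Q Omega^(k-1)], and
   [Omega^(k-1) Q^* ... Omega Q^*  Q^*]^*. *)
Definition Krylov (R : pzRingType) (k r l : nat) (Q : 'M[R]_(r, l)) (Omega : 'M[R]_l) :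
    'M[R]_(\sum_(i < k) r, l) :=
  \mxcol_(a < k) (Q *m Omega ^+ a).

Definition Krylovc (R : realType) (k r l : nat) (Q : 'M[R[i]]_(r, l))
    (Omega : 'M[R[i]]_l) : 'M[R[i]]_(\sum_(i < k) r, l) :=
  (\mxrow_(a < k) (Omega ^+ (k - a.+1) *m Q ^t*)) ^t*.

(* The same two matrices with the block Q (first, resp. last block row)
   replaced by 0. *)
Definition Krylov0 (R : pzRingType) (k r l : nat) (Q : 'M[R]_(r, l)) (Omega : 'M[R]_l) :
    'M[R]_(\sum_(i < k) r, l) :=
  \mxcol_(a < k) (if a == 0 :> nat then 0 else Q *m Omega ^+ a : 'M[R]_(r, l)).

Definition Krylovc0 (R : realType) (k r l : nat) (Q : 'M[R[i]]_(r, l))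
    (Omega : 'M[R[i]]_l) : 'M[R[i]]_(\sum_(i < k) r, l) :=
  (\mxrow_(a < k) (if a.+1 == k :> nat then 0
                   else Omega ^+ (k - a.+1) *m Q ^t* : 'M[R[i]]_(l, r))) ^t*.

(* Main.v *)
Require Import Defs.
From HB Require Import structures.
From mathcomp Require Import zify ring lra.

Set Implicit Arguments.
Unset Strict Implicit.
Unset Printing Implicit Defensive.

Import Order.TTheory GRing.Theory Num.Theory numFieldNormedType.Exports.

Local Open Scope ring_scope.
Local Open Scope complex_scope.
Local Open Scope sesquilinear_scope.
Local Open Scope classical_set_scope.

(** Idea. Put z = t^(1/rho).  In the eigenbasis of H, scaling the coordinate block
    (k, i) of the unknown basis by a suitable power of z, and the equations by
    the complementary power, turns (H + tT) X = X (lambda + z Theta)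
    into A(z) U = E(z) U Theta with A and E polynomial in z.  At z = 0 this system
    is block triangular: the invertibility of Psi_(rho+1) determines the blocks
    k > rho, that of Psi_rho makes Theta_rho(-S) invertible, which determines the
    blocks k < rho.  Hence its linearization, bordered by a normalization of U, is
    injective, and a contraction argument gives a solution for small z.  The basis
    for - conj lambda solves the same problem for - (H + tT), with the blocks of
    each Jordan chain reversed; the two bases are then paired by J, and the isotropy
    relations follow from a Sylvester equation.  The same perturbation lemma, applied
    to Theta~ and to its transpose, gives F~, Fc~ and Omega~. *)

(** The basis [X] itself is a bad unknown: for [rho > 1] only its first block column survives at
    [z = 0], so it has no nondegenerate linearization there. The rescaled [U] is normalized to have
    identity coordinates on the chains of length [rho], which is why the block of [X] at [rho] is an
    exact diagonal of powers of [z]. This uses up the freedom in [X]; the pairing is therefore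
    corrected on the other basis only, whose block at [rho] is diagonal merely up to higher order.
    The exponent of the pairing comes from the reversal: blocks [i] and [rho + 1 - i] carry
    [z^(i-1)] and [z^(rho-i)], with product [z^(rho-1)], whereas for chains of any other length, and
    on the complement, the exponents sum to at least [rho]. After division by [z^(rho-1)] the
    pairing is thus a permutation of blocks plus [O(z)], and correcting it costs no order. Estimates
    carry explicit constants valid for all small [z]; they become orders in [t] only at the end. *)

Section EntrywiseNorm.
Variable R : realType.
Local Notation C := R[i].

(** The modulus [|x|] lives in [R[i]], whose order is only partial; its real part puts all estimates
    in [R], where [lra] and suprema apply. *)
Definition cabs (x : C) : R := complex.Re `|x|.

Lemma norm_cabs (x : C) : `|x| = (cabs x)%:C.
Proof. by case: x => a b. Qed.

Lemma cabs_ge0 (x : C) : 0 <= cabs x.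
Proof. by rewrite -ler0c -norm_cabs normr_ge0. Qed.

Lemma cabsD (x y : C) : cabs (x + y) <= cabs x + cabs y.
Proof. by rewrite -lecR rmorphD /= -!norm_cabs ler_normD. Qed.

Lemma cabsM (x y : C) : cabs (x * y) = cabs x * cabs y.
Proof. by apply: complexI; rewrite rmorphM /= -!norm_cabs normrM. Qed.

Lemma cabsN (x : C) : cabs (- x) = cabs x.
Proof. by rewrite /cabs normrN. Qed.

Lemma cabs0 : cabs 0 = 0.
Proof. by rewrite /cabs normr0. Qed.

Lemma cabs_eq0 (x : C) : cabs x = 0 -> x = 0.
Proof. by move=> x0; apply/normr0_eq0; rewrite norm_cabs x0. Qed.

Lemma cabsR (x : R) : cabs x%:C = `|x|.
Proof. by rewrite /cabs normc_def /= expr0n /= addr0 sqrtr_sqr. Qed.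

Lemma cabsJ (x : C) : cabs (Num.conj x) = cabs x.
Proof. by rewrite /cabs norm_conjC. Qed.

Lemma cabs_sum (I : Type) (r : seq I) (P : pred I) (f : I -> C) :
  cabs (\sum_(i <- r | P i) f i) <= \sum_(i <- r | P i) cabs (f i).
Proof.
elim/big_ind2: _ => [|x a y b xa yb|//]; first by rewrite cabs0.
exact: le_trans (cabsD _ _) (lerD xa yb).
Qed.

Lemma Re_le_cabs (x : C) : `|complex.Re x| <= cabs x.
Proof.
rewrite /cabs normc_def /= -sqrtr_sqr ler_sqrt ?addr_ge0 ?sqr_ge0 //.
by rewrite lerDl sqr_ge0.
Qed.

Lemma Im_le_cabs (x : C) : `|complex.Im x| <= cabs x.
Proof.
rewrite /cabs normc_def /= -sqrtr_sqr ler_sqrt ?addr_ge0 ?sqr_ge0 //.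
by rewrite lerDr sqr_ge0.
Qed.

Lemma cabs_le_ReIm (x : C) : cabs x <= `|complex.Re x| + `|complex.Im x|.
Proof.
rewrite {1}[x]complexE -(cabsR (complex.Re x)) -(cabsR (complex.Im x)).
apply: le_trans (cabsD _ _) _; rewrite cabsM lerD2l.
by rewrite /cabs normc_def /= expr0n /= add0r expr1n sqrtr1 mul1r.
Qed.

(** Unlike the maximum norm of [bigO], the sum is submultiplicative without a dimension factor and
    additive on [col_mx]; it dominates every entry, which is all that [bigO] asks. *)
Definition nrm (a b : nat) (A : 'M[C]_(a, b)) : R := \sum_i \sum_j cabs (A i j).

Lemma nrm_ge0 a b (A : 'M[C]_(a, b)) : 0 <= nrm A.
Proof. by do 2 (apply: sumr_ge0 => ? _); apply: cabs_ge0. Qed.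

Lemma nrm_entry a b (A : 'M[C]_(a, b)) i j : cabs (A i j) <= nrm A.
Proof.
rewrite /nrm (bigD1 i) //= (bigD1 j) //= -addrA lerDl addr_ge0 //.
  by apply: sumr_ge0 => ? _; apply: cabs_ge0.
by do 2 (apply: sumr_ge0 => ? _); apply: cabs_ge0.
Qed.

Lemma nrm0 a b : nrm (0 : 'M[C]_(a, b)) = 0.
Proof. by rewrite /nrm !big1 // => i _; rewrite big1 // => j _; rewrite mxE cabs0. Qed.

Lemma nrm0_eq a b (A : 'M[C]_(a, b)) : nrm A <= 0 -> A = 0.
Proof.
move=> A0; apply/matrixP => i j; rewrite mxE; apply: cabs_eq0.
by apply/eqP; rewrite eq_le cabs_ge0 andbT (le_trans (nrm_entry A i j)).
Qed.

Lemma nrmD a b (A B : 'M[C]_(a, b)) : nrm (A + B) <= nrm A + nrm B.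
Proof.
rewrite /nrm -big_split ler_sum //= => i _; rewrite -big_split ler_sum //= => j _.
by rewrite mxE cabsD.
Qed.

Lemma nrmN a b (A : 'M[C]_(a, b)) : nrm (- A) = nrm A.
Proof. by do 2 (apply: eq_bigr => ? _); rewrite mxE cabsN. Qed.

Lemma nrmB a b (A B : 'M[C]_(a, b)) : nrm (A - B) <= nrm A + nrm B.
Proof. by rewrite -(nrmN B) nrmD. Qed.

Lemma nrmBC a b (A B : 'M[C]_(a, b)) : nrm (A - B) = nrm (B - A).
Proof. by rewrite -nrmN opprB. Qed.

Lemma nrmZ a b (x : C) (A : 'M[C]_(a, b)) : nrm (x *: A) = cabs x * nrm A.
Proof.
rewrite mulr_sumr; apply: eq_bigr => i _.
by rewrite mulr_sumr; apply: eq_bigr => j _; rewrite mxE cabsM.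
Qed.

Lemma nrm_sum (I : Type) (r : seq I) (P : pred I) a b (f : I -> 'M[C]_(a, b)) :
  nrm (\sum_(i <- r | P i) f i) <= \sum_(i <- r | P i) nrm (f i).
Proof.
elim/big_ind2: _ => [|x u y v xu yv|//]; first by rewrite nrm0.
exact: le_trans (nrmD _ _) (lerD xu yv).
Qed.

Lemma nrmM a b c (A : 'M[C]_(a, b)) (B : 'M[C]_(b, c)) :
  nrm (A *m B) <= nrm A * nrm B.
Proof.
have row_le i k : cabs (A i k) * (\sum_j cabs (B k j)) <= cabs (A i k) * nrm B.
  rewrite ler_wpM2l ?cabs_ge0 // /nrm [leRHS](bigD1 k) //= lerDl.
  by do 2 (apply: sumr_ge0 => ? _); apply: cabs_ge0.
rewrite [leRHS]mulr_suml ler_sum // => i _.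
apply: (@le_trans _ _ (\sum_j \sum_k cabs (A i k) * cabs (B k j))).
  apply: ler_sum => j _; rewrite mxE (le_trans (cabs_sum _ _ _)) //.
  by apply: ler_sum => k _; rewrite cabsM.
rewrite exchange_big mulr_suml ler_sum //= => k _.
by rewrite -mulr_sumr row_le.
Qed.

Lemma nrm_tr a b (A : 'M[C]_(a, b)) : nrm A^T = nrm A.
Proof.
by rewrite /nrm exchange_big; do 2 (apply: eq_bigr => ? _); rewrite mxE.
Qed.

Lemma nrm_conj a b (A : 'M[C]_(a, b)) : nrm (map_mx Num.conj A) = nrm A.
Proof. by do 2 (apply: eq_bigr => ? _); rewrite mxE cabsJ. Qed.

Lemma nrm_adj a b (A : 'M[C]_(a, b)) : nrm (A ^t*) = nrm A.
Proof. by rewrite nrm_conj nrm_tr. Qed.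

Lemma nrm_col_mx a b c (A : 'M[C]_(a, c)) (B : 'M[C]_(b, c)) :
  nrm (col_mx A B) = nrm A + nrm B.
Proof.
rewrite /nrm big_split_ord /=; congr (_ + _); apply: eq_bigr => i _;
  by apply: eq_bigr => j _; rewrite ?col_mxEu ?col_mxEd.
Qed.

Lemma nrm_usubmx a b c (A : 'M[C]_(a + b, c)) : nrm (usubmx A) <= nrm A.
Proof. by rewrite -[in leRHS](vsubmxK A) nrm_col_mx lerDl nrm_ge0. Qed.

Lemma nrm_dsubmx a b c (A : 'M[C]_(a + b, c)) : nrm (dsubmx A) <= nrm A.
Proof. by rewrite -[in leRHS](vsubmxK A) nrm_col_mx lerDr nrm_ge0. Qed.

Lemma nrm_linear_bound a b c d (g : {linear 'M[C]_(a, b) -> 'M[C]_(c, d)}) :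
  exists2 k : R, 0 <= k & forall v, nrm (g v) <= k * nrm v.
Proof.
exists (\sum_i \sum_j nrm (g (delta_mx i j))).
  by do 2 (apply: sumr_ge0 => ? _); apply: nrm_ge0.
move=> v; rewrite {1}[v]matrix_sum_delta linear_sum (le_trans (nrm_sum _ _ _)) //.
rewrite mulr_suml ler_sum // => i _; rewrite linear_sum (le_trans (nrm_sum _ _ _)) //.
rewrite mulr_suml ler_sum // => j _; rewrite linearZ /= nrmZ mulrC.
by rewrite ler_wpM2l ?nrm_ge0 ?nrm_entry.
Qed.

(** Finite dimension makes an injective endomorphism bijective. The inverse is returned as a linear
    map so that [nrm_linear_bound] bounds it. *)
Lemma injective_linear_inverse a b (g : {linear 'M[C]_(a, b) -> 'M[C]_(a, b)}) :
  (forall v, g v = 0 -> v = 0) ->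
  exists h : {linear 'M[C]_(a, b) -> 'M[C]_(a, b)}, cancel h g.
Proof.
move=> g_inj; have ker0 : lker (linfun g) == 0%VS.
  apply/lker0P => u v; rewrite !lfunE /= => guv.
  by apply/eqP; rewrite -subr_eq0; apply/eqP/g_inj; rewrite linearB /= guv subrr.
exists ((linfun g)^-1)%VF => v.
by have := lker0_lfunVK ker0 v; rewrite lfunE.
Qed.

End EntrywiseNorm.

Lemma addmxE (V : nmodType) a b (A B : 'M[V]_(a, b)) i j : (A + B) i j = A i j + B i j.
Proof. by rewrite mxE. Qed.

Lemma oppmxE (V : zmodType) a b (A : 'M[V]_(a, b)) i j : (- A) i j = - A i j.
Proof. by rewrite mxE. Qed.

Lemma scalemxE (V : pzRingType) a b (x : V) (A : 'M[V]_(a, b)) i j :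
  (x *: A) i j = x * A i j.
Proof. by rewrite mxE. Qed.

Lemma zeromxE (V : nmodType) a b i j : (0 : 'M[V]_(a, b)) i j = 0.
Proof. by rewrite mxE. Qed.

(* Expanding only the module structure keeps matrix products as atoms of [ring]. *)
Ltac mx_module :=
  let i := fresh "i" in let j := fresh "j" in
  apply/matrixP => i j; rewrite !(addmxE, oppmxE, scalemxE, zeromxE); ring.

(** * Contraction fixed points for complex matrices *)

Section FixedPoint.
Variable R : realType.
Local Notation C := R[i].

(** Archimedean property: a positive [y] would force [2 ^+ n <= K / y] for all [n]. *)
Lemma le_geometric0 (y K : R) : (forall n, y <= K * 2^-1 ^+ n) -> y <= 0.
Proof.
move=> yK; rewrite leNgt; apply/negP => y_gt0.
have K_gt0 : 0 < K by have := yK 0%N; rewrite expr0 mulr1; apply: lt_le_trans.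
have := upper_nthrootP (leqnn (Num.bound (K / y))); set n := Num.bound _.
rewrite ltNge => /negP; apply.
by rewrite ler_pdivlMr // mulrC -ler_pdivlMr ?exprn_gt0 // -exprVn yK.
Qed.

(** Nested intervals: [q n] is the tail of the geometric series, so the intervals
    [[u n - q n, u n + q n]] decrease, and the supremum of their left ends is the limit. *)
Lemma geometric_limit (u : nat -> R) (c : R) :
  (forall n, `|u n.+1 - u n| <= c * 2^-1 ^+ n) ->
  exists l, forall n, `|u n - l| <= 2 * c * 2^-1 ^+ n.
Proof.
move=> du; pose q n := 2 * c * 2^-1 ^+ n.
have c_ge0 : 0 <= c by apply: le_trans (normr_ge0 _) _; rewrite -[c]mulr1; apply: (du 0%N).
have q_ge0 n : 0 <= q n by rewrite !mulr_ge0 ?exprn_ge0 // invr_ge0.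
have qS n : q n = q n.+1 + c * 2^-1 ^+ n by rewrite /q exprS; field.
have dul n := le_trans (ler_norm _) (du n).
have dur n := le_trans (ler_norm _) (eq_ind_r (fun y => y <= _) (du n) (distrC _ _)).
have lo : {homo (fun n => u n - q n) : i j / (i <= j)%N >-> i <= j}.
  apply: homo_leq => [x|y x z|n]; [exact: lexx|exact: le_trans|].
  by have := dur n; have := qS n; lra.
have hi : {homo (fun n => u n + q n) : i j / (i <= j)%N >-> j <= i}.
  apply: (homo_leq (r := fun x y => y <= x)) => [x|y x z yx zy|n]; [exact: lexx|exact: le_trans zy yx|].
  by have := dul n; have := qS n; lra.
have lohi n k : u n - q n <= u k + q k.
  have := lo _ _ (leq_maxl n k); have := hi _ _ (leq_maxr n k).
  by have := q_ge0 (maxn n k); lra.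
pose E := [set u n - q n | n in [set: nat]].
have supE : has_sup E.
  split; first by exists (u 0%N - q 0%N), 0%N.
  by exists (u 0%N + q 0%N) => _ [n _ <-].
exists (sup E) => n; rewrite ler_norml; apply/andP; split.
  have : sup E <= u n + q n by apply: ge_sup => [|_ [k _ <-]]; [case: supE | apply: lohi].
  by rewrite -/(q n); lra.
have : u n - q n <= sup E by apply: ub_le_sup; [case: supE | exists n].
by rewrite -/(q n); lra.
Qed.

(** The iterates from [0] have geometric increments; the limit is taken in the real and imaginary
    part of each entry, so that only order completeness of [R] is involved. *)
Lemma contraction_fixpoint (a b : nat) (f : 'M[C]_(a, b) -> 'M[C]_(a, b)) (r : R) :
  0 <= r ->
  (forall x, nrm x <= r -> nrm (f x) <= r) ->
  (forall x y, nrm x <= r -> nrm y <= r -> nrm (f x - f y) <= 2^-1 * nrm (x - y)) ->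
  exists2 x, nrm x <= r & f x = x.
Proof.
move=> r0 f_ball f_contr; pose x n := iter n f 0.
have x_ball n : nrm (x n) <= r by elim: n => [|n IHn] /=; rewrite ?nrm0 //; apply: f_ball.
have dx n : nrm (x n.+1 - x n) <= r * 2^-1 ^+ n.
  elim: n => [|n IHn]; first by rewrite expr0 mulr1 subr0; apply: (x_ball 1%N).
  apply: (le_trans (f_contr _ _ (x_ball n.+1) (x_ball n))).
  by rewrite exprS mulrCA ler_wpM2l // invr_ge0.
have limRe i j : exists l, forall n, `|complex.Re (x n i j) - l| <= 2 * r * 2^-1 ^+ n.
  apply: geometric_limit => n; apply: le_trans (dx n).
  apply: le_trans (nrm_entry _ i j); rewrite !mxE -raddfB.
  exact: Re_le_cabs.
have limIm i j : exists l, forall n, `|complex.Im (x n i j) - l| <= 2 * r * 2^-1 ^+ n.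
  apply: geometric_limit => n; apply: le_trans (dx n).
  apply: le_trans (nrm_entry _ i j); rewrite !mxE -raddfB.
  exact: Im_le_cabs.
pose y := \matrix_(i, j) (projT1 (cid (limRe i j)) +i* projT1 (cid (limIm i j)))%C.
pose K := \sum_(i < a) \sum_(j < b) (2 * r + 2 * r).
have xy n : nrm (x n - y) <= K * 2^-1 ^+ n.
  rewrite mulr_suml ler_sum // => i _; rewrite mulr_suml ler_sum // => j _.
  apply: le_trans (cabs_le_ReIm _) _; rewrite mulrDl lerD // !mxE raddfB /=.
    by case: cid => l /=.
  by case: cid => l /=.
have y_ball : nrm y <= r.
  rewrite -subr_le0; apply: (@le_geometric0 _ K) => n.
  have := nrmB (x n) (x n - y); rewrite opprB addrC subrK.
  by have := xy n; have := x_ball n; lra.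
(* [f y - y] is split into [f y - f (x n)] and [x n.+1 - y], both geometrically small. *)
exists y => //; apply/eqP; rewrite -subr_eq0; apply/eqP/nrm0_eq.
apply: (@le_geometric0 _ (K + K)) => n.
have := nrmB (f y - f (x n)) (y - x n.+1).
rewrite (_ : f y - f (x n) - (y - x n.+1) = f y - y); last first.
  by rewrite /x /= -/(x n) opprB addrA subrK.
have := f_contr _ _ y_ball (x_ball n); rewrite (nrmBC y (x n)) (nrmBC y (x n.+1)).
have := xy n; have := xy n.+1; rewrite exprS.
have : 0 <= K * 2^-1 ^+ n by apply: le_trans (xy n); apply: nrm_ge0.
set A := 2^-1 ^+ n; lra.
Qed.

(* Neumann series, without the series: a row vector fixed by [1 - A] vanishes. *)
Lemma unitmx_near1 (a : nat) (A : 'M[C]_a) (e : R) :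
  nrm (A - 1%:M) <= e -> e <= 2^-1 ->
  A \in unitmx /\ nrm (invmx A - 1%:M) <= 2 * e.
Proof.
move=> Ae e2; have uA : A \in unitmx.
  rewrite -row_free_unit; apply/row_freeP; apply/row_freeP/inj_row_free => v vA.
  apply: nrm0_eq; have : nrm v <= nrm v * nrm (A - 1%:M).
    by apply: le_trans (nrmM _ _); rewrite mulmxBr mulmx1 vA sub0r nrmN.
  by have := nrm_ge0 v; nra.
split=> //; set x := nrm _.
have : x <= x * nrm (A - 1%:M) + nrm (A - 1%:M).
  rewrite {1}/x (_ : _ - _ = (invmx A - 1%:M) *m (1%:M - A) + (1%:M - A)); last first.
    by rewrite mulmxBl mul1mx mulmxBr mulmx1 mulVmx // subrK.
  by apply: le_trans (nrmD _ _) _; rewrite (nrmBC 1%:M A) lerD2r -(nrmBC 1%:M A) nrmM.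
have : x * nrm (A - 1%:M) <= x * 2^-1.
  by rewrite ler_wpM2l ?nrm_ge0 // (le_trans Ae).
lra.
Qed.

End FixedPoint.

(** * Perturbation of the equation A U = E U Theta *)

Section DeflatingAlgebra.
Variables (K : comNzRingType) (r q : nat).

(** For [B = E *m U] this is the derivative of [(U, Th) |-> (A U - E U Th, W U)] in the direction
    [(Y, M)], stacked as [v]. Stacking makes domain and codomain the same space, so injectivity
    gives invertibility. *)
Definition bordered_sylvester (A E : 'M[K]_r) (B : 'M[K]_(r, q)) (Th : 'M[K]_q)
    (W : 'M[K]_(q, r)) (v : 'M[K]_(r + q, q)) : 'M[K]_(r + q, q) :=
  col_mx (A *m usubmx v - E *m usubmx v *m Th - B *m dsubmx v) (W *m usubmx v).

Lemma bordered_sylvester_is_linear A E B Th W :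
  linear (bordered_sylvester A E B Th W).
Proof.
move=> a u v; rewrite /bordered_sylvester.
have -> : usubmx (a *: u + v) = a *: usubmx u + usubmx v by rewrite linearP.
have -> : dsubmx (a *: u + v) = a *: dsubmx u + dsubmx v by rewrite linearP.
rewrite !(mulmxDr, mulmxDl) -!(scalemxAr, scalemxAl) scale_col_mx add_col_mx.
by congr col_mx; mx_module.
Qed.

HB.instance Definition _ A E B Th W :=
  GRing.isLinear.Build K 'M[K]_(r + q, q) 'M[K]_(r + q, q) *:%R
    (bordered_sylvester A E B Th W) (bordered_sylvester_is_linear A E B Th W).

Definition bordered_injective (A E : 'M[K]_r) (B : 'M[K]_(r, q)) (Th : 'M[K]_q)
    (W : 'M[K]_(q, r)) := forall (Y : 'M[K]_(r, q)) (M : 'M[K]_q),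
  A *m Y - E *m Y *m Th - B *m M = 0 -> W *m Y = 0 -> Y = 0 /\ M = 0.

Variables (A0 E0 A E : 'M[K]_r) (U0 : 'M[K]_(r, q)) (Th0 : 'M[K]_q).

(** What remains of the equation at [(U0 + Y, Th0 + M)] beyond the operator at [(A0, E0)]: the
    initial defect, linear terms with the small factors [A - A0] and [E - E0], and one quadratic
    term. *)
Definition deflating_rem (Y : 'M[K]_(r, q)) (M : 'M[K]_q) : 'M[K]_(r, q) :=
  (A - A0) *m U0 - (E - E0) *m U0 *m Th0
  + ((A - A0) *m Y - (E - E0) *m Y *m Th0 - (E - E0) *m U0 *m M)
  - E *m Y *m M.

Lemma deflating_rem0 :
  deflating_rem 0 0 = (A - A0) *m U0 - (E - E0) *m (U0 *m Th0).
Proof. by rewrite /deflating_rem !(mulmx0, mul0mx) !subr0 addr0 mulmxA. Qed.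

Lemma deflating_remB Y M Y' M' :
  deflating_rem Y M - deflating_rem Y' M' =
  (A - A0) *m (Y - Y') - (E - E0) *m ((Y - Y') *m Th0)
  - (E - E0) *m (U0 *m (M - M')) - E *m ((Y - Y') *m M + Y' *m (M - M')).
Proof.
rewrite /deflating_rem !(mulmxDl, mulmxDr, mulmxN, mulNmx) !mulmxA.
by mx_module.
Qed.

Lemma deflating_split Y M :
  A *m (U0 + Y) - E *m (U0 + Y) *m (Th0 + M) =
  A0 *m Y - E0 *m Y *m Th0 - E0 *m U0 *m M + deflating_rem Y M
  + (A0 *m U0 - E0 *m U0 *m Th0).
Proof.
rewrite /deflating_rem !(mulmxDl, mulmxDr, mulmxN, mulNmx).
by mx_module.
Qed.

End DeflatingAlgebra.

Section DeflatingPerturbation.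
Variable R : realType.
Local Notation C := R[i].

Lemma bordered_sylvester_inverse (r q : nat) (A E : 'M[C]_r) (B : 'M[C]_(r, q))
    (Th : 'M[C]_q) (W : 'M[C]_(q, r)) : bordered_injective A E B Th W ->
  exists h : {linear 'M[C]_(r + q, q) -> 'M[C]_(r + q, q)},
    cancel h (bordered_sylvester A E B Th W).
Proof.
move=> inj; apply: injective_linear_inverse => v.
rewrite -[0]vsubmxK !linear0 => /eq_col_mx[Y0 WY].
by have [v1 v2] := inj _ _ Y0 WY; rewrite -[v]vsubmxK v1 v2 col_mx0.
Qed.

(** Newton's method with the derivative frozen at the unperturbed data: if [h] inverts the bordered
    operator, solutions are fixed points of [v |-> - h (rem0 v)]. The normalization by [W] removes
    the freedom [U |-> U S] and is preserved exactly. *)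
Lemma deflating_perturbation (r q : nat) (A0 E0 : 'M[C]_r) (U0 : 'M[C]_(r, q))
    (Th0 : 'M[C]_q) (W : 'M[C]_(q, r)) :
  A0 *m U0 = E0 *m U0 *m Th0 -> W *m U0 = 1%:M ->
  bordered_injective A0 E0 (E0 *m U0) Th0 W ->
  exists e0 k : R, [/\ 0 < e0, 0 <= k &
    forall (e : R) (A E : 'M[C]_r),
      e <= e0 -> nrm (A - A0) <= e -> nrm (E - E0) <= e ->
      exists (U : 'M[C]_(r, q)) (Th : 'M[C]_q),
        [/\ A *m U = E *m U *m Th, W *m U = 1%:M, nrm (U - U0) <= k * e
          & nrm (Th - Th0) <= k * e]].
Proof.
move=> AU0 WU0 /bordered_sylvester_inverse[h hK].
have [k k_ge0 h_le] := nrm_linear_bound h.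
set u := nrm U0; set th := nrm Th0; set ep := nrm E0.
have [u_ge0 th_ge0 ep_ge0] : [/\ 0 <= u, 0 <= th & 0 <= ep] by split; apply: nrm_ge0.
(* [e * c1] and [c2 * rho] bound the Lipschitz constants of the linear and quadratic parts of the
   remainder, [e * c3] its value at [0]. *)
pose c1 := 1 + th + u; pose c2 := 2 * (ep + 1); pose c3 := u + u * th.
have c1_ge0 : 0 <= c1 by rewrite /c1; lra.
have c2_ge0 : 0 <= c2 by rewrite /c2; lra.
have c3_ge0 : 0 <= c3 by rewrite /c3 addr_ge0 // mulr_ge0.
pose c := k * (c1 + c2 * (2 * k * c3)).
have c_ge0 : 0 <= c by rewrite /c !(mulr_ge0, addr_ge0).
(* This [e0] gives both [c * e <= 1 / 2] and [e <= 1]. The radius [2 k c3 e] is twice the bound on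
   the image of [0], so a map with Lipschitz constant [1 / 2] preserves the ball. *)
exists (2 * (c + 1))^-1, (2 * k * c3); split; [by rewrite invr_gt0; lra|by rewrite !mulr_ge0|].
move=> e A E e_le dA dE.
have e_ge0 : 0 <= e by apply: le_trans dA; apply: nrm_ge0.
have ce : c * e <= 2^-1.
  apply: le_trans (ler_wpM2l c_ge0 e_le) _.
  by rewrite ler_pdivrMr; lra.
have e_le1 : e <= 1.
  by apply: le_trans e_le _; rewrite invf_le1; lra.
have E_le : nrm E <= ep + 1.
  by rewrite -[E](subrK E0) (le_trans (nrmD _ _)) // -/ep; lra.
pose rem v := deflating_rem A0 E0 A E U0 Th0 (usubmx v) (dsubmx v).
pose rem0 v : 'M[C]_(r + q, q) := col_mx (rem v) 0.
pose rho := 2 * k * c3 * e.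
have rho_ge0 : 0 <= rho by rewrite !mulr_ge0.
have rem_0 : nrm (rem0 0) <= e * c3.
  rewrite nrm_col_mx nrm0 addr0 /rem !linear0 deflating_rem0.
  apply: le_trans (nrmB _ _) _; rewrite /c3 mulrDr lerD //.
    by rewrite (le_trans (nrmM _ _)) // ler_wpM2r.
  by rewrite (le_trans (nrmM _ _)) // ler_pM ?nrm_ge0 // nrmM.
have rem_lip v w : nrm v <= rho -> nrm w <= rho ->
    nrm (rem0 v - rem0 w) <= (e * c1 + c2 * rho) * nrm (v - w).
  move=> v_le w_le; set d := nrm (v - w).
  have d_ge0 : 0 <= d by apply: nrm_ge0.
  set Y := usubmx (v - w); set M := dsubmx (v - w).
  have Y_le : nrm Y <= d by apply: nrm_usubmx.
  have M_le : nrm M <= d by apply: nrm_dsubmx.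
  have mv_le : nrm (dsubmx v) <= rho by apply: le_trans v_le; apply: nrm_dsubmx.
  have yw_le : nrm (usubmx w) <= rho by apply: le_trans w_le; apply: nrm_usubmx.
  rewrite opp_col_mx add_col_mx nrm_col_mx subr0 nrm0 addr0.
  rewrite /rem deflating_remB -!linearB /= -/Y -/M.
  have t1 : nrm ((A - A0) *m Y) <= e * d.
    by rewrite (le_trans (nrmM _ _)) // ler_pM ?nrm_ge0.
  have t2 : nrm ((E - E0) *m (Y *m Th0)) <= e * (d * th).
    rewrite (le_trans (nrmM _ _)) // ler_pM ?nrm_ge0 //.
    by rewrite (le_trans (nrmM _ _)) // ler_wpM2r.
  have t3 : nrm ((E - E0) *m (U0 *m M)) <= e * (u * d).
    rewrite (le_trans (nrmM _ _)) // ler_pM ?nrm_ge0 //.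
    by rewrite (le_trans (nrmM _ _)) // ler_wpM2l.
  have t4 : nrm (E *m (Y *m dsubmx v + usubmx w *m M)) <= (ep + 1) * (d * rho + rho * d).
    rewrite (le_trans (nrmM _ _)) // ler_pM ?nrm_ge0 // (le_trans (nrmD _ _)) // lerD //.
      by rewrite (le_trans (nrmM _ _)) // ler_pM ?nrm_ge0.
    by rewrite (le_trans (nrmM _ _)) // ler_pM ?nrm_ge0.
  apply: le_trans (nrmB _ _) _; apply: le_trans (lerD (nrmB _ _) (lexx _)) _.
  apply: le_trans (lerD (lerD (nrmB _ _) (lexx _)) (lexx _)) _.
  apply: le_trans (lerD (lerD (lerD t1 t2) t3) t4) _.
  by rewrite le_eqVlt /c1 /c2; apply/orP; left; apply/eqP; ring.
pose f v := - h (rem0 v).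
have f_lip v w : nrm v <= rho -> nrm w <= rho -> nrm (f v - f w) <= 2^-1 * nrm (v - w).
  move=> v_le w_le.
  have -> : f v - f w = - h (rem0 v - rem0 w) by rewrite linearB /f opprB opprK addrC.
  rewrite nrmN.
  apply: le_trans (h_le _) _; apply: le_trans (ler_wpM2l k_ge0 (rem_lip _ _ v_le w_le)) _.
  rewrite mulrA ler_wpM2r ?nrm_ge0 //.
  by apply: le_trans ce; rewrite /rho /c; lra.
have f_ball v : nrm v <= rho -> nrm (f v) <= rho.
  move=> v_le; have := f_lip v 0 v_le; rewrite nrm0 subr0 => /(_ rho_ge0) d1.
  have d2 : nrm (f 0) <= k * (e * c3).
    by rewrite nrmN (le_trans (h_le _)) // ler_wpM2l.
  rewrite -[f v](subrK (f 0)) (le_trans (nrmD _ _)) //.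
  by rewrite /rho in v_le *; lra.
have [v v_le fv] := contraction_fixpoint rho_ge0 f_ball f_lip.
have : bordered_sylvester A0 E0 (E0 *m U0) Th0 W v = - rem0 v.
  by rewrite -[in LHS]fv linearN /= hK.
rewrite opp_col_mx oppr0 => /eq_col_mx[eq1 eq2].
exists (U0 + usubmx v), (Th0 + dsubmx v); split.
- apply/eqP; rewrite -subr_eq0; apply/eqP.
  rewrite (deflating_split A0 E0).
  by rewrite eq1 AU0 subrr addr0 addNr.
- by rewrite mulmxDr WU0 eq2 addr0.
- by rewrite [U0 + _]addrC addrK (le_trans (nrm_usubmx _)).
- by rewrite [Th0 + _]addrC addrK (le_trans (nrm_dsubmx _)).
Qed.

End DeflatingPerturbation.

(** * Scaling in the eigenbasis *)

Section Frame.
Variables (K : comNzRingType) (r m : nat) (s : nat -> nat).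
Variables (Xi : forall j i : nat, 'M[K]_(r, s j)) (W : forall j i : nat, 'M[K]_(s j, r)).

Definition is_block (m k i : nat) := (1 <= i)%N && (i <= k <= m)%N.

(** The blocks [Xi k i] need not span, so the coordinates [W k i] are data rather than an inverse.
    The cases are separate because an identity block is well typed only within one [k]. *)
Definition biorthogonal :=
  (forall k i i', is_block m k i -> is_block m k i' ->
     W k i *m Xi k i' = if i == i' then 1%:M else 0) /\
  (forall k i k' i', is_block m k i -> is_block m k' i' -> k != k' ->
     W k i *m Xi k' i' = 0).

Definition frame_sum q (y : forall k i : nat, 'M[K]_(s k, q)) : 'M[K]_(r, q) :=
  \sum_(k < m) \sum_(i < k.+1) Xi k.+1 i.+1 *m y k.+1 i.+1.

(** A diagonal operator: [phi k i] on the block [Xi k i] and [c] on the common kernel of the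
    [W k i]. All scalings by powers of [z] have this form and multiply pointwise. *)
Definition frame_diag (phi : nat -> nat -> K) (c : K) : 'M[K]_r :=
  c%:M + frame_sum (fun k i => (phi k i - c) *: W k i).

(** The projector onto the common kernel of the coordinates, along the span of the blocks. *)
Definition frame_compl := frame_diag (fun _ _ => 0) 1.

Hypothesis dual : biorthogonal.

Lemma is_block_ord (k : 'I_m) (i : 'I_k.+1) : is_block m k.+1 i.+1.
Proof. by rewrite /is_block /= !ltn_ord. Qed.

Lemma frame_sum_coord q (y : forall k i : nat, 'M[K]_(s k, q)) k i :
  is_block m k i -> W k i *m frame_sum y = y k i.
Proof.
case: dual => dual_same dual_diff; rewrite /frame_sum mulmx_sumr.
case: k => [|k]; first by rewrite /is_block; lia.
case: i => [|i] // Bki; have [/andP[_ /andP[ik km]]] := (Bki, Bki).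
rewrite (bigD1 (Ordinal km)) //= [X in _ + X]big1 ?addr0 => [|k' k'k]; last first.
  rewrite mulmx_sumr big1 // => i' _; rewrite mulmxA dual_diff ?mul0mx ?is_block_ord //.
  by apply: contra_neq k'k => -[kk']; apply: val_inj.
rewrite mulmx_sumr (bigD1 (Ordinal ik)) //= big1 ?addr0 => [|i' i'i].
  by rewrite mulmxA dual_same // eqxx mul1mx.
rewrite mulmxA dual_same //; last first.
  by rewrite /is_block /= km andbT; have := ltn_ord i'.
case: eqP => [[ii']|]; last by rewrite mul0mx.
by case/eqP: i'i; apply: val_inj.
Qed.

Lemma frame_sumZ q (y : forall k i : nat, 'M[K]_(s k, q)) (c : K) :
  frame_sum (fun k i => c *: y k i) = c *: frame_sum y.
Proof.
rewrite /frame_sum scaler_sumr; apply: eq_bigr => k _; rewrite scaler_sumr.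
by apply: eq_bigr => i _; rewrite -scalemxAr.
Qed.

Lemma eq_frame_sum q (y y' : forall k i : nat, 'M[K]_(s k, q)) :
  (forall k i, is_block m k i -> y k i = y' k i) -> frame_sum y = frame_sum y'.
Proof.
move=> yy'; apply: eq_bigr => k _; apply: eq_bigr => i _.
by rewrite yy' ?is_block_ord.
Qed.

Lemma frame_sum_mul q q' (y : forall k i : nat, 'M[K]_(s k, q)) (B : 'M[K]_(q, q')) :
  frame_sum y *m B = frame_sum (fun k i => y k i *m B).
Proof.
rewrite /frame_sum mulmx_suml; apply: eq_bigr => k _; rewrite mulmx_suml.
by apply: eq_bigr => i _; rewrite mulmxA.
Qed.

Lemma frame_sumB q (y y' : forall k i : nat, 'M[K]_(s k, q)) :
  frame_sum y - frame_sum y' = frame_sum (fun k i => y k i - y' k i).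
Proof.
rewrite /frame_sum -sumrB; apply: eq_bigr => k _; rewrite -sumrB.
by apply: eq_bigr => i _; rewrite mulmxBr.
Qed.

Lemma frame_compl_mul q (A : 'M[K]_(r, q)) :
  frame_compl *m A = A - frame_sum (fun k i => W k i *m A).
Proof.
rewrite /frame_compl /frame_diag mulmxDl mul1mx frame_sum_mul; congr (_ + _).
rewrite -scaleN1r -frame_sumZ; apply: eq_frame_sum => k i _.
by rewrite sub0r -scalemxAl.
Qed.

Lemma frame_decomp q (A : 'M[K]_(r, q)) :
  A = frame_sum (fun k i => W k i *m A) + frame_compl *m A.
Proof. by rewrite frame_compl_mul addrC subrK. Qed.

Lemma frame_ext q (A B : 'M[K]_(r, q)) :
  (forall k i, is_block m k i -> W k i *m A = W k i *m B) ->
  frame_compl *m A = frame_compl *m B -> A = B.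
Proof.
move=> WAB PAB; rewrite [A]frame_decomp [B]frame_decomp PAB; congr (_ + _).
exact: eq_frame_sum.
Qed.

Lemma frame_diag_coord phi c k i :
  is_block m k i -> W k i *m frame_diag phi c = phi k i *: W k i.
Proof.
move=> Bki; rewrite /frame_diag mulmxDr frame_sum_coord // mul_mx_scalar.
by rewrite -scalerDl addrC subrK.
Qed.

Lemma frame_compl_coord k i : is_block m k i -> W k i *m frame_compl = 0.
Proof. by move=> Bki; rewrite frame_diag_coord // scale0r. Qed.

Lemma frame_compl_sum q (y : forall k i : nat, 'M[K]_(s k, q)) :
  frame_compl *m frame_sum y = 0.
Proof.
rewrite frame_compl_mul (eq_frame_sum (y' := y)) ?subrr // => k i Bki.
by rewrite frame_sum_coord.
Qed.

Lemma frame_compl_diag phi c : frame_compl *m frame_diag phi c = c *: frame_compl.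
Proof.
by rewrite mulmxDr frame_compl_sum addr0 mul_mx_scalar.
Qed.

Lemma frame_diag_scalar c : frame_diag (fun _ _ => c) c = c%:M.
Proof.
rewrite /frame_diag (eq_frame_sum (y' := fun k i => 0 *: W k i)) => [|k i _].
  by rewrite frame_sumZ scale0r addr0.
by rewrite subrr.
Qed.

Lemma frame_diagM phi c psi d :
  frame_diag phi c *m frame_diag psi d = frame_diag (fun k i => phi k i * psi k i) (c * d).
Proof.
apply: frame_ext => [k i Bki|].
  by rewrite mulmxA !frame_diag_coord // -scalemxAl frame_diag_coord // scalerA.
by rewrite mulmxA !frame_compl_diag -scalemxAl frame_compl_diag scalerA.
Qed.

Lemma eq_frame_diag phi psi c : (forall k i, is_block m k i -> phi k i = psi k i) ->
  frame_diag phi c = frame_diag psi c.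
Proof.
by move=> e; congr (_ + _); apply: eq_frame_sum => k i Bki; rewrite e.
Qed.

Section Jordan.
Variables (H T : 'M[K]_r) (lam : K) (rho : nat).

Definition jordan_frame :=
  (forall k i, is_block m k i ->
     W k i *m H = lam *: W k i + (if (i < k)%N then W k i.+1 else 0)) /\
  (forall k i, is_block m k i ->
     H *m Xi k i = lam *: Xi k i + (if (1 < i)%N then Xi k i.-1 else 0)).

Hypothesis jordan : jordan_frame.

(** Multiplying the sum of [Xi k i *m W k i] by [H] on the right raises the index of [W], on the
    left lowers that of [Xi]; after a shift of the index both nilpotent parts are the sum of
    [Xi k i *m W k i.+1]. *)
Lemma frame_compl_comm : frame_compl *m H = H *m frame_compl.
Proof.
case: jordan => WH HXi; rewrite frame_compl_mul.
rewrite /frame_compl /frame_diag mulmxDr mulmx1; congr (_ + _).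
rewrite (eq_frame_sum (y := fun k i => (0 - 1) *: W k i) (y' := fun k i => - 1 *: W k i)).
  2: by move=> k i _; rewrite sub0r.
rewrite frame_sumZ scaleN1r mulmxN; congr (- _).
rewrite /frame_sum mulmx_sumr; apply: eq_bigr => k _; rewrite mulmx_sumr.
transitivity (\sum_(i < k.+1) (lam *: (Xi k.+1 i.+1 *m W k.+1 i.+1)) +
    \sum_(i < k) Xi k.+1 i.+1 *m W k.+1 i.+2).
  rewrite (eq_bigr (fun i : 'I_k.+1 => lam *: (Xi k.+1 i.+1 *m W k.+1 i.+1)
     + (if (i < k)%N then Xi k.+1 i.+1 *m W k.+1 i.+2 else 0))) => [|i _].
    rewrite big_split /= [in X in _ + X]big_ord_recr /= ltnn addr0.
    by congr (_ + _); apply: eq_bigr => i _; rewrite ltn_ord.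
  rewrite WH ?is_block_ord // mulmxDr -scalemxAr ltnS; congr (_ + _).
  by case: ifP => // _; rewrite mulmx0.
rewrite [RHS](eq_bigr (fun i : 'I_k.+1 => lam *: (Xi k.+1 i.+1 *m W k.+1 i.+1)
     + (if (0 < i)%N then Xi k.+1 i *m W k.+1 i.+1 else 0))) => [|i _].
  by rewrite big_split /= [in X in _ = _ + X]big_ord_recl /= add0r.
rewrite mulmxA HXi ?is_block_ord // mulmxDl -scalemxAl ltnS; congr (_ + _).
by case: ifP => // _; rewrite mul0mx.
Qed.

(* Exponent of [z = t^(1/rho)] in the block [(k, i)] of the eigenbasis; at
   [i = k + 1] it equals [rho]. *)
Definition jexp (k i : nat) : nat :=
  if (k <= rho)%N then (rho - k + i.-1)%N else minn i.-1 rho.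

Lemma jexp_le k i : (i <= k)%N -> (jexp k i.+1 <= rho)%N.
Proof. by rewrite /jexp /=; case: ifP; lia. Qed.

Lemma jexp_step k i : (1 <= i)%N -> (jexp k i.+1 <= (jexp k i).+1)%N.
Proof. by rewrite /jexp /=; case: ifP; lia. Qed.

(* For [X = scaleR z *m U], the equation [(H + z^rho T) X = X (lam + z Th)] is
   [scaled z *m U = scaleE z *m U *m Th] multiplied on the left by the diagonal
   matrix with entries [z ^+ jexp k i.+1]; unlike [X], [U] has a limit as [z -> 0]. *)
Definition scaleR (z : K) := frame_diag (fun k i => z ^+ jexp k i) (z ^+ rho).
Definition scaleL (z : K) := frame_diag (fun k i => z ^+ (rho - jexp k i.+1)) 1.
Definition scaleE (z : K) :=
  frame_diag (fun k i => z ^+ ((jexp k i).+1 - jexp k i.+1)) z.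
Definition scaled (z : K) := H - lam%:M + scaleL z *m T *m scaleR z.

Lemma jordan_coord k i : is_block m k i ->
  W k i *m (H - lam%:M) = if (i < k)%N then W k i.+1 else 0.
Proof.
by case: jordan => WH _ Bki; rewrite mulmxBr WH // mul_mx_scalar addrC addKr.
Qed.

Lemma frame_compl_commB : frame_compl *m (H - lam%:M) = (H - lam%:M) *m frame_compl.
Proof. by rewrite mulmxBl mulmxBr frame_compl_comm mul_mx_scalar mul_scalar_mx. Qed.

Lemma scaled_invariant q (z : K) (U : 'M[K]_(r, q)) (Th : 'M[K]_q) :
  scaled z *m U = scaleE z *m U *m Th ->
  (H + z ^+ rho *: T) *m (scaleR z *m U) = (scaleR z *m U) *m (lam%:M + z *: Th).
Proof.
move=> eqU; pose D := frame_diag (fun k i => z ^+ jexp k i.+1) (z ^+ rho).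
have DH : D *m (H - lam%:M) = (H - lam%:M) *m scaleR z.
  apply: frame_ext => [k i Bki|].
    rewrite !mulmxA frame_diag_coord // -scalemxAl !jordan_coord //.
    case: ifP => ik; last by rewrite scaler0 mul0mx.
    by rewrite frame_diag_coord //; move: Bki; rewrite /is_block; lia.
  by rewrite !mulmxA frame_compl_diag -scalemxAl frame_compl_commB -mulmxA
    frame_compl_diag -scalemxAr.
have DL : D *m scaleL z = (z ^+ rho)%:M.
  rewrite frame_diagM mulr1 -frame_diag_scalar; apply: eq_frame_diag => k i Bki.
  by rewrite -exprD subnKC // jexp_le //; move: Bki; rewrite /is_block; lia.
have DE : D *m scaleE z = z *: scaleR z.
  rewrite frame_diagM -mul_scalar_mx -frame_diag_scalar frame_diagM mulrC.
  apply: eq_frame_diag => k i Bki; rewrite -exprD subnKC ?exprS // jexp_step //.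
  by move: Bki; rewrite /is_block; lia.
have DA : D *m scaled z = (H - lam%:M + z ^+ rho *: T) *m scaleR z.
  by rewrite /scaled mulmxDr DH [RHS]mulmxDl !mulmxA DL mul_scalar_mx.
have eqX : (H - lam%:M + z ^+ rho *: T) *m (scaleR z *m U) = z *: (scaleR z *m U *m Th).
  by rewrite mulmxA -DA -mulmxA eqU !mulmxA DE -!scalemxAl.
move: (scaleR z *m U) eqX => X eqX.
rewrite mulmxDr mul_mx_scalar -scalemxAr -eqX [in RHS]mulmxDl mulmxBl mul_scalar_mx.
by rewrite mulmxDl addrA addrCA subrr addr0.
Qed.

End Jordan.
End Frame.

(** * Block rows and invertibility of Theta *)

Section BlockRows.
Variables (K : fieldType) (rho sr : nat).

(** The index is a natural number, so that selectors out of range vanish and the last block row of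
    [Theta] obeys the same shift formula as the others. *)
Definition eblk (a : nat) : 'M[K]_(sr, \sum_(i < rho) sr) :=
  \mxrow_(b < rho) (if b == a :> nat then 1%:M else 0 : 'M[K]_(sr, sr)).

Lemma eblk_mul a (ha : (a < rho)%N) q (U : 'M[K]_(\sum_(i < rho) sr, q)) :
  eblk a *m U = submxcol U (Ordinal ha).
Proof.
rewrite -[in LHS](submxcolK U) mul_mxrow_mxcol (bigD1 (Ordinal ha)) //= eqxx mul1mx.
by rewrite big1 ?addr0 // => b ba; rewrite ifN ?mul0mx.
Qed.

Lemma submxcol_eblk q (U : 'M[K]_(\sum_(i < rho) sr, q)) (a : 'I_rho) :
  submxcol U a = eblk a *m U.
Proof. by rewrite (eblk_mul (ltn_ord a)); congr submxcol; apply: val_inj. Qed.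

Lemma eblk_mxcol a (ha : (a < rho)%N) q (B : 'I_rho -> 'M[K]_(sr, q)) :
  eblk a *m (\mxcol_(b < rho) B b) = B (Ordinal ha).
Proof. by rewrite (eblk_mul ha) mxcolK. Qed.

Lemma eblk_ext q (U V : 'M[K]_(\sum_(i < rho) sr, q)) :
  (forall a, (a < rho)%N -> eblk a *m U = eblk a *m V) -> U = V.
Proof. by move=> UV; apply/mxcolP => a; rewrite !submxcol_eblk UV. Qed.

Lemma eblk_ge a : (rho <= a)%N -> eblk a = 0.
Proof.
move=> ra; rewrite /eblk -[RHS]mxrow0; apply/eq_mxrowP => b.
by rewrite ifN // neq_ltn (leq_trans (ltn_ord b)).
Qed.

Lemma eblk_Theta (S : 'M[K]_sr) a : (a < rho)%N ->
  eblk a *m Theta rho S = eblk a.+1 + (if a.+1 == rho then S *m eblk 0 else 0).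
Proof.
move=> ha; rewrite (eblk_mul ha) /Theta mxblockEv mxcolK /eblk.
case: (a.+1 =P rho) => [ar|/eqP/negbTE ar]; last first.
  by rewrite addr0; apply/eq_mxrowP => b; case: eqP.
rewrite mul_mxrow -mxrowD; apply/eq_mxrowP => b.
have -> : (b == a.+1 :> nat) = false by rewrite ar; apply/negbTE; rewrite neq_ltn ltn_ord.
rewrite add0r /=.
by case: eqP; rewrite ?mulmx1 ?mulmx0.
Qed.

Lemma unitmx_injective n (A : 'M[K]_n) :
  (forall u : 'cV[K]_n, A *m u = 0 -> u = 0) -> A \in unitmx.
Proof.
move=> inj; rewrite -unitmx_tr -row_free_unit; apply/inj_row_free => v vA.
by apply: (can_inj trmxK); rewrite linear0; apply: inj; rewrite -[A]trmxK -trmx_mul vA linear0.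
Qed.

(** The block rows of [Theta u = 0] read [u_1 = 0], ..., [u_(rho-1) = 0] and [S u_0 = 0]. *)
Lemma Theta_unitmx (S : 'M[K]_sr) : S \in unitmx -> Theta rho S \in unitmx.
Proof.
move=> uS; apply: unitmx_injective => u Tu0; apply: eblk_ext => a.
rewrite mulmx0; have eqa b : (b < rho)%N -> eblk b.+1 *m u
    + (if b.+1 == rho then S *m eblk 0 else 0) *m u = 0.
  by move=> hb; rewrite -mulmxDl -eblk_Theta // -mulmxA Tu0 mulmx0.
case: a => [|a] ha.
  have := eqa rho.-1; rewrite prednK // eqxx eblk_ge // mul0mx add0r => /(_ (leqnn _)).
  by move/(congr1 (mulmx (invmx S))); rewrite -mulmxA mulKmx // mulmx0.
by have := eqa a (ltnW ha); rewrite (ltn_eqF ha) mul0mx addr0.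
Qed.

End BlockRows.

Lemma jexp_last rho k : (1 <= k)%N -> jexp rho k k.+1 = rho.
Proof. by rewrite /jexp /=; case: ifP; lia. Qed.

(** * The scaled system at z = 0 *)

Section LeadingPart.
Variables (K : fieldType) (r m : nat) (s : nat -> nat).
Variables (Xi : forall j i : nat, 'M[K]_(r, s j)) (W : forall j i : nat, 'M[K]_(s j, r)).
Variables (H T : 'M[K]_r) (lam : K) (rho : nat).
Hypothesis rho_range : (1 <= rho <= m)%N.

(** The index [j] stands for the chain length [j.+1], so [rho <= j] selects the lengths beyond
    [rho]. *)
Definition tail_sum q (y : forall j : nat, 'M[K]_(s j, q)) : 'M[K]_(r, q) :=
  \sum_(j < m | (rho <= j)%N) Xi j.+1 1%N *m y j.+1.

Lemma tail_sumB q (y y' : forall j : nat, 'M[K]_(s j, q)) :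
  tail_sum y - tail_sum y' = tail_sum (fun j => y j - y' j).
Proof. by rewrite /tail_sum -sumrB; apply: eq_bigr => j _; rewrite mulmxBr. Qed.

Lemma tail_sum_mul q q' (y : forall j : nat, 'M[K]_(s j, q)) (B : 'M[K]_(q, q')) :
  tail_sum y *m B = tail_sum (fun j => y j *m B).
Proof. by rewrite /tail_sum mulmx_suml; apply: eq_bigr => j _; rewrite mulmxA. Qed.

Lemma eq_tail_sum q (y y' : forall j : nat, 'M[K]_(s j, q)) :
  (forall j, (rho < j <= m)%N -> y j = y' j) -> tail_sum y = tail_sum y'.
Proof.
by move=> yy'; apply: eq_bigr => j rj; rewrite yy' // ltnS rj ltn_ord.
Qed.

(** At [z = 0] only the blocks of exponent [0] survive, and [jexp k i] vanishes exactly for [i = 1]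
    and [k >= rho]. *)
Lemma scaleR0 q (Y : 'M[K]_(r, q)) :
  scaleR m Xi W rho 0 *m Y = Xi rho 1%N *m (W rho 1%N *m Y)
                            + tail_sum (fun j => W j 1%N *m Y).
Proof.
have rho_gt0 : (0 < rho)%N by case/andP: rho_range.
have rm : (rho.-1 < m)%N by case/andP: rho_range; lia.
rewrite /scaleR /frame_diag expr0n eqn0Ngt rho_gt0 /= raddf0 add0r /frame_sum.
transitivity (\sum_(j < m | (rho <= j.+1)%N) Xi j.+1 1%N *m (W j.+1 1%N *m Y)).
  rewrite mulmx_suml [RHS]big_mkcond; apply: eq_bigr => k _.
  rewrite big_ord_recl big1 ?addr0 => [|i _].
    rewrite subr0 /jexp /= expr0n addn0 min0n; case: ifP => kr.
      rewrite subn_eq0; case: ifP => _; first by rewrite scale1r mulmxA.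
      by rewrite scale0r mulmx0 mul0mx.
    by rewrite scale1r mulmxA ifT //; lia.
  rewrite subr0 expr0n (_ : jexp _ _ _ == 0 = false)%N ?scale0r ?mulmx0 //.
  by rewrite /jexp /= /bump /=; case: ifP; lia.
rewrite (bigD1 (Ordinal rm)) /= prednK //; congr (_ + _).
apply: eq_bigl => j; rewrite -val_eqE /=; apply/idP/idP; lia.
Qed.

Definition Wblk : 'M[K]_(\sum_(i < rho) s rho, r) := \mxcol_(a < rho) W rho a.+1.

Lemma eblk_Wblk a : (a < rho)%N -> eblk K rho (s rho) a *m Wblk = W rho a.+1.
Proof. by move=> ha; rewrite (eblk_mxcol ha). Qed.

Hypothesis dual : biorthogonal m Xi W.
Hypothesis jordan : jordan_frame m Xi W H lam.
(** [compl] says that [lam] is no eigenvalue of [H] on the complement. [psi_tail] and [psi_head]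
    express the invertibility of [Psi_(rho+1)] and [Psi_rho] through kernels, a form that fits both
    frames without comparing block dimensions. *)
Hypothesis compl : forall q (Y : 'M[K]_(r, q)),
  (forall k i, is_block m k i -> W k i *m Y = 0) -> H *m Y = lam *: Y -> Y = 0.
Hypothesis psi_tail : forall q (y : forall j : nat, 'M[K]_(s j, q)),
  (forall k, (rho < k <= m)%N -> W k k *m T *m tail_sum y = 0) ->
  forall j, (rho < j <= m)%N -> y j = 0.
Hypothesis psi_head : forall q (u : 'M[K]_(s rho, q)) (y : forall j : nat, 'M[K]_(s j, q)),
  (forall k, (rho <= k <= m)%N -> W k k *m T *m (Xi rho 1%N *m u + tail_sum y) = 0) ->
  u = 0.
Variable G : forall j : nat, 'M[K]_(s j, s rho).

(** With [G] the blocks of [Ghat] (of [Ghatc] in the mirror frame), this is the leading coefficient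
    [Upsilon_rho [I; Ghat]], and [lead_schur] becomes a Schur complement, equal to [- Shat] in the
    right frame. *)
Definition lead : 'M[K]_(r, s rho) := Xi rho 1%N + tail_sum G.

Hypothesis G_eq : forall k, (rho < k <= m)%N -> W k k *m T *m lead = 0.

Definition lead_schur : 'M[K]_(s rho) := W rho rho *m T *m lead.

(** If the Schur complement kills [u], then [lead *m u] solves the homogeneous system of [Psi_rho],
    and its head is [u]. *)
Lemma lead_schur_unit : lead_schur \in unitmx.
Proof.
apply: unitmx_injective => u Su; apply: (psi_head (y := fun j => G j *m u)) => k kr.
rewrite -tail_sum_mul -mulmxDl mulmxA -/lead.
have [kr'|] := ltnP rho k; first by rewrite G_eq ?mul0mx // kr' //; case/andP: kr.
move=> rk; have -> : k = rho by lia.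
exact: Su.
Qed.

Lemma scaled_coord z k i q (Y : 'M[K]_(r, q)) : is_block m k i ->
  W k i *m (scaled m Xi W H T lam rho z *m Y) =
  (if (i < k)%N then W k i.+1 *m Y else 0)
  + z ^+ (rho - jexp rho k i.+1) *: (W k i *m T *m (scaleR m Xi W rho z *m Y)).
Proof.
move=> Bki; rewrite /scaled mulmxA mulmxDr (jordan_coord jordan) // !mulmxA.
rewrite /scaleL (frame_diag_coord dual) // mulmxDl -!scalemxAl.
by case: ifP => // _; rewrite mul0mx.
Qed.

Lemma scaleE_coord z k i q (Y : 'M[K]_(r, q)) : is_block m k i ->
  W k i *m (scaleE m Xi W rho z *m Y) =
  z ^+ ((jexp rho k i).+1 - jexp rho k i.+1) *: (W k i *m Y).
Proof. by move=> Bki; rewrite mulmxA (frame_diag_coord dual) // -scalemxAl. Qed.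

(** Triangular elimination. The exponent on the right side of row [(k, i)] is [0] for [k <= rho],
    and for [k > rho] exactly when [i <= rho]; so the terms surviving at [z = 0] depend on the chain
    length. [Ust] only fixes the border, which lets the lemma serve first an auxiliary matrix and
    then the true solution. *)
Lemma bordered_injective_scaled (Ust : 'M[K]_(r, \sum_(i < rho) s rho)) :
  Wblk *m Ust = 1%:M ->
  bordered_injective (scaled m Xi W H T lam rho 0) (scaleE m Xi W rho 0)
    (scaleE m Xi W rho 0 *m Ust) (Theta rho lead_schur) Wblk.
Proof.
move=> WU Y M eqY WY.
have rhoB a : (a < rho)%N -> is_block m rho a.+1.
  by move=> ha; case/andP: rho_range; rewrite /is_block /=; lia.
have rho0 a : (a < rho)%N -> W rho a.+1 *m Y = 0.
  by move=> ha; rewrite -eblk_Wblk // -mulmxA WY mulmx0.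
pose D0Y := scaleR m Xi W rho 0 *m Y.
have blk k i : is_block m k i ->
    (if (i < k)%N then W k i.+1 *m Y else 0) + 0 ^+ (rho - jexp rho k i.+1) *: (W k i *m T *m D0Y)
    = 0 ^+ ((jexp rho k i).+1 - jexp rho k i.+1)
       *: (W k i *m Y *m Theta rho lead_schur + W k i *m Ust *m M).
  move=> Bki; rewrite -scaled_coord // scalerDr (scalemxAl _ (W k i *m Y)) (scalemxAl _ (W k i *m Ust)) -!scaleE_coord //.
  apply/eqP; rewrite -subr_eq0 opprD addrA; apply/eqP.
  by rewrite -!mulmxA -!mulmxBr !mulmxA; move: eqY; rewrite -!mulmxA => ->; rewrite mulmx0.
have D0Y_tail : D0Y = tail_sum (fun j => W j 1%N *m Y).
  rewrite /D0Y scaleR0 rho0 ?mulmx0 ?add0r //; by case/andP: rho_range.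
(* Rows [i = k > rho]: the shift has ended, [T] enters with exponent [0], and the right side has a
   positive power of [0]. *)
have tail1 j : (rho < j <= m)%N -> W j 1%N *m Y = 0.
  apply: (psi_tail (y := fun j => W j 1%N *m Y)) => k kr; rewrite -D0Y_tail.
  have := blk k k; rewrite ltnn add0r jexp_last; last by lia.
  rewrite subnn expr0 scale1r => -> //; last by rewrite /is_block; lia.
  rewrite expr0n (_ : _ == _ = false)%N ?scale0r //.
  by rewrite /jexp; case: ifP; lia.
have D0Y0 : D0Y = 0.
  rewrite D0Y_tail (eq_tail_sum (y' := fun j => 0)) //.
  by apply: big1 => j _; rewrite mulmx0.
(* With [D0Y = 0] and [rho0], the rows of chain [rho] contain [M] alone. *)
have M0 : M = 0.
  apply: eblk_ext => a ha; rewrite mulmx0; have := blk rho a.+1 (rhoB a ha).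
  rewrite D0Y0 mulmx0 scaler0 addr0 (rho0 a ha) mul0mx add0r.
  rewrite -(eblk_Wblk ha) -(mulmxA _ Wblk) WU mulmx1 (_ : _ - _ = 0)%N.
    rewrite expr0 scale1r => <-; case: ifP => // ar; exact: rho0.
  by rewrite /jexp leqnn /=; lia.
have blk0 k i : is_block m k i -> (if (i < k)%N then W k i.+1 *m Y else 0)
    = 0 ^+ ((jexp rho k i).+1 - jexp rho k i.+1) *: (W k i *m Y *m Theta rho lead_schur).
  by move/blk; rewrite D0Y0 M0 !mulmx0 scaler0 !addr0.
split=> //; apply: (frame_ext (m := m) (Xi := Xi) (W := W)) => [k i Bki|]; rewrite mulmx0.
  have [kr|kr|kr] := ltngtP k rho; last 1 first.
  - move: Bki; rewrite kr; case: i => [|i]; rewrite /is_block // => /andP[_ /andP[ir _]].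
    exact: rho0.
  (* Short chains: the last row gives [W k k *m Y *m Theta = 0], and invertibility of [Theta] drives
     a descent to [i = 1]. *)
  - have down j : (j < k)%N -> W k (k - j)%N *m Y = 0.
      elim: j => [|j IHj] jk.
        have := blk0 k (k - 0)%N; rewrite subn0 ltnn jexp_last; last by lia.
        move/(_ ltac:(move: Bki; rewrite /is_block; lia))/esym.
        rewrite (_ : _ - _ = 0)%N ?expr0 ?scale1r; last by rewrite /jexp; case: ifP; lia.
        move/(congr1 (mulmx^~ (invmx (Theta rho lead_schur)))).
        by rewrite mulmxK ?Theta_unitmx ?lead_schur_unit // mul0mx.
      have := blk0 k (k - j.+1)%N; rewrite (_ : (_ < k)%N = true); last by lia.
      rewrite (_ : (k - j.+1).+1 = k - j)%N ?IHj; [|lia|lia].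
      move/(_ ltac:(move: Bki; rewrite /is_block; lia))/esym.
      rewrite (_ : _ - jexp _ _ _ = 0)%N ?expr0 ?scale1r; last by rewrite /jexp (ltnW kr); lia.
      move/(congr1 (mulmx^~ (invmx (Theta rho lead_schur)))).
      by rewrite mulmxK ?Theta_unitmx ?lead_schur_unit // mul0mx.
    have -> : i = (k - (k - i))%N by move: Bki; rewrite /is_block; lia.
    by apply: down; move: Bki; rewrite /is_block; lia.
  (* Long chains: block [i.+1] is block [i] times [Theta], or [0], starting from [tail1]. *)
  - case: i Bki => [|i]; first by rewrite /is_block.
    elim: i => [|i IHi] Bki; first by rewrite tail1 //; move: Bki; rewrite /is_block; lia.
    have Bki' : is_block m k i.+1 by move: Bki; rewrite /is_block; lia.
    have := blk0 k i.+1 Bki'; rewrite IHi // mul0mx scaler0 ifT //.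
    by move: Bki; rewrite /is_block; lia.
(* On the complement [scaleE] is [0] at [z = 0], so this component of [Y] is annihilated by
   [H - lam]. *)
apply: compl => [k i Bki|].
  by rewrite mulmxA (frame_compl_coord dual) // mul0mx.
apply/eqP; rewrite -subr_eq0 -mul_scalar_mx -mulmxBl; apply/eqP.
rewrite mulmxA -(frame_compl_commB jordan).
have scY : scaled m Xi W H T lam rho 0 *m Y = (H - lam%:M) *m Y.
  by rewrite /scaled mulmxDl -(mulmxA _ _ Y) -/D0Y D0Y0 mulmx0 addr0.
have := congr1 (mulmx (frame_compl m Xi W)) eqY.
rewrite scY M0 !mulmx0 subr0 mulmxBr !mulmxA (frame_compl_diag dual).
by rewrite scale0r !mul0mx subr0.
Qed.

End LeadingPart.

(** * The scaled system for small z *)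

Section ScaledBasis.
Variables (R : realType) (r m : nat) (s : nat -> nat).
Local Notation C := R[i].
Variables (Xi : forall j i : nat, 'M[C]_(r, s j)) (W : forall j i : nat, 'M[C]_(s j, r)).

Lemma block_bound : exists2 w : R, 0 <= w & forall k i, is_block m k i -> nrm (W k i) <= w.
Proof.
exists (\sum_(k < m) \sum_(i < k.+1) nrm (W k.+1 i.+1)).
  by do 2 (apply: sumr_ge0 => ? _); apply: nrm_ge0.
case=> [|k] [|i] //; rewrite /is_block => //= /andP[ik km].
rewrite (bigD1 (Ordinal km)) //= (bigD1 (Ordinal ik)) //= -addrA lerDl addr_ge0 //.
  by apply: sumr_ge0 => ? _; apply: nrm_ge0.
by do 2 (apply: sumr_ge0 => ? _); apply: nrm_ge0.
Qed.

Lemma frame_diag_lipschitz : exists2 k : R, 0 <= k &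
  forall (phi psi : nat -> nat -> C) (c d : C) (e : R),
    (forall j i, is_block m j i -> cabs (phi j i - psi j i) <= e) -> cabs (c - d) <= e ->
    nrm (frame_diag m Xi W phi c - frame_diag m Xi W psi d) <= k * e.
Proof.
pose b := \sum_(j < m) \sum_(i < j.+1) nrm (Xi j.+1 i.+1) * (2 * nrm (W j.+1 i.+1)).
have b_ge0 : 0 <= b by do 2 (apply: sumr_ge0 => ? _); rewrite !mulr_ge0 ?nrm_ge0.
exists (nrm (1%:M : 'M[C]_r) + b); first by rewrite addr_ge0 ?nrm_ge0.
move=> phi psi c d e phi_psi cd; rewrite /frame_diag opprD addrACA -raddfB /=.
rewrite frame_sumB mulrDl (le_trans (nrmD _ _)) // lerD //.
  by rewrite -(scalemx1 _ (c - d)) nrmZ [leRHS]mulrC ler_wpM2r ?nrm_ge0.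
apply: le_trans (nrm_sum _ _ _) _; rewrite mulr_suml ler_sum // => j _.
apply: le_trans (nrm_sum _ _ _) _; rewrite mulr_suml ler_sum // => i _.
apply: le_trans (nrmM _ _) _; rewrite -mulrA ler_wpM2l ?nrm_ge0 //.
rewrite -scalerBl nrmZ [leRHS]mulrAC ler_wpM2r ?nrm_ge0 //.
rewrite (_ : _ - _ = (phi j.+1 i.+1 - psi j.+1 i.+1) - (c - d)); last by ring.
apply: le_trans (cabsD _ _) _; rewrite cabsN.
by have := phi_psi j.+1 i.+1 (is_block_ord i); lra.
Qed.

(** Every diagonal entry of the scalings is such a power, exponent [0] included, so the scaled
    system is Lipschitz at [z = 0]. *)
Lemma cabs_pow0 (z : R) n : 0 <= z -> z <= 1 -> cabs (z%:C ^+ n - 0 ^+ n) <= z.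
Proof.
move=> z0 z1; case: n => [|n]; first by rewrite !expr0 subrr cabs0.
rewrite [0 ^+ _]expr0n subr0 -rmorphXn cabsR ger0_norm ?exprn_ge0 //.
by rewrite exprS ler_piMr // exprn_ile1.
Qed.

Lemma sandwich_lipschitz (L L0 T D D0 : 'M[C]_r) (d k : R) :
  nrm (L - L0) <= d -> nrm (D - D0) <= d -> nrm D <= k ->
  nrm (L *m T *m D - L0 *m T *m D0) <= (nrm T * k + nrm L0 * nrm T) * d.
Proof.
move=> dL dD Dk.
rewrite (_ : _ - _ = (L - L0) *m (T *m D) + L0 *m T *m (D - D0)); last first.
  by rewrite mulmxBl mulmxBr !mulmxA addrA subrK.
rewrite mulrDl (le_trans (nrmD _ _)) // lerD // (le_trans (nrmM _ _)) //.
  rewrite mulrC ler_pM ?nrm_ge0 // (le_trans (nrmM _ _)) //.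
  by rewrite ler_wpM2l ?nrm_ge0.
by rewrite ler_pM ?nrm_ge0 ?nrmM.
Qed.

Variables (H T : 'M[C]_r) (lam : C) (rho : nat).
Hypothesis rho_range : (1 <= rho <= m)%N.

Lemma scaled_lipschitz : exists2 k : R, 0 <= k & forall z : R, 0 <= z -> z <= 1 ->
  nrm (scaled m Xi W H T lam rho z%:C - scaled m Xi W H T lam rho 0) <= k * z /\
  nrm (scaleE m Xi W rho z%:C - scaleE m Xi W rho 0) <= k * z.
Proof.
have [k k_ge0 lip] := frame_diag_lipschitz.
set L0 := scaleL m Xi W rho 0; set R0 := scaleR m Xi W rho 0.
pose k1 := (nrm T * (nrm R0 + k) + nrm L0 * nrm T) * k.
have k1_ge0 : 0 <= k1 by rewrite !(addr_ge0, mulr_ge0) ?nrm_ge0.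
exists (k1 + k) => [|z z0 z1]; first exact: addr_ge0.
have dL : nrm (scaleL m Xi W rho z%:C - L0) <= k * z.
  apply: lip => [j i _|]; last by rewrite subrr cabs0.
  exact: cabs_pow0.
have dR : nrm (scaleR m Xi W rho z%:C - R0) <= k * z.
  by apply: lip => [j i _|]; apply: cabs_pow0.
have dE : nrm (scaleE m Xi W rho z%:C - scaleE m Xi W rho 0) <= k * z.
  apply: lip => [j i _|]; first exact: cabs_pow0.
  by rewrite subr0 cabsR ger0_norm.
split; last by apply: le_trans dE _; rewrite ler_wpM2r // lerDr.
have R_le : nrm (scaleR m Xi W rho z%:C) <= nrm R0 + k.
  rewrite -[scaleR _ _ _ _ _](subrK R0) addrC (le_trans (nrmD _ _)) // lerD2l.
  by apply: le_trans dR _; rewrite ler_piMr.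
apply: (@le_trans _ _ (k1 * z)); last by rewrite ler_wpM2r // lerDl.
rewrite /scaled -/L0 -/R0 opprD addrACA subrr add0r /k1 -mulrA.
exact: (sandwich_lipschitz T dL dR R_le).
Qed.

Hypothesis dual : biorthogonal m Xi W.
Hypothesis jordan : jordan_frame m Xi W H lam.
Hypothesis compl : forall q (Y : 'M[C]_(r, q)),
  (forall k i, is_block m k i -> W k i *m Y = 0) -> H *m Y = lam *: Y -> Y = 0.
Hypothesis psi_tail : forall q (y : forall j : nat, 'M[C]_(s j, q)),
  (forall k, (rho < k <= m)%N -> W k k *m T *m tail_sum m Xi rho y = 0) ->
  forall j, (rho < j <= m)%N -> y j = 0.
Hypothesis psi_head : forall q (u : 'M[C]_(s rho, q)) (y : forall j : nat, 'M[C]_(s j, q)),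
  (forall k, (rho <= k <= m)%N ->
     W k k *m T *m (Xi rho 1%N *m u + tail_sum m Xi rho y) = 0) ->
  u = 0.
Variable G : forall j : nat, 'M[C]_(s j, s rho).
Hypothesis G_eq : forall k, (rho < k <= m)%N -> W k k *m T *m lead m Xi G = 0.

Local Notation Th0 := (Theta rho (lead_schur m Xi W T G)).
Local Notation e_ a := (eblk C rho (s rho) a).

Lemma rho_block a : (a < rho)%N -> is_block m rho a.+1.
Proof. by case/andP: rho_range; rewrite /is_block /=; lia. Qed.

Lemma first_block j : (rho < j <= m)%N -> is_block m j 1.
Proof. by rewrite /is_block; lia. Qed.

Lemma jexp_first j : (rho <= j)%N -> jexp rho j 1 = 0%N.
Proof. by rewrite /jexp; case: ifP; lia. Qed.

(** [U0] is not written down: the bordered system with right side [(0, 1)] is solvable because it is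
    injective, and reading its rows shows that the multiplier [M] vanishes, so [U0] solves the
    equation itself. *)
Lemma leading_solution : exists U0 : 'M[C]_(r, \sum_(i < rho) s rho),
  [/\ scaled m Xi W H T lam rho 0 *m U0 = scaleE m Xi W rho 0 *m U0 *m Th0,
      Wblk W rho *m U0 = 1%:M
    & forall j, (rho < j <= m)%N -> W j 1%N *m U0 = G j *m e_ 0].
Proof.
pose Xr := \sum_(a < rho) Xi rho a.+1 *m e_ a.
have WXr : Wblk W rho *m Xr = 1%:M.
  apply: eblk_ext => a ha; rewrite mulmxA eblk_Wblk // mulmx1 mulmx_sumr.
  rewrite [LHS](bigD1 (Ordinal ha)) //= mulmxA dual.1 ?rho_block // eqxx mul1mx.
  rewrite [X in _ + X]big1 ?addr0 //.
  move=> b ba; rewrite mulmxA dual.1 ?rho_block // ifN ?mul0mx // eqSS eq_sym.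
  by rewrite -val_eqE in ba.
have [h hK] := bordered_sylvester_inverse (bordered_injective_scaled rho_range dual
   jordan compl psi_tail psi_head G_eq WXr).
have := hK (col_mx 0 1%:M); rewrite /bordered_sylvester.
move: (usubmx _) (dsubmx _) => U0 M /eq_col_mx[eqU WU].
have rowU a : (a < rho)%N -> W rho a.+1 *m U0 = e_ a.
  by move=> ha; rewrite -(eblk_Wblk W ha) -mulmxA WU mulmx1.
pose X0 := scaleR m Xi W rho 0 *m U0.
have X0E : X0 = Xi rho 1%N *m e_ 0 + tail_sum m Xi rho (fun j => W j 1%N *m U0).
  by rewrite /X0 (scaleR0 _ _ rho_range) (rowU 0%N) //; case/andP: rho_range.
have blk k i : is_block m k i ->
    (if (i < k)%N then W k i.+1 *m U0 else 0) + 0 ^+ (rho - jexp rho k i.+1) *: (W k i *m T *m X0)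
    = 0 ^+ ((jexp rho k i).+1 - jexp rho k i.+1)
       *: (W k i *m U0 *m Th0 + W k i *m Xr *m M).
  move=> Bki; rewrite -(scaled_coord T rho dual jordan) //.
  rewrite scalerDr (scalemxAl _ (W k i *m U0)) (scalemxAl _ (W k i *m Xr)).
  rewrite -!(scaleE_coord rho dual) //.
  apply/eqP; rewrite -subr_eq0 opprD addrA; apply/eqP.
  by rewrite -!mulmxA -!mulmxBr !mulmxA; move: eqU; rewrite -!mulmxA => ->; rewrite mulmx0.
clearbody X0.
(* Uniqueness in the tail: [X0] and [lead *m e_0] satisfy the same equations in the rows [(k, k)]
   with [k > rho]. *)
have U1 j : (rho < j <= m)%N -> W j 1%N *m U0 = G j *m e_ 0.
  move=> rj; apply/eqP; rewrite -subr_eq0; apply/eqP; move: j rj.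
  apply: (psi_tail (y := fun j => W j 1%N *m U0 - G j *m e_ 0)) => k kr.
  have -> : tail_sum m Xi rho (fun j => W j 1%N *m U0 - G j *m e_ 0)
      = X0 - lead m Xi G *m e_ 0.
    by rewrite X0E /lead [in RHS]mulmxDl tail_sum_mul opprD addrACA subrr add0r tail_sumB.
  rewrite mulmxBr mulmxA G_eq // mul0mx subr0.
  have := blk k k; rewrite ltnn add0r jexp_last; last by lia.
  rewrite subnn expr0 scale1r => -> //; last by rewrite /is_block; lia.
  rewrite expr0n (_ : _ == _ = false)%N ?scale0r //.
  by rewrite /jexp; case: ifP; lia.
have X0_lead : X0 = lead m Xi G *m e_ 0.
  rewrite X0E /lead mulmxDl tail_sum_mul; congr (_ + _).
  exact: eq_tail_sum.
(* On chain [rho] the left side already consists of the rows of [Th0]: shifts, then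
   [lead_schur *m e_0] in the last row. *)
have M0 : M = 0.
  apply: eblk_ext => a ha; rewrite mulmx0; have := blk rho a.+1 (rho_block ha).
  rewrite (rowU a ha) -(eblk_Wblk W ha) -(mulmxA _ (Wblk W rho) Xr) WXr mulmx1.
  rewrite (_ : (jexp _ _ _).+1 - _ = 0)%N; last by rewrite /jexp leqnn /=; lia.
  rewrite expr0 scale1r eblk_Theta // eblk_Wblk // X0_lead.
  have [ar|ar] := eqVneq a.+1 rho.
    have -> : (a.+1 < rho)%N = false by rewrite ar ltnn.
    rewrite add0r (_ : jexp _ _ _ = rho); last by rewrite /jexp leqnn /=; lia.
    have ea : e_ a.+1 = 0 by apply: eblk_ge; rewrite ar.
    rewrite subnn expr0 scale1r ea.
    rewrite add0r mulmxA /lead_schur {1}ar -[LHS]addr0 => /addrI.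
    by move/esym.
  rewrite (_ : (a.+1 < rho)%N = true) ?rowU; [|lia|lia].
  rewrite expr0n (_ : _ == _ = false)%N ?scale0r; last by rewrite /jexp leqnn /=; lia.
  by rewrite !addr0 -[LHS]addr0 => /addrI/esym.
exists U0; split=> //; apply/eqP; rewrite -subr_eq0; apply/eqP.
by move: eqU; rewrite M0 mulmx0 subr0.
Qed.

(** The perturbation lemma at scale [e = k2 * z], followed by [scaleR z]. The normalization of [U]
    makes the coordinates on chain [rho] exact. First blocks beyond [rho] have exponent [0], so for
    them the distance to the limit [G j *m e_0] is estimated as well. *)
Lemma scaled_basis : exists z0 k : R, [/\ 0 < z0, 0 <= k & forall z : R, 0 < z -> z <= z0 ->
  exists (X : 'M[C]_(r, \sum_(i < rho) s rho)) (Th : 'M[C]_(\sum_(i < rho) s rho)),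
    [/\ (H + z%:C ^+ rho *: T) *m X = X *m (lam%:M + z%:C *: Th) /\ nrm (Th - Th0) <= k * z,
        forall a, (a < rho)%N -> W rho a.+1 *m X = z%:C ^+ a *: e_ a,
        forall j i, is_block m j i -> nrm (W j i *m X) <= k * z ^+ jexp rho j i,
        forall j, (rho < j <= m)%N -> nrm (W j 1%N *m X - G j *m e_ 0) <= k * z
      & nrm (frame_compl m Xi W *m X) <= k * z ^+ rho /\ nrm X <= k]].
Proof.
have [U0 [eqU0 WU0 U01]] := leading_solution.
have [e0 [k1 [e0_gt0 k1_ge0 pert]]] := deflating_perturbation eqU0 WU0
  (bordered_injective_scaled rho_range dual jordan compl psi_tail psi_head G_eq WU0).
have [k2 k2_ge0 lip] := scaled_lipschitz.
have [w w_ge0 W_le] := block_bound.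
have [kd kd_ge0 dlip] := frame_diag_lipschitz.
pose kR := nrm (scaleR m Xi W rho 0) + kd.
have kR_ge0 : 0 <= kR by rewrite addr_ge0 ?nrm_ge0.
pose kU := nrm U0 + k1 * k2.
have kU_ge0 : 0 <= kU by rewrite !(addr_ge0, mulr_ge0) ?nrm_ge0.
pose z0 := Num.min 1 (e0 / (k2 + 1)).
pose P := frame_compl m Xi W.
(* A sum of nonnegative terms, one for each estimate below. *)
pose k := k1 * k2 + w * kU + w * (k1 * k2) + nrm P * kU + kR * kU.
have [t1 t2 t3 t4 t5] : [/\ 0 <= k1 * k2, 0 <= w * kU, 0 <= w * (k1 * k2),
  0 <= nrm P * kU & 0 <= kR * kU] by rewrite !mulr_ge0 ?nrm_ge0.
exists z0, k; split.
- by rewrite lt_min ltr01 divr_gt0 // ltr_wpDl.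
- by rewrite /k; lra.
move=> z z_gt0; rewrite le_min => /andP[z1 ze].
have z_ge0 := ltW z_gt0.
have k2z : k2 * z <= e0.
  move: ze; rewrite ler_pdivlMr ?ltr_wpDl //; apply: le_trans.
  by rewrite mulrC ler_wpM2l // lerDl.
have [lA lE] := lip z z_ge0 z1.
have [U [Th [eqU WU dU dTh]]] := pert _ _ _ k2z lA lE.
have U_le : nrm U <= kU.
  rewrite -[U](subrK U0) addrC (le_trans (nrmD _ _)) // lerD2l (le_trans dU) //.
  by rewrite mulrA ler_piMr.
have Wcoord j i : is_block m j i ->
    W j i *m (scaleR m Xi W rho z%:C *m U) = z%:C ^+ jexp rho j i *: (W j i *m U).
  by move=> B; rewrite mulmxA (frame_diag_coord dual) // -scalemxAl.
have zX n : cabs (z%:C ^+ n) = z ^+ n by rewrite -rmorphXn cabsR ger0_norm ?exprn_ge0.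
exists (scaleR m Xi W rho z%:C *m U), Th; split.
- split; first exact: scaled_invariant.
  by apply: le_trans dTh _; rewrite mulrA ler_wpM2r // /k; lra.
- move=> a ha; rewrite Wcoord ?rho_block //.
  by rewrite -(eblk_Wblk W ha) -mulmxA WU mulmx1 /jexp leqnn subnn.
- move=> j i B; rewrite Wcoord // nrmZ zX mulrC ler_wpM2r ?exprn_ge0 //.
  apply: (@le_trans _ _ (w * kU)); last by rewrite /k; lra.
  by rewrite (le_trans (nrmM _ _)) // ler_pM ?nrm_ge0 ?W_le.
- move=> j rj; have B := first_block rj.
  rewrite Wcoord // jexp_first; last by case/andP: rj => /ltnW.
  rewrite expr0 scale1r -U01 // -mulmxBr.
  apply: (@le_trans _ _ (w * (k1 * k2) * z)); last by rewrite ler_wpM2r // /k; lra.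
  by rewrite (le_trans (nrmM _ _)) // -mulrA ler_pM ?nrm_ge0 ?W_le // -mulrA.
split.
  rewrite mulmxA (frame_compl_diag dual) -scalemxAl nrmZ zX mulrC ler_wpM2r ?exprn_ge0 //.
  apply: (@le_trans _ _ (nrm P * kU)); last by rewrite /k; lra.
  by rewrite (le_trans (nrmM _ _)) // ler_wpM2l ?nrm_ge0.
apply: (@le_trans _ _ (kR * kU)); last by rewrite /k; lra.
rewrite (le_trans (nrmM _ _)) // ler_pM ?nrm_ge0 //.
rewrite -[scaleR _ _ _ _ _](subrK (scaleR m Xi W rho 0)) addrC.
rewrite (le_trans (nrmD _ _)) // lerD2l.
apply: (@le_trans _ _ (kd * z)); last by rewrite ler_piMr.
by apply: dlip => [j i _|]; apply: cabs_pow0.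
Qed.

End ScaledBasis.

(** * Hamiltonian structure *)

Section Adjoint.
Variable R : realType.
Local Notation C := R[i].

Lemma adjmxM a b c (A : 'M[C]_(a, b)) (B : 'M[C]_(b, c)) : (A *m B) ^t* = B ^t* *m A ^t*.
Proof. by rewrite trmx_mul map_mxM. Qed.

Lemma adjmxD a b (A B : 'M[C]_(a, b)) : (A + B) ^t* = A ^t* + B ^t*.
Proof. by rewrite linearD map_mxD. Qed.

Lemma adjmxN a b (A : 'M[C]_(a, b)) : (- A) ^t* = - A ^t*.
Proof. by rewrite linearN map_mxN. Qed.

Lemma adjmxB a b (A B : 'M[C]_(a, b)) : (A - B) ^t* = A ^t* - B ^t*.
Proof. by rewrite adjmxD adjmxN. Qed.

Lemma adjmxZ a b (x : C) (A : 'M[C]_(a, b)) : (x *: A) ^t* = Num.conj x *: A ^t*.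
Proof. by apply/matrixP => i j; rewrite !mxE rmorphM. Qed.

Lemma adjmx0 a b : (0 : 'M[C]_(a, b)) ^t* = 0.
Proof. by rewrite trmx0 map_mx0. Qed.

Lemma adjmx_scalar a (x : C) : (x%:M : 'M[C]_a) ^t* = (Num.conj x)%:M.
Proof. by rewrite tr_scalar_mx map_scalar_mx. Qed.

Lemma adjmx_row a b c (A : 'M[C]_(a, b)) (B : 'M[C]_(a, c)) :
  (row_mx A B) ^t* = col_mx (A ^t*) (B ^t*).
Proof. by rewrite tr_row_mx map_col_mx. Qed.

Lemma conjCR (x : R) : Num.conj (x%:C) = x%:C.
Proof. by apply/CrealP; apply/complex_realP; exists x. Qed.

Lemma conjCRX (x : R) k : Num.conj (x%:C ^+ k) = x%:C ^+ k.
Proof. by rewrite -rmorphXn conjCR. Qed.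

Lemma adjmx_Jmx k : (Jmx C k) ^t* = - Jmx C k.
Proof.
rewrite /Jmx tr_block_mx map_block_mx opp_block_mx !trmx0 !map_mx0 opprK oppr0.
by rewrite linearN map_mxN /= trmx1 map_mx1.
Qed.


Lemma Hamiltonian_adj n (H : 'M[C]_(n + n)) : Hamiltonian H ->
  Jmx C n *m H = - (H ^t* *m Jmx C n).
Proof. by rewrite /Hamiltonian => ->; rewrite adjmxM adjmx_Jmx mulmxN. Qed.

End Adjoint.

(** * Block elimination with Psi *)

Section TailBlocks.
Variables (K : fieldType) (r : nat) (s : nat -> nat).

Fixpoint tail_col q (y : forall j : nat, 'M[K]_(s j, q)) (k d : nat) :
    'M[K]_(tail_dim s k d, q) :=
  if d is d'.+1 then col_mx (y k) (tail_col y k.+1 d') else 0.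

Lemma tail_row_col q (B : forall j, 'M[K]_(r, s j)) (y : forall j, 'M[K]_(s j, q)) k d :
  tail_row B k d *m tail_col y k d = \sum_(j < d) B (k + j)%N *m y (k + j)%N.
Proof.
elim: d k => [|d IHd] k /=; first by rewrite big_ord0 mul0mx.
rewrite mul_row_col IHd big_ord_recl addn0; congr (_ + _).
by apply: eq_bigr => j _; rewrite lift0 addnS -addSn.
Qed.

Lemma tail_col0 q (y : forall j, 'M[K]_(s j, q)) k d : tail_col y k d = 0 ->
  forall j, (k <= j < k + d)%N -> y j = 0.
Proof.
elim: d k => [|d IHd] k; first by move=> _ j; lia.
rewrite /= -[0]vsubmxK !linear0 => /eq_col_mx[yk yt] j kj.
have [<-//|jk] := eqVneq k j.
by apply: (IHd _ yt); lia.
Qed.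

Lemma eq_tail_col q (y y' : forall j, 'M[K]_(s j, q)) k d :
  (forall j, (k <= j)%N -> y j = y' j) -> tail_col y k d = tail_col y' k d.
Proof.
elim: d k => //= d IHd k yy'; rewrite yy' // (IHd k.+1) // => j kj.
by apply: yy'; apply: ltnW.
Qed.

(** Used to split [Ghat], a single matrix, into a family indexed by chain length. *)
Lemma tail_col_surj q k d (M : 'M[K]_(tail_dim s k d, q)) :
  exists y : forall j, 'M[K]_(s j, q), tail_col y k d = M.
Proof.
elim: d k M => [|d IHd] k M.
  by exists (fun j => 0); apply/matrixP => -[].
have [y yM] := IHd _ (@dsubmx _ (s k) _ _ M).
(* The family is overwritten at index [k] only; the size [s j] forces a transport along [k = j]. *)
pose y' j : 'M[K]_(s j, q) := match k =P j with
  | ReflectT e => castmx (congr1 s e, erefl q) (@usubmx _ (s k) _ _ M)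
  | ReflectF _ => y j end.
exists y'; rewrite /= -[RHS](@vsubmxK _ (s k)); congr col_mx.
  by rewrite /y'; case: eqP => // e; rewrite castmx_id.
rewrite -yM; apply: eq_tail_col => j kj; rewrite /y'; case: eqP => // e.
by rewrite e ltnn in kj.
Qed.

End TailBlocks.

Section TailSchur.
Variables (R : realType) (r : nat) (s : nat -> nat) (m rho : nat).
Local Notation C := R[i].
Variables (A B : forall j, 'M[C]_(r, s j)) (M : 'M[C]_r).
Hypothesis rho_range : (1 <= rho <= m)%N.

Lemma tail_row_adj0 q (Z : 'M[C]_(r, q)) k d : (tail_row B k d) ^t* *m Z = 0 <->
  forall j, (k <= j < k + d)%N -> (B j) ^t* *m Z = 0.
Proof.
elim: d k => [|d IHd] k /=.
  by split=> [_ j|_]; [lia | rewrite adjmx0 mul0mx].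
rewrite adjmx_row mul_col_mx.
have e0 : (0 : 'M[C]_(s k + tail_dim s k.+1 d, q)) = col_mx 0 0 by rewrite col_mx0.
rewrite [X in _ = X]e0; split.
  move=> /eq_col_mx[Bk Bt] j kj; have [<-//|jk] := eqVneq k j.
  by apply: ((IHd _).1 Bt); lia.
move=> Bj; congr col_mx; first by apply: Bj; lia.
by apply/IHd => j kj; apply: Bj; lia.
Qed.

Lemma tail_sum_col q (y : forall j, 'M[C]_(s j, q)) :
  \sum_(j < m | (rho <= j)%N) A j.+1 *m y j.+1
  = tail_row A rho.+1 (m - rho) *m tail_col y rho.+1 (m - rho).
Proof.
rewrite tail_row_col -(big_mkord (fun j => (rho <= j)%N) (fun j => A j.+1 *m y j.+1)).
rewrite -(big_mkord xpredT (fun j => A (rho.+1 + j)%N *m y (rho.+1 + j)%N)).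
have rm : (rho <= m)%N by case/andP: rho_range.
rewrite (big_cat_nat _ (n := rho)) //= big_nat_cond big1 ?add0r; last by move=> j; lia.
rewrite -{1}[rho]add0n big_addn big_mkord [RHS]big_mkord; apply: eq_big => j.
  by rewrite leq_addl.
by move=> _; rewrite addSn addnC.
Qed.

Let P k d := (tail_row B k d) ^t* *m M *m tail_row A k d.
Let G := - (invmx (P rho.+1 (m - rho)) *m (tail_row B rho.+1 (m - rho)) ^t* *m M *m A rho).

Lemma tail_schur_tail q (y : forall j, 'M[C]_(s j, q)) :
  P rho.+1 (m - rho) \in unitmx ->
  (forall k, (rho < k <= m)%N ->
     (B k) ^t* *m M *m \sum_(j < m | (rho <= j)%N) A j.+1 *m y j.+1 = 0) ->
  forall j, (rho < j <= m)%N -> y j = 0.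
Proof.
move=> P_tail eqy j rj; apply: (@tail_col0 _ _ _ _ rho.+1 (m - rho)); last by lia.
rewrite -[LHS]mul1mx -(mulVmx P_tail) -mulmxA [X in _ *m X](_ : _ = 0) ?mulmx0 //.
rewrite -!mulmxA -tail_sum_col; apply/tail_row_adj0 => k rk.
by rewrite mulmxA eqy //; lia.
Qed.

Lemma tail_schur_head q (u : 'M[C]_(s rho, q)) (y : forall j, 'M[C]_(s j, q)) :
  P rho (m - rho).+1 \in unitmx ->
  (forall k, (rho <= k <= m)%N -> (B k) ^t* *m M *m
     (A rho *m u + \sum_(j < m | (rho <= j)%N) A j.+1 *m y j.+1) = 0) ->
  u = 0.
Proof.
move=> P_head eqy; have : col_mx u (tail_col y rho.+1 (m - rho)) = 0.
  rewrite -[LHS]mul1mx -(mulVmx P_head) -mulmxA [X in _ *m X](_ : _ = 0) ?mulmx0 //.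
  rewrite -!mulmxA mul_row_col -tail_sum_col.
  apply/(tail_row_adj0 _ rho (m - rho).+1) => k rk.
  by rewrite mulmxA eqy //; lia.
by rewrite -[0]vsubmxK !linear0 => /eq_col_mx[].
Qed.

(** Multiplying [G] by the tail block of [P] cancels the column coming from [A rho]. [A] and [B]
    stay abstract because the mirror frame exchanges [Xi] and [Xic]. *)
Lemma tail_schur_lead : P rho.+1 (m - rho) \in unitmx -> exists Gf : forall j, 'M[C]_(s j, s rho),
  [/\ tail_row A rho (m - rho).+1 *m col_mx 1%:M G
        = A rho + \sum_(j < m | (rho <= j)%N) A j.+1 *m Gf j.+1,
      tail_row A rho.+1 (m - rho) *m G
        = \sum_(j < m | (rho <= j)%N) A j.+1 *m Gf j.+1
    & forall k, (rho < k <= m)%N -> (B k) ^t* *m M *m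
        (A rho + \sum_(j < m | (rho <= j)%N) A j.+1 *m Gf j.+1) = 0].
Proof.
move=> P_tail; have [Gf GfG] := tail_col_surj G; exists Gf.
rewrite tail_sum_col GfG mul_row_col mulmx1; split=> // k rk.
rewrite -mulmxA; apply: ((tail_row_adj0 _ rho.+1 (m - rho)).1 _ k); last by lia.
rewrite mulmxA mulmxDr mulmxA -/(P _ _) /G mulmxN !mulmxA mulmxV // mul1mx.
by rewrite subrr.
Qed.

End TailSchur.

(** * Block relations of the eigenbasis *)

Section EigenbasisBlocks.
Variables (R : realType) (n m : nat) (s : nat -> nat).
Local Notation C := R[i].
Local Notation J := (Jmx C n).

Lemma adj_mxrow a p (q_ : 'I_p -> nat) (B : forall j, 'M[C]_(a, q_ j)) :
  (\mxrow_j B j) ^t* = \mxcol_j (B j) ^t*.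
Proof. by rewrite tr_mxrow; apply/matrixP => i j; rewrite !mxE. Qed.

(** Two nested partitions, by chain length and then inside the chains. By [colblkE] it is a right
    multiplication by a slice of the identity, hence linear. *)
Definition colblk a (A : 'M[C]_(a, psize m s)) (k : 'I_m) (i : 'I_k.+1) :
    'M[C]_(a, s k.+1) :=
  submxrow (q_ := fun _ : 'I_k.+1 => s k.+1)
    (submxrow (q_ := fun j : 'I_m => (\sum_(i < j.+1) s j.+1)%N) A k) i.

Definition rowblk a (A : 'M[C]_(psize m s, a)) (k : 'I_m) (i : 'I_k.+1) :
    'M[C]_(s k.+1, a) :=
  submxcol (p_ := fun _ : 'I_k.+1 => s k.+1)
    (submxcol (p_ := fun j : 'I_m => (\sum_(i < j.+1) s j.+1)%N) A k) i.

Lemma colblk_allgrp (Xi : forall j i : nat, 'M[C]_(n + n, s j)) (k : 'I_m) (i : 'I_k.+1) :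
  colblk (allgrp m Xi) i = Xi k.+1 i.+1.
Proof. by rewrite /colblk /allgrp mxrowK /grp mxrowK. Qed.

Lemma colblk_mul a b (A : 'M[C]_(a, b)) (B : 'M[C]_(b, psize m s)) (k : 'I_m) (i : 'I_k.+1) :
  colblk (A *m B) i = A *m colblk B i.
Proof. by rewrite /colblk !mul_submxrow. Qed.

Lemma rowblk_mul a b (A : 'M[C]_(psize m s, a)) (B : 'M[C]_(a, b)) (k : 'I_m) (i : 'I_k.+1) :
  rowblk (A *m B) i = rowblk A i *m B.
Proof. by rewrite /rowblk !submxcol_mul. Qed.

Lemma colblkE a (A : 'M[C]_(a, psize m s)) (k : 'I_m) (i : 'I_k.+1) :
  colblk A i = A *m colblk 1%:M i.
Proof. by rewrite -colblk_mul mulmx1. Qed.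

Lemma colblkD a (A B : 'M[C]_(a, psize m s)) (k : 'I_m) (i : 'I_k.+1) :
  colblk (A + B) i = colblk A i + colblk B i.
Proof. by rewrite (colblkE (A + B)) (colblkE A) (colblkE B) mulmxDl. Qed.

Lemma colblkZ a x (A : 'M[C]_(a, psize m s)) (k : 'I_m) (i : 'I_k.+1) :
  colblk (x *: A) i = x *: colblk A i.
Proof. by rewrite (colblkE (x *: A)) (colblkE A) -scalemxAl. Qed.

Lemma rowblkE a (A : 'M[C]_(psize m s, a)) (k : 'I_m) (i : 'I_k.+1) :
  rowblk A i = rowblk 1%:M i *m A.
Proof. by rewrite -rowblk_mul mul1mx. Qed.

Lemma rowblkD a (A B : 'M[C]_(psize m s, a)) (k : 'I_m) (i : 'I_k.+1) :
  rowblk (A + B) i = rowblk A i + rowblk B i.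
Proof. by rewrite (rowblkE (A + B)) (rowblkE A) (rowblkE B) mulmxDr. Qed.

Lemma rowblkZ a x (A : 'M[C]_(psize m s, a)) (k : 'I_m) (i : 'I_k.+1) :
  rowblk (x *: A) i = x *: rowblk A i.
Proof. by rewrite (rowblkE (x *: A)) (rowblkE A) -scalemxAr. Qed.

Lemma rowblkN a (A : 'M[C]_(psize m s, a)) (k : 'I_m) (i : 'I_k.+1) :
  rowblk (- A) i = - rowblk A i.
Proof. by rewrite (rowblkE (- A)) (rowblkE A) mulmxN. Qed.

Lemma rowblk_adj a (A : 'M[C]_(a, psize m s)) (k : 'I_m) (i : 'I_k.+1) :
  rowblk (A ^t*) i = (colblk A i) ^t*.
Proof. by apply/matrixP => x y; rewrite !mxE. Qed.

(** The identity is block diagonal for the partition by chain length, and so is each of its diagonal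
    blocks for the inner partition. *)
Lemma block_1 (k : 'I_m) (i : 'I_k.+1) (k' : 'I_m) (i' : 'I_k'.+1) :
  (k == k' -> nat_of_ord i == i' -> False) ->
  rowblk (colblk 1%:M i') i = 0.
Proof.
move=> kk'.
have -> : rowblk (colblk 1%:M i') i =
    submxblock (submxblock (p_ := fun j : 'I_m => (\sum_(i < j.+1) s j.+1)%N)
      (q_ := fun j : 'I_m => (\sum_(i < j.+1) s j.+1)%N) 1%:M k k')
      (p_ := fun _ : 'I_k.+1 => s k.+1) (q_ := fun _ : 'I_k'.+1 => s k'.+1) i i'.
  by apply/matrixP => x y; rewrite !mxE.
rewrite -(mxdiagZ (p_ := fun j : 'I_m => (\sum_(i < j.+1) s j.+1)%N)).
have [kk|kk] := eqVneq k k'; last first.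
  by rewrite /mxdiag mxblockK ifN ?submxblock0.
move: i' kk'; rewrite -{}kk => i' kk'; rewrite submxblock_diag.
rewrite -(mxdiagZ (p_ := fun _ : 'I_k.+1 => s k.+1)) /mxdiag mxblockK ifN ?submxblock0 //.
by apply/eqP => ii'; apply: kk'; rewrite ?ii' eqxx.
Qed.

Lemma block_1_diag (k : 'I_m) (i : 'I_k.+1) : rowblk (colblk 1%:M i) i = 1%:M.
Proof.
have -> : rowblk (colblk 1%:M i) i =
    submxblock (submxblock (p_ := fun j : 'I_m => (\sum_(i < j.+1) s j.+1)%N)
      (q_ := fun j : 'I_m => (\sum_(i < j.+1) s j.+1)%N) 1%:M k k)
      (p_ := fun _ : 'I_k.+1 => s k.+1) (q_ := fun _ : 'I_k.+1 => s k.+1) i i.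
  by apply/matrixP => x y; rewrite !mxE.
rewrite -(mxdiagZ (p_ := fun j : 'I_m => (\sum_(i < j.+1) s j.+1)%N)) submxblock_diag.
by rewrite -(mxdiagZ (p_ := fun _ : 'I_k.+1 => s k.+1)) submxblock_diag.
Qed.

Lemma colblk_Nmx (Xi : forall j i : nat, 'M[C]_(n + n, s j)) (k : 'I_m) (i : 'I_k.+1) :
  colblk (allgrp m Xi *m Nmx C m s) i = if (0 < i)%N then Xi k.+1 i else 0.
Proof.
rewrite /colblk /allgrp /Nmx mul_mxrow_mxdiag mxrowK /grp /Nblock mul_mxrow_mxblock mxrowK.
case: i => [[|i] ik] /=.
  by rewrite big1 // => a _; rewrite mulmx0.
rewrite (bigD1 (Ordinal (ltnW ik))) //= eqxx mulmx1 big1 ?addr0 // => a ai.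
rewrite ifN ?mulmx0 // eqSS; apply: contra_neqN ai => /eqP ai; exact: val_inj.
Qed.

Lemma rowblk_Nmx (Xi : forall j i : nat, 'M[C]_(n + n, s j)) (k : 'I_m) (i : 'I_k.+1) :
  rowblk (Nmx C m s *m (allgrp m Xi) ^t*) i =
  if (i < k)%N then (Xi k.+1 i.+2) ^t* else 0.
Proof.
rewrite /rowblk /allgrp adj_mxrow /Nmx mul_mxdiag_mxcol mxcolK -submxcol_mul.
rewrite /grp adj_mxrow /Nblock mxblockEv mxcolK -/(eblk C k.+1 (s k.+1) i.+1).
case: ltnP => ik; last by rewrite eblk_ge ?mul0mx.
by rewrite (eblk_mxcol (ik : (i.+1 < k.+1)%N)).
Qed.

Variables (H : 'M[C]_(n + n)) (lambda : C)
  (Xi Xic : forall j i : nat, 'M[C]_(n + n, s j))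
  (PhiC : 'M[C]_(n + n, (n - psize m s) + (n - psize m s)))
  (HC : 'M[C]_((n - psize m s) + (n - psize m s))).
Let Phi := row_mx (row_mx (allgrp m Xi) (allgrp m Xic)) PhiC.
Let LN := lambda%:M + Nmx C m s.
Hypothesis Phi_inv : invertible_mx Phi.
Hypothesis H_Phi : H *m Phi = Phi *m diag2 (diag2 LN (- LN ^t*)) HC.
Hypothesis J_Phi : Phi ^t* *m J *m Phi
             = diag2 (Jmx C (psize m s)) (Jmx C (n - psize m s)).

Lemma eigenbasis_columns :
  [/\ H *m allgrp m Xi = allgrp m Xi *m LN,
      H *m allgrp m Xic = - (allgrp m Xic *m LN ^t*) & H *m PhiC = PhiC *m HC].
Proof.
move: H_Phi; rewrite /Phi /diag2 !mul_mx_row !mul_row_block !mulmx0 !addr0 !add0r.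
by rewrite mulmxN => /eq_row_mx[/eq_row_mx[-> ->] ->].
Qed.

Lemma eigenbasis_pairing :
  (allgrp m Xi) ^t* *m J *m allgrp m Xic = 1%:M.
Proof.
move: J_Phi; rewrite /Phi /diag2 !adjmx_row !mul_col_mx !mul_mx_row /block_mx.
move=> /eq_col_mx[+ _]; rewrite -block_mxEv block_mxEh => /eq_row_mx[+ _].
by rewrite /Jmx block_mxEv => /eq_col_mx[/eq_row_mx[]].
Qed.

Lemma block_ordinals (P : nat -> nat -> Prop) :
  (forall (k : 'I_m) (i : 'I_k.+1), P k.+1 i.+1) ->
  forall k i, is_block m k i -> P k i.
Proof.
move=> Pki [|k] [|i] //; rewrite /is_block => // /andP[_ /andP[ik km]].
exact: (Pki (Ordinal km) (Ordinal ik)).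
Qed.

Lemma H_Xi k i : is_block m k i ->
  H *m Xi k i = lambda *: Xi k i + (if (1 < i)%N then Xi k i.-1 else 0).
Proof.
move: k i; apply: block_ordinals => k i; rewrite -colblk_allgrp -colblk_mul.
have [-> _ _] := eigenbasis_columns.
rewrite /LN mulmxDr mul_mx_scalar colblkD colblkZ colblk_Nmx colblk_allgrp.
by rewrite ltnS.
Qed.

Lemma H_Xic k i : is_block m k i ->
  H *m Xic k i = - (Num.conj lambda *: Xic k i + (if (i < k)%N then Xic k i.+1 else 0)).
Proof.
move: k i; apply: block_ordinals => k i; rewrite -colblk_allgrp -colblk_mul.
have [_ -> _] := eigenbasis_columns.
rewrite -[LHS]trmxCK -rowblk_adj adjmxN adjmxM trmxCK /LN mulmxDl mul_scalar_mx.
rewrite rowblkN rowblkD rowblkZ rowblk_Nmx rowblk_adj adjmxN adjmxD adjmxZ trmxCK.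
rewrite colblk_allgrp ltnS; congr (- (_ + _)).
by case: ifP => _; rewrite ?trmxCK ?adjmx0.
Qed.

Lemma Xi_J_Xic_ord (k : 'I_m) (i i' : 'I_k.+1) :
  (Xi k.+1 i.+1) ^t* *m J *m Xic k.+1 i'.+1 = if i == i' then 1%:M else 0.
Proof.
rewrite -(colblk_allgrp Xi i) -(colblk_allgrp Xic i').
rewrite -rowblk_adj -!rowblk_mul -colblk_mul eigenbasis_pairing.
case: eqP => [->|ii']; first exact: block_1_diag.
by apply: block_1 => _ /eqP e; apply: ii'; apply: val_inj.
Qed.

Lemma Xi_J_Xic_same k i i' : is_block m k i -> is_block m k i' ->
  (Xi k i) ^t* *m J *m Xic k i' = if i == i' then 1%:M else 0.
Proof.
case: k => [|k]; first by rewrite /is_block; lia.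
case: i i' => [|i] [|i'] // /andP[_ /andP[ik km]] /andP[_ /andP[ik' _]].
exact: (@Xi_J_Xic_ord (Ordinal km) (Ordinal ik) (Ordinal ik')).
Qed.

Lemma Xi_J_Xic_diff k i k' i' : is_block m k i -> is_block m k' i' -> k != k' ->
  (Xi k i) ^t* *m J *m Xic k' i' = 0.
Proof.
move=> B B' kk'; move: k i B k' i' B' kk'; apply: block_ordinals => k i.
apply: block_ordinals => k' i' kk'.
rewrite -(colblk_allgrp Xi i) -(colblk_allgrp Xic i').
rewrite -rowblk_adj -!rowblk_mul -colblk_mul eigenbasis_pairing.
by apply: block_1 => /eqP e; rewrite e eqxx in kk'.
Qed.

(** For [Y = Phi c], [J_Phi] turns the two orthogonality assumptions into the vanishing of the
    components of [c] along [Xic] and [Xi]. So [Y = PhiC c3], and [H Y = mu Y] becomes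
    [(HC - mu) c3 = 0]. *)
Lemma complement_eigen (mu : C) q (Y : 'M[C]_(n + n, q)) :
  ~~ eigenvalue HC mu -> H *m Y = mu *: Y ->
  (forall k i, is_block m k i -> (Xi k i) ^t* *m J *m Y = 0) ->
  (forall k i, is_block m k i -> (Xic k i) ^t* *m J *m Y = 0) -> Y = 0.
Proof.
move=> muHC HY XiY XicY; have [B [PB BP]] := Phi_inv.
pose c := B *m Y; have Yc : Y = Phi *m c by rewrite mulmxA PB mul1mx.
have grp0 (X : forall j i : nat, 'M[C]_(n + n, s j)) :
    (forall k i, is_block m k i -> (X k i) ^t* *m J *m Y = 0) ->
    (allgrp m X) ^t* *m J *m Y = 0.
  move=> XY; rewrite -mulmxA /allgrp adj_mxrow mxcol_mul -[RHS]mxcol0.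
  apply/eq_mxcolP => k; rewrite /grp adj_mxrow mxcol_mul -[RHS]mxcol0.
  by apply/eq_mxcolP => i; rewrite mulmxA XY // is_block_ord.
have : Phi ^t* *m J *m Y = col_mx (col_mx 0 0) (PhiC ^t* *m J *m Y).
  by rewrite /Phi !adjmx_row !mul_col_mx !grp0.
rewrite Yc mulmxA J_Phi -Yc -[c]vsubmxK -[usubmx c]vsubmxK /diag2 /Jmx.
rewrite !mul_block_col !(mul0mx, add0r, addr0, mul1mx, mulNmx).
move=> /eq_col_mx[/eq_col_mx[c2 c1] _].
have Yc3 : Y = PhiC *m dsubmx c.
  rewrite Yc -[c in LHS]vsubmxK -[usubmx c]vsubmxK c2 -[usubmx (usubmx c)]opprK c1 oppr0.
  by rewrite /Phi !mul_row_col !mulmx0 !add0r.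
have [_ _ HPC] := eigenbasis_columns.
have : Phi *m col_mx 0 ((HC - mu%:M) *m dsubmx c) = 0.
  rewrite /Phi mul_row_col mulmx0 add0r mulmxBl mulmxBr mulmxA -HPC -mulmxA -Yc3 HY.
  by rewrite mul_scalar_mx -scalemxAr -Yc3 subrr.
move/(congr1 (mulmx B)); rewrite mulmxA BP mul1mx mulmx0 -[0 in RHS]vsubmxK.
move=> /eq_col_mx[_]; rewrite linear0 => c3.
have uHC : HC - mu%:M \in unitmx.
  rewrite -row_free_unit -kermx_eq0; by move: muHC; rewrite /eigenvalue negbK.
by rewrite Yc3 -[dsubmx c](mulKmx uHC) c3 !mulmx0.
Qed.

End EigenbasisBlocks.

(** At [k = rho] the sum is only [rho - 1]; this gap makes the chains of length [rho] dominate the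
    pairing. *)
Lemma jexp_rev rho k i : (1 <= i <= k)%N -> k != rho ->
  (rho <= jexp rho k i + jexp rho k (k.+1 - i))%N.
Proof. by rewrite /jexp; case: ifP; lia. Qed.

Lemma rev_ord_lt rho a : (a < rho)%N -> (rho - a.+1 < rho)%N.
Proof. lia. Qed.

Lemma rev_ord_succ rho a : (a < rho)%N -> ((rho - a.+1).+1 = rho - a)%N.
Proof. lia. Qed.

Lemma rev_ord_sum rho a : (a < rho)%N -> (a + (rho - a.+1) = rho.-1)%N.
Proof. lia. Qed.

Lemma rev_revK k i : (i <= k)%N -> (k.+1 - (k.+1 - i) = i)%N.
Proof. lia. Qed.

(** * The frames of lambda and of its mirror eigenvalue *)

Section DualFrames.
Variables (R : realType) (n m : nat) (s : nat -> nat).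
Local Notation C := R[i].
Local Notation J := (Jmx C n).
Variables (Xi Xic : forall j i : nat, 'M[C]_(n + n, s j)).

(** The sign comes from [J^* = - J]: the known relation [Xi^* J Xic = 1] is read from the other
    side. *)
Definition right_dual (k i : nat) : 'M[C]_(s k, n + n) := - ((Xic k i) ^t* *m J).

(* The frame of the eigenvalue [conj lambda] of [- H]: reversing the blocks of
   each Jordan chain turns the subdiagonal of [N ^t*] into the superdiagonal. *)
Definition mirror (k i : nat) : 'M[C]_(n + n, s k) := Xic k (k.+1 - i)%N.
Definition mirror_dual (k i : nat) : 'M[C]_(s k, n + n) := (Xi k (k.+1 - i)%N) ^t* *m J.

Hypothesis same : forall k i i', is_block m k i -> is_block m k i' ->
  (Xi k i) ^t* *m J *m Xic k i' = if i == i' then 1%:M else 0.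
Hypothesis diff : forall k i k' i', is_block m k i -> is_block m k' i' -> k != k' ->
  (Xi k i) ^t* *m J *m Xic k' i' = 0.

Lemma is_block_rev k i : is_block m k i -> is_block m k (k.+1 - i).
Proof. by rewrite /is_block; lia. Qed.

Lemma right_dual_mul a (k i : nat) (A : 'M[C]_(n + n, a)) :
  right_dual k i *m A = (A ^t* *m J *m Xic k i) ^t*.
Proof. by rewrite !adjmxM trmxCK adjmx_Jmx /right_dual mulNmx mulmxA mulmxN mulNmx. Qed.

Lemma biorthogonal_right : biorthogonal m Xi right_dual.
Proof.
split=> [k i i' B B'|k i k' i' B B' kk'].
  rewrite right_dual_mul same // eq_sym; case: eqP => _; last exact: adjmx0.
  by rewrite adjmx_scalar rmorph1.
by rewrite right_dual_mul diff ?adjmx0 // eq_sym.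
Qed.

Lemma biorthogonal_mirror : biorthogonal m mirror mirror_dual.
Proof.
split=> [k i i' B B'|k i k' i' B B' kk'].
  rewrite /mirror /mirror_dual same ?is_block_rev //; congr (if _ then _ else _).
  by apply/eqP/eqP; move: B B'; rewrite /is_block; lia.
by rewrite diff ?is_block_rev.
Qed.

Variables (H : 'M[C]_(n + n)) (lambda : C).
Hypothesis H_ham : Hamiltonian H.
Hypothesis HXi : forall k i, is_block m k i ->
  H *m Xi k i = lambda *: Xi k i + (if (1 < i)%N then Xi k i.-1 else 0).
Hypothesis HXic : forall k i, is_block m k i ->
  H *m Xic k i = - (Num.conj lambda *: Xic k i + (if (i < k)%N then Xic k i.+1 else 0)).

Lemma Hamiltonian_row a (A : 'M[C]_(n + n, a)) : A ^t* *m J *m H = - ((H *m A) ^t* *m J).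
Proof. by rewrite -mulmxA Hamiltonian_adj // mulmxN adjmxM !mulmxA. Qed.

Lemma jordan_right : jordan_frame m Xi right_dual H lambda.
Proof.
split=> // k i B; rewrite /right_dual mulNmx Hamiltonian_row HXic // opprK.
rewrite adjmxN adjmxD adjmxZ conjCK mulNmx mulmxDl -scalemxAl opprD -scalerN; congr (_ + _).
by case: ifP => _; rewrite ?adjmx0 ?mul0mx ?oppr0.
Qed.

Lemma jordan_mirror : jordan_frame m mirror mirror_dual (- H) (Num.conj lambda).
Proof.
split=> k i B; have B' := is_block_rev B; rewrite /is_block in B B'.
  rewrite /mirror_dual mulmxN Hamiltonian_row opprK HXi // adjmxD adjmxZ mulmxDl.
  rewrite -scalemxAl; congr (_ + _); rewrite (_ : (1 < k.+1 - i)%N = (i < k)%N); last by lia.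
  case: ifP => ik; last by rewrite adjmx0 mul0mx.
  by rewrite subSS subSn //; lia.
rewrite /mirror mulNmx HXic // opprK; congr (_ + _).
rewrite (_ : (k.+1 - i < k)%N = (1 < i)%N); last by lia.
case: ifP => // i1; congr (Xic k _); lia.
Qed.

Hypothesis lambda_nonimag : lambda + Num.conj lambda != 0.

(** [J H] is Hermitian, so pairing a [lambda] chain with a [lambda] eigenvector produces the nonzero
    factor [lambda + conj lambda]; induction along the chain follows. Orthogonality to [Xi] is thus
    automatic, and [compl] needs only that to [Xic]. *)
Lemma right_complement q (Y : 'M[C]_(n + n, q)) : H *m Y = lambda *: Y ->
  forall k i, is_block m k i -> (Xi k i) ^t* *m J *m Y = 0.
Proof.
move=> HY k i B.
have step i' : is_block m k i' -> (lambda + Num.conj lambda) *: ((Xi k i') ^t* *m J *m Y)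
    = - ((if (1 < i')%N then Xi k i'.-1 else 0) ^t* *m J *m Y).
  move=> B'; rewrite scalerDl scalemxAr -HY mulmxA Hamiltonian_row HXi //.
  rewrite adjmxD adjmxZ !mulmxDl opprD mulmxDl -!scalemxAl !mulNmx addrAC.
  by rewrite -scalemxAl addNr add0r.
elim: i B => [|i IHi] B; first by move: B; rewrite /is_block.
have /eqP := step _ B; have [->|i0] := posnP i.
  by rewrite adjmx0 !mul0mx oppr0 scaler_eq0 (negbTE lambda_nonimag) => /eqP.
rewrite ltnS i0 /= IHi ?oppr0; last by move: B; rewrite /is_block; lia.
by rewrite scaler_eq0 (negbTE lambda_nonimag) => /eqP.
Qed.

(** As before, but [H] raises the index on the chains of [Xic], so the induction runs down from
    [i = k]. *)
Lemma mirror_complement q (Y : 'M[C]_(n + n, q)) : H *m Y = - Num.conj lambda *: Y ->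
  forall k i, is_block m k i -> (Xic k i) ^t* *m J *m Y = 0.
Proof.
move=> HY k i B.
have step i' : is_block m k i' -> (lambda + Num.conj lambda) *: ((Xic k i') ^t* *m J *m Y)
    = - ((if (i' < k)%N then Xic k i'.+1 else 0) ^t* *m J *m Y).
  move=> B'; have e : (Xic k i') ^t* *m J *m (H *m Y) = lambda *: ((Xic k i') ^t* *m J *m Y)
      + (if (i' < k)%N then Xic k i'.+1 else 0) ^t* *m J *m Y.
    rewrite mulmxA Hamiltonian_row HXic // adjmxN !mulNmx opprK adjmxD adjmxZ conjCK.
    by rewrite !mulmxDl -!scalemxAl.
  move: e; rewrite HY -scalemxAr => /eqP; rewrite addrC -subr_eq => /eqP <-.
  by rewrite scaleNr opprD !opprK scalerDl addrC.
have down j : (j < k)%N -> (Xic k (k - j)%N) ^t* *m J *m Y = 0.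
  elim: j => [|j IHj] jk.
    have /eqP := step k ltac:(move: B; rewrite /is_block; lia).
    rewrite ltnn adjmx0 !mul0mx oppr0 scaler_eq0 (negbTE lambda_nonimag) subn0.
    by move/eqP.
  have /eqP := step (k - j.+1)%N ltac:(move: B; rewrite /is_block; lia).
  have -> : (k - j.+1 < k)%N by lia.
  have -> : (k - j.+1).+1 = (k - j)%N by lia.
  rewrite IHj; last by lia.
  by rewrite oppr0 scaler_eq0 (negbTE lambda_nonimag) => /eqP.
have -> : i = (k - (k - i))%N by move: B; rewrite /is_block; lia.
by apply: down; move: B; rewrite /is_block; lia.
Qed.

End DualFrames.

(** * Pairing of the two bases by J *)

Section Pairing.
Variables (R : realType) (rho sr : nat).
Local Notation C := R[i].
Local Notation e_ a := (eblk C rho sr a).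

Lemma eblk_adj a b : (a < rho)%N -> e_ a *m (e_ b) ^t* = if a == b then 1%:M else 0.
Proof.
move=> ha; rewrite {2}/eblk adj_mxrow (eblk_mxcol ha) /=.
by case: eqP => _; rewrite ?adjmx_scalar ?rmorph1 ?adjmx0.
Qed.

(** The mirror frame lists each chain backwards, so two normalized bases pair to this flip instead
    of the identity. *)
Definition rev_blocks : 'M[C]_(\sum_(i < rho) sr) :=
  \mxcol_(a < rho) e_ (rho - a.+1)%N.

Lemma eblk_rev a : (a < rho)%N -> e_ a *m rev_blocks = e_ (rho - a.+1)%N.
Proof. by move=> ha; rewrite (eblk_mxcol ha). Qed.

Lemma rev_blocksK : rev_blocks *m rev_blocks = 1%:M.
Proof.
apply: eblk_ext => a ha; rewrite mulmxA eblk_rev // eblk_rev ?mulmx1; last by lia.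
by congr eblk; lia.
Qed.

Lemma rev_blocksE : rev_blocks = \sum_(a < rho) (e_ a) ^t* *m e_ (rho - a.+1)%N.
Proof.
apply: eblk_ext => a ha; rewrite eblk_rev // mulmx_sumr.
rewrite [RHS](bigD1 (Ordinal ha)) //= mulmxA eblk_adj // eqxx mul1mx.
rewrite [X in _ + X]big1 ?addr0 // => b ba; rewrite mulmxA eblk_adj // ifN ?mul0mx //.
by rewrite eq_sym -val_eqE in ba *.
Qed.
End Pairing.

Section PairingEstimate.
Variables (R : realType) (n m : nat) (s : nat -> nat).
Local Notation C := R[i].
Local Notation J := (Jmx C n).
Variables (Xi Xic : forall j i : nat, 'M[C]_(n + n, s j)) (rho : nat).
Hypothesis rho_range : (1 <= rho <= m)%N.
Local Notation W1 := (right_dual Xic).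
Local Notation W2 := (mirror_dual Xi).
Local Notation q := (\sum_(i < rho) s rho)%N.
Local Notation e_ a := (eblk C rho (s rho) a).

(** Expand [X] in its frame: [Xi k i] paired with [Y] is the mirror coordinate [(k, k + 1 - i)] of
    [Y]. Chain [rho] gives the main term exactly; [jexp_rev] puts the other chains at order
    [z ^+ rho], as does the bound on the complement. *)
Lemma pairing_estimate (k1 k2 : R) : 0 <= k1 -> 0 <= k2 ->
  exists2 c : R, 0 <= c & forall (z : R) (X Y : 'M[C]_(n + n, q)), 0 < z -> z <= 1 ->
  (forall a, (a < rho)%N -> W1 rho a.+1 *m X = z%:C ^+ a *: e_ a) ->
  (forall a, (a < rho)%N -> W2 rho a.+1 *m Y = z%:C ^+ a *: e_ a) ->
  (forall j i, is_block m j i -> nrm (W1 j i *m X) <= k1 * z ^+ jexp rho j i) ->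
  (forall j i, is_block m j i -> nrm (W2 j i *m Y) <= k2 * z ^+ jexp rho j i) ->
  nrm (frame_compl m Xi W1 *m X) <= k1 * z ^+ rho -> nrm Y <= k2 ->
  nrm (X ^t* *m J *m Y - z%:C ^+ rho.-1 *: rev_blocks R rho (s rho)) <= c * z ^+ rho.
Proof.
move=> k1_ge0 k2_ge0.
pose b := \sum_(k < m) \sum_(i < k.+1) (k1 * k2).
have b_ge0 : 0 <= b by do 2 (apply: sumr_ge0 => ? _); rewrite mulr_ge0.
have J_ge0 := nrm_ge0 J.
exists (b + k1 * nrm J * k2) => [|z X Y z_gt0 z1 Xr Yr X_le Y_le PX_le Y_le2].
  by rewrite addr_ge0 ?mulr_ge0.
have z_ge0 := ltW z_gt0.
have rm : (rho.-1 < m)%N by case/andP: rho_range => r0; rewrite prednK.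
have rhoS : rho.-1.+1 = rho by case/andP: rho_range => r0 _; rewrite prednK.
pose term (k i : nat) := (W1 k i *m X) ^t* *m (W2 k (k.+1 - i)%N *m Y).
have pairE : X ^t* *m J *m Y = \sum_(k < m) \sum_(i < k.+1) term k.+1 i.+1
    + (frame_compl m Xi W1 *m X) ^t* *m J *m Y.
  rewrite {1}[X](frame_decomp m Xi W1) adjmxD !mulmxDl; congr (_ + _).
  rewrite /frame_sum [X in X *m _ *m _](_ : _ =
     \sum_(k < m) \sum_(i < k.+1) (Xi k.+1 i.+1 *m (W1 k.+1 i.+1 *m X)) ^t*); last first.
    by rewrite linear_sum raddf_sum; apply: eq_bigr => k _; rewrite linear_sum raddf_sum.
  rewrite !mulmx_suml; apply: eq_bigr => k _; rewrite !mulmx_suml; apply: eq_bigr => i _.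
  rewrite /term adjmxM /mirror_dual -!mulmxA; congr (_ *m (_ ^t* *m _)).
  by congr (Xi _ _); rewrite (rev_revK (ltn_ord i)).
have term_rho : \sum_(i < rho) term rho i.+1 = z%:C ^+ rho.-1 *: rev_blocks R rho (s rho).
  rewrite rev_blocksE scaler_sumr; apply: eq_bigr => a _.
  have ar := ltn_ord a; rewrite /term Xr // subSS.
  rewrite -(rev_ord_succ ar) Yr ?rev_ord_lt //.
  rewrite adjmxZ -scalemxAl -scalemxAr scalerA conjCRX -exprD.
  by congr (_ ^+ _ *: _); exact: rev_ord_sum.
have term_le k i : is_block m k i -> k != rho -> nrm (term k i) <= k1 * k2 * z ^+ rho.
  move=> B krho; have B' := is_block_rev B.
  apply: le_trans (nrmM _ _) _; rewrite nrm_adj.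
  apply: le_trans (ler_pM (nrm_ge0 _) (nrm_ge0 _) (X_le _ _ B) (Y_le _ _ B')) _.
  rewrite mulrACA -exprD ler_wpM2l ?mulr_ge0 // ler_wiXn2l //.
  by apply: jexp_rev => //; case/and3P: B => -> ->.
rewrite pairE (bigD1 (Ordinal rm)) //= rhoS term_rho.
rewrite [X in nrm X]addrC !addrA addNr add0r mulrDl (le_trans (nrmD _ _)) // lerD //; last first.
  apply: le_trans (nrmM _ _) _; rewrite mulrAC ler_pM ?nrm_ge0 //.
  apply: le_trans (nrmM _ _) _; rewrite nrm_adj mulrAC ler_wpM2r //.
apply: le_trans (nrm_sum _ _ _) _.
apply: (@le_trans _ _ (\sum_(k < m | k != Ordinal rm) \sum_(i < k.+1) k1 * k2 * z ^+ rho)).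
  apply: ler_sum => k krho; apply: le_trans (nrm_sum _ _ _) _; apply: ler_sum => i _.
  apply: term_le; first exact: is_block_ord.
  by apply: contra_neq krho => e; apply: val_inj => /=; rewrite -e.
rewrite big_mkcond /b mulr_suml ler_sum // => k _; rewrite mulr_suml.
by case: ifP => // _; apply: sumr_ge0 => i _; rewrite !mulr_ge0 ?exprn_ge0.
Qed.

End PairingEstimate.

(** * Construction of the structured basis *)

Section StructuredPair.
Variables (R : realType) (n m : nat) (s : nat -> nat).
Local Notation C := R[i].
Local Notation J := (Jmx C n).

(** The equation reads [(lam + conj lam) Z = - z (Th^* Z + Z Th)]; for [d] a quarter of the modulus
    of [lam + conj lam], the right side has at most half the norm of the left. *)
Lemma small_sylvester (lam : C) : lam + Num.conj lam != 0 ->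
  exists2 d : R, 0 < d & forall (z : R) q (Th Z : 'M[C]_q), 0 <= z -> z * nrm Th <= d ->
    (lam%:M + z%:C *: Th) ^t* *m Z + Z *m (lam%:M + z%:C *: Th) = 0 -> Z = 0.
Proof.
move=> lam0; pose a := cabs (lam + Num.conj lam).
have a_gt0 : 0 < a.
  rewrite lt0r cabs_ge0 andbT; apply: contra lam0 => /eqP/cabs_eq0 ->; exact: eqxx.
exists (a / 4) => [|z q Th Z z_ge0 zTh eqZ]; first by rewrite divr_gt0.
have e : (lam + Num.conj lam) *: Z = - (z%:C *: (Th ^t* *m Z + Z *m Th)).
  move: eqZ; rewrite adjmxD adjmx_scalar adjmxZ conjCR mulmxDl mulmxDr.
  rewrite mul_scalar_mx mul_mx_scalar -scalemxAl -scalemxAr addrACA -scalerDr -scalerDl.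
  by rewrite [Num.conj lam + _]addrC => /eqP; rewrite addr_eq0 => /eqP.
apply: nrm0_eq; have := congr1 (@nrm R q q) e.
rewrite nrmN !nrmZ cabsR ger0_norm // -/a => eqn.
have b : z * nrm (Th ^t* *m Z + Z *m Th) <= a / 2 * nrm Z.
  apply: (@le_trans _ _ (z * (2 * nrm Th * nrm Z))).
    rewrite ler_wpM2l // (le_trans (nrmD _ _)) //.
    have := nrmM (Th ^t*) Z; have := nrmM Z Th; rewrite nrm_adj [nrm Z * _]mulrC.
    by rewrite -mulrA; set x := nrm Th * nrm Z; lra.
  rewrite !mulrA ler_wpM2r ?nrm_ge0 // [z * 2]mulrC -mulrA.
  by apply: le_trans (ler_wpM2l _ zTh) _ => //; lra.
move: b; rewrite -eqn => b; rewrite leNgt; apply/negP => nz.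
by have := mulr_gt0 a_gt0 nz; lra.
Qed.

Lemma Hamiltonian_perturb (H T : 'M[C]_(n + n)) (x : C) : Num.conj x = x ->
  Hamiltonian H -> Hamiltonian T -> Hamiltonian (H + x *: T).
Proof.
move=> xR; rewrite /Hamiltonian => eH eT; rewrite mulmxDr adjmxD -eH; congr (_ + _).
by rewrite -scalemxAr adjmxZ xR -eT.
Qed.

(** Puts the Gram matrix of an invariant subspace in the form that [small_sylvester] annihilates. *)
Lemma isotropic (K : 'M[C]_(n + n)) q (X : 'M[C]_(n + n, q)) (A : 'M[C]_q) :
  Hamiltonian K -> K *m X = X *m A ->
  A ^t* *m (X ^t* *m J *m X) + X ^t* *m J *m X *m A = 0.
Proof.
move=> K_ham KX; rewrite -[X in _ + X]mulmxA -KX [X in _ + X]mulmxA Hamiltonian_row // KX adjmxM.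
by rewrite mulNmx !mulmxA subrr.
Qed.

(* With [B] the matrix of [- K] on [Y'] and [M = X^* J Y'], invariance forces
   [A^* M = M B], so multiplying [Y'] by [c M^-1] turns [B] into [A^*]. *)
Lemma dual_normalization (K : 'M[C]_(n + n)) q (X Y' : 'M[C]_(n + n, q))
    (A B M1 V : 'M[C]_q) (c : C) :
  Hamiltonian K -> K *m X = X *m A -> - K *m Y' = Y' *m B ->
  V *m V = 1%:M -> M1 \in unitmx -> c != 0 -> X ^t* *m J *m Y' = c *: (M1 *m V) ->
  let Y := Y' *m (V *m invmx M1) in
  K *m Y = Y *m (- A ^t*) /\ X ^t* *m J *m Y = c%:M.
Proof.
move=> K_ham KX KY' VV uM c0 XJY' Y.
have AM : A ^t* *m (M1 *m V) = M1 *m V *m B.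
  apply: (scalerI c0); rewrite scalemxAr [in RHS]scalemxAl -XJY'.
  have : X ^t* *m J *m (K *m Y') = - (X ^t* *m J *m Y' *m B).
    by rewrite -[K *m Y']opprK -mulNmx KY' mulmxN mulmxA.
  rewrite mulmxA Hamiltonian_row // KX adjmxM !mulNmx => /oppr_inj <-.
  by rewrite !mulmxA.
split; last first.
  rewrite /Y [LHS]mulmxA XJY' -scalemxAl mulmxA -(mulmxA M1) VV mulmx1 mulmxV //.
  exact: scalemx1.
have BV : B *m (V *m invmx M1) = V *m invmx M1 *m A ^t*.
  have -> : B = V *m invmx M1 *m (M1 *m V *m B).
    by rewrite -!mulmxA (mulmxA (invmx M1)) mulVmx // mul1mx mulmxA VV mul1mx.
  by rewrite -AM -!mulmxA (mulmxA V V) VV mul1mx mulmxV // mulmx1.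
have KYB : K *m Y' = - (Y' *m B) by rewrite -KY' mulNmx opprK.
rewrite /Y mulmxN [LHS]mulmxA KYB mulNmx; congr (- _).
by rewrite -[LHS]mulmxA BV [LHS]mulmxA.
Qed.

Lemma le_sum4 (x y u v : R) : 0 <= x -> 0 <= y -> 0 <= u -> 0 <= v ->
  [/\ x <= x + y + u + v, y <= x + y + u + v, u <= x + y + u + v
    & y + v <= x + y + u + v].
Proof. by move=> x0 y0 u0 v0; split; lra. Qed.

Section Main.
Variables (H T : 'M[C]_(n + n)) (lam : C) (rho : nat).
Variables (Xi Xic : forall j i : nat, 'M[C]_(n + n, s j)).
Local Notation W1 := (right_dual Xic).
Local Notation W2 := (mirror_dual Xi).
Local Notation Xi2 := (mirror Xic).
Local Notation q := (\sum_(i < rho) s rho)%N.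
Local Notation e_ a := (eblk C rho (s rho) a).
Hypothesis rho_range : (1 <= rho <= m)%N.
Hypothesis H_ham : Hamiltonian H.
Hypothesis T_ham : Hamiltonian T.
Hypothesis lam0 : lam + Num.conj lam != 0.
Hypothesis same : forall k i i', is_block m k i -> is_block m k i' ->
  (Xi k i) ^t* *m J *m Xic k i' = if i == i' then 1%:M else 0.
Hypothesis diff : forall k i k' i', is_block m k i -> is_block m k' i' -> k != k' ->
  (Xi k i) ^t* *m J *m Xic k' i' = 0.
Hypothesis HXi : forall k i, is_block m k i ->
  H *m Xi k i = lam *: Xi k i + (if (1 < i)%N then Xi k i.-1 else 0).
Hypothesis HXic : forall k i, is_block m k i ->
  H *m Xic k i = - (Num.conj lam *: Xic k i + (if (i < k)%N then Xic k i.+1 else 0)).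
Hypothesis complement : forall mu, mu = lam \/ mu = - Num.conj lam ->
  forall p (Y : 'M[C]_(n + n, p)), H *m Y = mu *: Y ->
  (forall k i, is_block m k i -> (Xi k i) ^t* *m J *m Y = 0) ->
  (forall k i, is_block m k i -> (Xic k i) ^t* *m J *m Y = 0) -> Y = 0.
Hypothesis P_head : Psi Xi Xic T rho (m - rho).+1 \in unitmx.
Hypothesis P_tail : Psi Xi Xic T rho.+1 (m - rho) \in unitmx.

Lemma JT_herm : (J *m T) ^t* = J *m T. Proof. by rewrite -T_ham. Qed.

(** [J T] is Hermitian, so exchanging [Xi] and [Xic] turns [Psi] into its adjoint and one
    invertibility assumption serves both frames. *)
Lemma Psi_adj k d : (Ups Xi k d) ^t* *m (J *m T) *m Upsc Xic k d = (Psi Xi Xic T k d) ^t*.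
Proof. by rewrite /Psi adjmxM (adjmxM _ (J *m T)) JT_herm trmxCK mulmxA. Qed.

Lemma adjmx_unit p (A : 'M[C]_p) : A ^t* \in unitmx = (A \in unitmx).
Proof. by rewrite map_unitmx unitmx_tr. Qed.

Lemma P_head_mirror :
  (Ups Xi rho (m - rho).+1) ^t* *m (J *m T) *m Upsc Xic rho (m - rho).+1 \in unitmx.
Proof. by rewrite Psi_adj adjmx_unit. Qed.

Lemma P_tail_mirror :
  (Ups Xi rho.+1 (m - rho)) ^t* *m (J *m T) *m Upsc Xic rho.+1 (m - rho) \in unitmx.
Proof. by rewrite Psi_adj adjmx_unit. Qed.

Lemma lead_right : exists Gf : forall j, 'M[C]_(s j, s rho),
  [/\ Ups Xi rho (m - rho).+1 *m col_mx 1%:M (Ghat m Xi Xic T rho) = lead m Xi Gf,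
      lead_schur m Xi W1 T Gf = - Shat m Xi Xic T rho
    & forall k, (rho < k <= m)%N -> W1 k k *m T *m lead m Xi Gf = 0].
Proof.
have [Gf [e1 e2 e3]] := tail_schur_lead (A := fun j => Xi j 1%N) (B := fun j => Xic j j)
   rho_range P_tail.
have GhatE : Ghat m Xi Xic T rho = - (invmx ((tail_row (fun j => Xic j j) rho.+1 (m - rho)) ^t*
   *m (J *m T) *m tail_row (fun j => Xi j 1%N) rho.+1 (m - rho))
   *m (tail_row (fun j => Xic j j) rho.+1 (m - rho)) ^t* *m (J *m T) *m Xi rho 1%N).
  by rewrite /Ghat /Psi /Upsc /Ups !mulmxA.
rewrite -GhatE in e1 e2; exists Gf; split=> [|| k kr].
- exact: e1.
- rewrite /lead_schur /Shat /lead /tail_sum -e2 /right_dual !mulNmx.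
  by [].
by rewrite /right_dual !mulNmx -(mulmxA _ J T) e3 ?oppr0.
Qed.

Lemma lead_mirror : exists Gf : forall j, 'M[C]_(s j, s rho),
  Upsc Xic rho (m - rho).+1 *m col_mx 1%:M (Ghatc m Xi Xic T rho) = lead m Xi2 Gf /\
  forall k, (rho < k <= m)%N -> W2 k k *m (- T) *m lead m Xi2 Gf = 0.
Proof.
have [Gf [e1 _ e3]] := tail_schur_lead (A := fun j => Xic j j) (B := fun j => Xi j 1%N)
   rho_range P_tail_mirror.
have GhatE : Ghatc m Xi Xic T rho = - (invmx ((tail_row (fun j => Xi j 1%N) rho.+1 (m - rho)) ^t*
   *m (J *m T) *m tail_row (fun j => Xic j j) rho.+1 (m - rho))
   *m (tail_row (fun j => Xi j 1%N) rho.+1 (m - rho)) ^t* *m (J *m T) *m Xic rho rho).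
  by rewrite -/(Ups Xi _ _) -/(Upsc Xic _ _) Psi_adj /Ghatc -map_invmx -trmx_inv !mulmxA.
rewrite -GhatE in e1.
have leadE : lead m Xi2 Gf = Xic rho rho + \sum_(j < m | (rho <= j)%N) Xic j.+1 j.+1 *m Gf j.+1.
  by rewrite /lead /mirror subn1.
exists Gf; split=> [|k kr]; first by rewrite leadE -e1.
by rewrite leadE /mirror_dual subSnn mulmxN mulNmx -(mulmxA _ J T) e3 ?oppr0.
Qed.

Definition right_estimates (Gf : forall j, 'M[C]_(s j, s rho)) (z k : R)
    (X : 'M[C]_(n + n, q)) :=
  [/\ forall a, (a < rho)%N -> W1 rho a.+1 *m X = z%:C ^+ a *: e_ a,
      forall j i, is_block m j i -> nrm (W1 j i *m X) <= k * z ^+ jexp rho j i,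
      forall j, (rho < j <= m)%N -> nrm (W1 j 1%N *m X - Gf j *m e_ 0) <= k * z,
      nrm (frame_compl m Xi W1 *m X) <= k * z ^+ rho & nrm X <= k].

(** In contrast with [right_estimates], the normalization on chain [rho] holds only to relative
    order [z], since this basis absorbs the correction of the pairing; the flip replaces [e_ a] by
    [e_ (rho - a.+1)]. *)
Definition mirror_estimates (Gf : forall j, 'M[C]_(s j, s rho)) (z k : R)
    (Y : 'M[C]_(n + n, q)) :=
  [/\ forall a, (a < rho)%N ->
        nrm (W2 rho a.+1 *m Y - z%:C ^+ a *: e_ (rho - a.+1)%N) <= k * z ^+ a.+1,
      forall j i, is_block m j i -> nrm (W2 j i *m Y) <= k * z ^+ jexp rho j i,
      forall j, (rho < j <= m)%N -> nrm (W2 j 1%N *m Y - Gf j *m e_ rho.-1) <= k * z,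
      nrm (frame_compl m Xi2 W2 *m Y) <= k * z ^+ rho & nrm Y <= k].

Lemma right_half : exists (Gf : forall j, 'M[C]_(s j, s rho)) (z0 k : R),
  [/\ Ups Xi rho (m - rho).+1 *m col_mx 1%:M (Ghat m Xi Xic T rho) = lead m Xi Gf,
      0 < z0, 0 <= k & forall z : R, 0 < z -> z <= z0 ->
      exists (X : 'M[C]_(n + n, q)) (Th : 'M[C]_q),
        [/\ (H + z%:C ^+ rho *: T) *m X = X *m (lam%:M + z%:C *: Th),
            nrm (Th - Theta rho (- Shat m Xi Xic T rho)) <= k * z
          & right_estimates Gf z k X]].
Proof.
have [Gf [e1 e2 e3]] := lead_right.
have W1E k p (Z : 'M[C]_(n + n, p)) : W1 k k *m T *m Z = - ((Xic k k) ^t* *m (J *m T) *m Z).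
  by rewrite /right_dual !mulNmx !mulmxA.
have [z0 [k [z0_gt0 k_ge0 basis]]] := scaled_basis rho_range (biorthogonal_right same diff)
  (jordan_right H_ham HXi HXic)
  (fun p Y (WY : forall k i, is_block m k i -> W1 k i *m Y = 0) HY =>
     complement (or_introl erefl) HY (right_complement H_ham HXi lam0 HY)
       (fun k i B => oppr_inj (etrans (esym (mulNmx _ _)) (etrans (WY k i B) (esym (oppr0 _))))))
  (fun p y ey => tail_schur_tail (A := fun j => Xi j 1%N) (B := fun j => Xic j j) rho_range P_tail
     (fun k kr => oppr_inj (etrans (esym (W1E _ _ _)) (etrans (ey k kr) (esym (oppr0 _))))))
  (fun p u y ey => tail_schur_head (A := fun j => Xi j 1%N) (B := fun j => Xic j j) rho_range P_head
     (fun k kr => oppr_inj (etrans (esym (W1E _ _ _)) (etrans (ey k kr) (esym (oppr0 _))))))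
  e3.
rewrite e2 in basis; exists Gf, z0, k; split=> // z z_gt0 z_le.
by have [X [Th [[KX dTh] c1 c2 c3 [c4 c5]]]] := basis z z_gt0 z_le; exists X, Th.
Qed.

(** The construction for [- H], [- T] and [conj lam]. Closeness of the matrix of the action to its
    limit is dropped, because [dual_normalization] replaces that matrix by the adjoint of the one on
    [X]. *)
Lemma mirror_half : exists (Gf : forall j, 'M[C]_(s j, s rho)) (z0 k : R),
  [/\ Upsc Xic rho (m - rho).+1 *m col_mx 1%:M (Ghatc m Xi Xic T rho) = lead m Xi2 Gf,
      0 < z0, 0 <= k & forall z : R, 0 < z -> z <= z0 ->
      exists (Y : 'M[C]_(n + n, q)) (B : 'M[C]_q),
        [/\ - (H + z%:C ^+ rho *: T) *m Y = Y *m B,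
            forall a, (a < rho)%N -> W2 rho a.+1 *m Y = z%:C ^+ a *: e_ a,
            forall j i, is_block m j i -> nrm (W2 j i *m Y) <= k * z ^+ jexp rho j i,
            forall j, (rho < j <= m)%N -> nrm (W2 j 1%N *m Y - Gf j *m e_ 0) <= k * z
          & nrm (frame_compl m Xi2 W2 *m Y) <= k * z ^+ rho /\ nrm Y <= k]].
Proof.
have [Gf [e1 e3]] := lead_mirror.
have W2E k p (Z : 'M[C]_(n + n, p)) : W2 k k *m (- T) *m Z = - ((Xi k 1%N) ^t* *m (J *m T) *m Z).
  by rewrite /mirror_dual subSnn mulmxN mulNmx !mulmxA.
have compl2 p (Y : 'M[C]_(n + n, p)) : (forall k i, is_block m k i -> W2 k i *m Y = 0) ->
    - H *m Y = Num.conj lam *: Y -> Y = 0.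
  move=> WY HY; have HY' : H *m Y = - Num.conj lam *: Y.
    by rewrite scaleNr -HY mulNmx opprK.
  apply: (complement (or_intror erefl) HY') => [k i B|].
    have := WY k (k.+1 - i)%N (is_block_rev B).
    by rewrite /mirror_dual rev_revK //; case/and3P: B.
  exact: (mirror_complement H_ham HXic lam0 HY').
have psi_tail2 p (y : forall j : nat, 'M[C]_(s j, p)) :
    (forall k, (rho < k <= m)%N -> W2 k k *m (- T) *m tail_sum m Xi2 rho y = 0) ->
    forall j, (rho < j <= m)%N -> y j = 0.
  move=> ey; apply: (tail_schur_tail (A := fun j => Xic j j) (B := fun j => Xi j 1%N)
    rho_range P_tail_mirror) => k kr.
  by apply: oppr_inj; rewrite oppr0 -(ey k kr) W2E.
have psi_head2 p (u : 'M[C]_(s rho, p)) (y : forall j : nat, 'M[C]_(s j, p)) :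
    (forall k, (rho <= k <= m)%N ->
       W2 k k *m (- T) *m (Xi2 rho 1%N *m u + tail_sum m Xi2 rho y) = 0) -> u = 0.
  move=> ey; apply: (tail_schur_head (A := fun j => Xic j j) (B := fun j => Xi j 1%N)
    rho_range (y := y) P_head_mirror) => k kr.
  by apply: oppr_inj; rewrite oppr0 -(ey k kr) W2E /mirror subn1.
have [z0 [k [z0_gt0 k_ge0 basis]]] := scaled_basis rho_range (biorthogonal_mirror same diff)
  (jordan_mirror H_ham HXi HXic) compl2 psi_tail2 psi_head2 e3.
exists Gf, z0, k; split=> // z z_gt0 z_le.
have [Y [B [[KY _] c1 c2 c3 c4]]] := basis z z_gt0 z_le.
exists Y, (Num.conj lam *: 1%:M + z%:C *: B); split=> //.
by rewrite opprD -scalerN KY scalemx1.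
Qed.

(** [X] is kept and [Y'] is multiplied by [Kn], which is [O(z)] close to the flip [V], so the
    estimates survive. The last clause records an exactly normalized matrix, which [Y] no longer
    is. *)
Lemma structured_pair : exists (G1 G2 : forall j, 'M[C]_(s j, s rho)) (z0 k : R),
  [/\ Ups Xi rho (m - rho).+1 *m col_mx 1%:M (Ghat m Xi Xic T rho) = lead m Xi G1,
      Upsc Xic rho (m - rho).+1 *m col_mx 1%:M (Ghatc m Xi Xic T rho) = lead m Xi2 G2,
      0 < z0 <= 1, 0 <= k & forall z : R, 0 < z -> z <= z0 ->
      exists (X Y : 'M[C]_(n + n, q)) (Th : 'M[C]_q),
        let A := lam%:M + z%:C *: Th in let K := H + z%:C ^+ rho *: T in
        [/\ [/\ K *m X = X *m A, K *m Y = Y *m (- A ^t*)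
              & nrm (Th - Theta rho (- Shat m Xi Xic T rho)) <= k * z],
            [/\ X ^t* *m J *m X = 0, Y ^t* *m J *m Y = 0
              & X ^t* *m J *m Y = (z%:C ^+ rho.-1)%:M],
            right_estimates G1 z k X, mirror_estimates G2 z k Y
          & exists Z, W2 rho 1%N *m Z = e_ rho.-1]].
Proof.
have [G1 [z1 [k1 [lead1 z1_gt0 k1_ge0 half1]]]] := right_half.
have [G2 [z2 [k2 [lead2 z2_gt0 k2_ge0 half2]]]] := mirror_half.
have [c c_ge0 pairing] := pairing_estimate Xi Xic rho_range k1_ge0 k2_ge0.
have [d1 d1_gt0 iso1] := small_sylvester lam0.
(* For [Y] the coefficient of the Sylvester equation is the adjoint of [A], with leading part
   [conj lam]. *)
have [d2 d2_gt0 iso2] : exists2 d : R, 0 < d & forall (z : R) p (Th Z : 'M[C]_p), 0 <= z ->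
    z * nrm Th <= d ->
    ((Num.conj lam)%:M + z%:C *: Th) ^t* *m Z + Z *m ((Num.conj lam)%:M + z%:C *: Th) = 0 ->
    Z = 0.
  by apply: small_sylvester; rewrite conjCK addrC.
pose V := rev_blocks R rho (s rho).
have VV : V *m V = 1%:M := rev_blocksK R rho (s rho).
pose cV := c * nrm V.
have cV_ge0 : 0 <= cV by rewrite mulr_ge0 ?nrm_ge0.
pose t := nrm (Theta rho (- Shat m Xi Xic T rho)) + k1.
have t_ge0 : 0 <= t by rewrite addr_ge0 ?nrm_ge0.
pose kV := nrm V * (2 * cV).
have kV_ge0 : 0 <= kV by rewrite !mulr_ge0 ?nrm_ge0.
pose nK := nrm V + kV.
have nK_ge0 : 0 <= nK by rewrite addr_ge0 ?nrm_ge0.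
pose ge := \sum_(j < m) nrm (G2 j.+1 *m e_ 0).
have ge_ge0 : 0 <= ge by apply: sumr_ge0 => ? _; apply: nrm_ge0.
pose ee := \sum_(a < rho) nrm (e_ a).
have ee_ge0 : 0 <= ee by apply: sumr_ge0 => ? _; apply: nrm_ge0.
(* The last three bounds give [cV * z <= 1 / 2], hence an invertible [M1], and [z * nrm Th] below
   [d1] and [d2] for the isotropy of [X] and [Y]. *)
pose z0 := Num.min (Num.min 1 (Num.min z1 z2))
  (Num.min (2 * (cV + 1))^-1 (Num.min (d1 / (t + 1)) (d2 / (t + 1)))).
pose k := k1 + k2 * nK + ee * kV + ge * kV.
have [p1 p2 p3] : [/\ 0 <= k2 * nK, 0 <= ee * kV & 0 <= ge * kV] by split; apply: mulr_ge0.
have cV1 : 0 < cV + 1 by rewrite ltr_wpDl.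
have t1 : 0 < t + 1 by rewrite ltr_wpDl.
have [k1k k2k eek gek] : [/\ k1 <= k, k2 * nK <= k, ee * kV <= k & k2 * nK + ge * kV <= k].
  exact: le_sum4.
exists G1, G2, z0, k; split=> //.
- by rewrite !lt_min ltr01 z1_gt0 z2_gt0 invr_gt0 mulr_gt0 // !divr_gt0 // !ge_min lexx.
- by rewrite /k !addr_ge0.
move=> z z_gt0; rewrite !le_min => /and3P[/and3P[zle1 zz1 zz2] zcV /andP[zd1 zd2]].
have z_ge0 := ltW z_gt0.
have [X [Th [KX dTh [X1 X2 X3 X4 X5]]]] := half1 z z_gt0 zz1.
have [Y' [B [KY' Y1 Y2 Y3 [Y4 Y5]]]] := half2 z z_gt0 zz2.
have zn0 : z%:C != 0 by rewrite (inj_eq (@complexI R) z 0) gt_eqF.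
have rhoS : rho.-1.+1 = rho by case/andP: rho_range => r0 _; rewrite prednK.
have rho_gt0 : (0 < rho)%N by case/andP: rho_range.
have XY' := pairing z X Y' z_gt0 zle1 X1 Y1 X2 Y2 X4 Y5.
(* The rescaled pairing composed with the flip, so that its limit is the identity. *)
pose M1 := (z%:C ^- rho.-1 *: (X ^t* *m J *m Y')) *m V.
have XY'E : X ^t* *m J *m Y' = z%:C ^+ rho.-1 *: (M1 *m V).
  have -> : M1 *m V = z%:C ^- rho.-1 *: (X ^t* *m J *m Y').
    by rewrite /M1 -[LHS]mulmxA VV mulmx1.
  by rewrite scalerA mulfV ?expf_neq0 // scale1r.
have cabs_z j : cabs (z%:C ^+ j) = z ^+ j by rewrite -rmorphXn cabsR ger0_norm ?exprn_ge0.
have M1_le : nrm (M1 - 1%:M) <= cV * z.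
  have -> : M1 - 1%:M = z%:C ^- rho.-1 *: (X ^t* *m J *m Y' - z%:C ^+ rho.-1 *: V) *m V.
    rewrite scalerBr scalerA mulVf ?expf_neq0 // scale1r mulmxBl.
    by rewrite VV.
  apply: le_trans (nrmM _ _) _; rewrite nrmZ /cV [leRHS]mulrAC ler_wpM2r ?nrm_ge0 //.
  apply: le_trans (ler_wpM2l (cabs_ge0 _) XY') _.
  rewrite -rmorphXn -fmorphV cabsR ger0_norm ?invr_ge0 ?exprn_ge0 //.
  have -> : z ^+ rho = z ^+ rho.-1 * z by rewrite -exprSr rhoS.
  by rewrite mulrCA mulKf // expf_neq0 // gt_eqF.
have cVz : cV * z <= 2^-1.
  apply: le_trans (ler_wpM2l cV_ge0 zcV) _.
  by rewrite invfM mulrCA ler_piMr ?invr_ge0 // ler_pdivrMr // mul1r lerDl.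
have [uM M1V] := unitmx_near1 M1_le cVz.
have Kham : Hamiltonian (H + z%:C ^+ rho *: T).
  by apply: Hamiltonian_perturb => //; exact: conjCRX.
have [KY XY] := dual_normalization Kham KX KY' VV uM
   (expf_neq0 rho.-1 zn0) XY'E.
set Kn := V *m invmx M1 in KY XY; set Y := Y' *m Kn in KY XY.
have dK : nrm (Kn - V) <= kV * z.
  rewrite /Kn -[V in _ - V]mulmx1 -mulmxBr (le_trans (nrmM _ _)) // /kV -mulrA.
  by rewrite ler_wpM2l ?nrm_ge0 // -mulrA.
have K_le : nrm Kn <= nK.
  rewrite -[Kn](subrK V) addrC (le_trans (nrmD _ _)) // lerD2l (le_trans dK) //.
  by rewrite ler_piMr.
have Th_le : nrm Th <= t.
  rewrite -[Th](subrK (Theta rho (- Shat m Xi Xic T rho))) addrC (le_trans (nrmD _ _)) //.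
  by rewrite lerD2l (le_trans dTh) // ler_piMr.
have zTh d : 0 < d -> z <= d / (t + 1) -> z * nrm Th <= d.
  move=> d_gt0; rewrite ler_pdivlMr // => zt; apply: le_trans zt.
  by rewrite ler_wpM2l // (le_trans Th_le) // lerDl.
exists X, Y, Th; split.
- by split=> //; apply: le_trans dTh _; rewrite ler_wpM2r.
- split=> //.
    by apply: (iso1 z _ Th) => //; [exact: zTh | exact: isotropic Kham KX].
  apply: (iso2 z _ (Th ^t*)) => //; first by rewrite nrm_adj; exact: zTh.
  have := isotropic Kham KY; rewrite adjmxN mulNmx mulmxN -opprD => /eqP.
  by rewrite oppr_eq0 !adjmxD !adjmx_scalar !adjmxZ !conjCR !trmxCK !conjCK => /eqP.
- split=> // [j i B0|j jr||].
  + by apply: le_trans (X2 _ _ B0) _; rewrite ler_wpM2r ?exprn_ge0.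
  + by apply: le_trans (X3 _ jr) _; rewrite ler_wpM2r.
  + by apply: le_trans X4 _; rewrite ler_wpM2r ?exprn_ge0.
  + exact: le_trans X5 _.
- split=> [a ha|j i B0|j jr||].
  + rewrite /Y mulmxA Y1 // -scalemxAl -(eblk_rev R (s rho) ha) -scalerBr -mulmxBr nrmZ cabs_z.
    apply: (@le_trans _ _ (z ^+ a * (ee * (kV * z)))).
      rewrite ler_wpM2l ?exprn_ge0 // (le_trans (nrmM _ _)) // ler_pM ?nrm_ge0 //.
      by rewrite /ee [leRHS](bigD1 (Ordinal ha)) //= lerDl sumr_ge0 // => ? _; apply: nrm_ge0.
    have -> : z ^+ a * (ee * (kV * z)) = ee * kV * z ^+ a.+1 by rewrite exprSr; ring.
    by rewrite ler_wpM2r ?exprn_ge0.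
  + rewrite /Y mulmxA (le_trans (nrmM _ _)) //.
    apply: (@le_trans _ _ (k2 * z ^+ jexp rho j i * nK)); first by rewrite ler_pM ?nrm_ge0 ?Y2.
    by rewrite mulrAC ler_wpM2r ?exprn_ge0.
  + rewrite (_ : _ - _ = (W2 j 1%N *m Y' - G2 j *m e_ 0) *m Kn + G2 j *m e_ 0 *m (Kn - V)).
      apply: (@le_trans _ _ ((k2 * nK + ge * kV) * z)); last by rewrite ler_wpM2r.
      rewrite mulrDl (le_trans (nrmD _ _)) // lerD // (le_trans (nrmM _ _)) //.
        by rewrite mulrAC ler_pM ?nrm_ge0 ?Y3.
      rewrite -mulrA ler_pM ?nrm_ge0 //.
      case: j jr => // j /andP[_ jm]; rewrite /ge [leRHS](bigD1 (Ordinal jm)) //= lerDl.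
      by rewrite sumr_ge0 // => ? _; apply: nrm_ge0.
    rewrite mulmxBl mulmxBr addrA subrK /Y mulmxA -(mulmxA (G2 j)) eblk_rev //.
    by rewrite subn1.
  + rewrite /Y mulmxA (le_trans (nrmM _ _)) //.
    apply: (@le_trans _ _ (k2 * z ^+ rho * nK)); first by rewrite ler_pM ?nrm_ge0.
    by rewrite mulrAC ler_wpM2r ?exprn_ge0.
  + by rewrite /Y (le_trans (nrmM _ _)) // (le_trans _ k2k) // ler_pM ?nrm_ge0.
(* [V] permutes block columns only, so the exact normalization of [Y'] is inherited. *)
exists (Y' *m V).
by rewrite mulmxA Y1 // expr0 scale1r eblk_rev // subn1.
Qed.

End Main.
End StructuredPair.

(** * Perturbation of the invariant subspace of Theta *)

Section SpectralSeparation.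
Variable R : realType.
Local Notation C := R[i].

(** The sizes are equated by a hypothesis, since in the application they are [q] and [l + r]. *)
Lemma char_poly_similar a b (A : 'M[C]_a) (B : 'M[C]_b) (U : 'M[C]_(a, b)) (V : 'M[C]_(b, a)) :
  a = b -> U *m V = 1%:M -> A *m U = U *m B -> char_poly A = char_poly B.
Proof.
move=> ab; case: _ / ab B U V => B U V UV AU.
have -> : A = U *m B *m V by rewrite -AU -mulmxA UV mulmx1.
rewrite /char_poly /char_poly_mx.
have pUV : map_mx polyC U *m map_mx polyC V = 1%:M :> 'M[{poly C}]_a.
  by rewrite -map_mxM UV map_mx1.
have -> : 'X%:M - map_mx polyC (U *m B *m V) =
    map_mx polyC U *m ('X%:M - map_mx polyC B) *m map_mx polyC V.
  by rewrite mulmxBr mulmxBl !map_mxM mul_mx_scalar -scalemxAl pUV scalemx1.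
rewrite !det_mulmx mulrAC -det_mulmx pUV det1 mul1r.
by [].
Qed.

Lemma char_poly_block_diag a b (A : 'M[C]_a) (B : 'M[C]_b) :
  char_poly (block_mx A 0 0 B) = char_poly A * char_poly B.
Proof.
rewrite /char_poly /char_poly_mx map_block_mx !map_mx0.
by rewrite (scalar_mx_block a b) opp_block_mx add_block_mx !oppr0 !addr0 det_ublock.
Qed.

Lemma char_polyE a (A : 'M[C]_a) :
  char_poly A = \prod_(z <- sval (closed_field_poly_normal (char_poly A))) ('X - z%:P).
Proof.
case: closed_field_poly_normal => rs /= {1}->.
by rewrite (monicP (char_poly_monic A)) scale1r.
Qed.

Lemma root_spectrum a (A : 'M[C]_a) z :
  (z \in sval (closed_field_poly_normal (char_poly A))) = root (char_poly A) z.
Proof. by rewrite [in RHS]char_polyE root_prod_XsubC. Qed.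

Lemma char_poly_tr a (A : 'M[C]_a) : char_poly A^T = char_poly A.
Proof. by rewrite /char_poly -det_tr /char_poly_mx linearB /= tr_scalar_mx -map_trmx trmxK. Qed.

(** Cayley-Hamilton: with [chi] the characteristic polynomial of [A], [P chi(B) = chi(A) P = 0], and
    [chi(B)] is invertible because no root of [chi] is an eigenvalue of [B]. *)
Lemma sylvester_disjoint a b (A : 'M[C]_a) (B : 'M[C]_b) (P : 'M[C]_(a, b)) :
  (forall z, root (char_poly A) z -> root (char_poly B) z -> False) ->
  A *m P = P *m B -> P = 0.
Proof.
case: a A P => [|a] A P; first by rewrite [P]flatmx0.
case: b B P => [|b] B P sep; first by rewrite [P]thinmx0.
move=> APB; set rs := sval (closed_field_poly_normal (char_poly A)).
have swap (r : seq C) : (\prod_(z <- r) (A - z%:M)) *m P = P *m \prod_(z <- r) (B - z%:M).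
  elim: r => [|z r IHr]; first by rewrite !big_nil mul1mx mulmx1.
  rewrite !big_cons -!mulmxE -mulmxA IHr !mulmxA; congr (_ *m _).
  by rewrite mulmxBl mulmxBr APB mul_mx_scalar mul_scalar_mx.
have A0 : \prod_(z <- rs) (A - z%:M) = 0.
  have := Cayley_Hamilton A; rewrite char_polyE -/rs rmorph_prod /=.
  by under eq_bigr do rewrite rmorphB /= horner_mx_X horner_mx_C.
have uB : \prod_(z <- rs) (B - z%:M) \in unitmx.
  rewrite big_seq; elim/big_ind: _ => [|x y ux uy|z zr]; first exact: unitmx1.
    by rewrite -mulmxE unitmx_mul ux.
  have : ~~ eigenvalue B z.
    by rewrite eigenvalue_root_char; apply/negP; apply: sep; rewrite -root_spectrum.
  by rewrite /eigenvalue negbK kermx_eq0 row_free_unit.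
by rewrite -[P](mulmxK uB) -swap A0 !mul0mx.
Qed.

(** The columns of [K] form a basis of the kernel of [W]; [1 - F W] is the projector onto it along
    the range of [F], hence factors as [K G]. *)
Lemma left_complement (q l : nat) (F : 'M[C]_(q, l)) (W : 'M[C]_(l, q)) : W *m F = 1%:M ->
  exists r (K : 'M[C]_(q, r)) (G : 'M[C]_(r, q)),
    [/\ q = (l + r)%N, W *m K = 0, G *m F = 0, G *m K = 1%:M & F *m W + K *m G = 1%:M].
Proof.
move=> WF; pose B := row_base (kermx W^T); pose K := B^T.
have BW : B *m W^T = 0 by apply/sub_kermxP; rewrite eq_row_base.
have WK : W *m K = 0 by apply: trmx_inj; rewrite trmx_mul trmxK BW trmx0.
have KB : (pinvmx B)^T *m K = 1%:M by rewrite -trmx_mul mulmxVp ?row_base_free // trmx1.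
have PF : (1%:M - F *m W) *m F = 0 by rewrite mulmxBl mul1mx -mulmxA WF mulmx1 subrr.
have PK : (1%:M - F *m W) *m K = K by rewrite mulmxBl mul1mx -mulmxA WK mulmx0 subr0.
have WP : W *m (1%:M - F *m W) = 0 by rewrite mulmxBr mulmx1 mulmxA WF mul1mx subrr.
have [D PD] : exists D, 1%:M - F *m W = K *m D.
  have : ((1%:M - F *m W)^T <= B)%MS.
    by rewrite eq_row_base; apply/sub_kermxP; rewrite -trmx_mul WP trmx0.
  by case/submxP => D e; exists D^T; rewrite -[LHS]trmxK e trmx_mul.
exists (\rank (kermx W^T)), K, ((pinvmx B)^T *m (1%:M - F *m W)); split=> //.
- rewrite mxrank_ker mxrank_tr.
  have rW : \rank W = l.
    by apply/eqP; rewrite -[_ == _]/(row_free W); apply/row_freeP; exists F.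
  by rewrite rW subnKC // -{1}rW rank_leq_col.
- by rewrite -mulmxA PF mulmx0.
- by rewrite -mulmxA PK KB.
by rewrite mulmxA {1}PD !mulmxA -[K *m _ *m K]mulmxA KB mulmx1 -PD addrC subrK.
Qed.

(** In the decomposition by [F] and [K], [Th] becomes [diag(Om, Om2)]. Removing the multiset of [Om]
    leaves the spectrum of [Om2], so the hypothesis says that [Om] and [Om2] have no common
    eigenvalue, and [sylvester_disjoint] kills the [K] component of [Y]. *)
Lemma spectral_separation (q l : nat) (Th : 'M[C]_q) (F : 'M[C]_(q, l)) (W : 'M[C]_(l, q))
    (Om : 'M[C]_l) :
  W *m F = 1%:M -> Th *m F = F *m Om -> W *m Th = Om *m W ->
  (spectrum Om `&` (spectrum Th `\` spectrum Om))%mset = mset0 ->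
  forall Y : 'M[C]_(q, l), Th *m Y = Y *m Om -> W *m Y = 0 -> Y = 0.
Proof.
move=> WF ThF WTh sep Y ThY WY.
have [r [K [G [qE WK GF GK FWKG]]]] := left_complement WF.
pose Om2 := G *m Th *m K.
have ThK : Th *m K = K *m Om2.
  rewrite /Om2 -{1}[Th]mul1mx -FWKG mulmxDl -(mulmxA F) WTh mulmxDl -!mulmxA WK.
  by rewrite !mulmx0 add0r.
have chi : char_poly Th = char_poly Om * char_poly Om2.
  rewrite -char_poly_block_diag.
  apply: (char_poly_similar (U := row_mx F K) (V := col_mx W G) qE); first by rewrite mul_row_col.
  by rewrite mul_mx_row mul_row_block !mulmx0 addr0 add0r ThF ThK.
have GY : G *m Y = 0.
  apply: (sylvester_disjoint (A := Om2) (B := Om)); last first.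
    rewrite -mulmxA -ThY -!mulmxA; congr (G *m (Th *m _)).
    by rewrite -[RHS]mul1mx -FWKG mulmxDl -mulmxA WY mulmx0 add0r mulmxA.
  move=> z; rewrite -!root_spectrum => z2 z1.
  have perm : perm_eq (sval (closed_field_poly_normal (char_poly Th)))
      (sval (closed_field_poly_normal (char_poly Om))
       ++ sval (closed_field_poly_normal (char_poly Om2))).
    by apply: prod_XsubC_eq; rewrite big_cat /= -!char_polyE chi.
  have := congr1 (fun A : {mset C}%mset => A z) sep; rewrite /spectrum !msetE2 !mset_seqE.
  rewrite (permP perm) count_cat addKn mset0E => min0.
  have : (0 < minn (count_mem z (sval (closed_field_poly_normal (char_poly Om))))
    (count_mem z (sval (closed_field_poly_normal (char_poly Om2)))))%N.
    by rewrite leq_min -!has_count !has_pred1 z1 z2.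
  by rewrite min0.
by rewrite -[Y]mul1mx -FWKG mulmxDl -!mulmxA WY GY !mulmx0 addr0.
Qed.

(** The perturbation lemma with [E = 1], for the right and for the left subspace. The two solutions
    come with separate small matrices and a Gram matrix [N] near [1]; multiplying the left one by
    the inverse of [N] gives biorthogonality and with it a common [tOm]. *)
Lemma omega_perturbation (q l : nat) (Th0 : 'M[C]_q) (F Fc : 'M[C]_(q, l)) (Om : 'M[C]_l) :
  Th0 *m F = F *m Om -> Th0 ^t* *m Fc = Fc *m Om ^t* -> F ^t* *m Fc = 1%:M ->
  (spectrum Om `&` (spectrum Th0 `\` spectrum Om))%mset = mset0 ->
  exists e0 k : R, [/\ 0 < e0, 0 <= k & forall (e : R) (Th : 'M[C]_q),
    e <= e0 -> nrm (Th - Th0) <= e ->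
    exists (tF tFc : 'M[C]_(q, l)) (tOm : 'M[C]_l),
      [/\ Th *m tF = tF *m tOm, Th ^t* *m tFc = tFc *m tOm ^t*, tF ^t* *m tFc = 1%:M,
          nrm (tF - F) <= k * e
        & nrm (tFc - Fc) <= k * e /\ nrm (tOm - Om) <= k * e]].
Proof.
move=> ThF ThFc FFc sep.
have inj (A : 'M[C]_q) (G : 'M[C]_(q, l)) (W : 'M[C]_(l, q)) (B : 'M[C]_l) :
    W *m G = 1%:M -> A *m G = G *m B -> W *m A = B *m W ->
    (spectrum B `&` (spectrum A `\` spectrum B))%mset = mset0 ->
    bordered_injective A 1%:M (1%:M *m G) B W.
  move=> WG AG WA sepA Y M; rewrite !mul1mx => eqY WY.
  (* Multiplication by [W] cancels the Sylvester terms and leaves [- M = 0]. *)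
  have M0 : M = 0.
    have := congr1 (mulmx W) eqY; rewrite !mulmxBr !mulmxA WA -(mulmxA B) WY WG mul1mx.
    by rewrite !mulmx0 mul0mx subr0 sub0r => /eqP; rewrite oppr_eq0 => /eqP.
  split=> //; apply: (spectral_separation WG AG WA sepA) => //.
  by apply/eqP; rewrite -subr_eq0; move: eqY; rewrite M0 mulmx0 subr0 => ->.
have FcF : Fc ^t* *m F = 1%:M.
  by rewrite -[F]trmxCK -adjmxM FFc adjmx_scalar rmorph1.
have FcTh : Fc ^t* *m Th0 = Om *m Fc ^t*.
  by have := congr1 (fun A => A ^t*) ThFc; rewrite !adjmxM !trmxCK.
(* The left problem is the right one for the transposes. *)
pose G := map_mx Num.conj Fc.
have adjE a b (A : 'M[C]_(a, b)) : (map_mx Num.conj A)^T = A ^t* by rewrite map_trmx.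
have GT : G^T = Fc ^t* by rewrite adjE.
have FG : F^T *m G = 1%:M.
  by apply: trmx_inj; rewrite trmx_mul trmxK GT FcF trmx1.
have ThG : Th0^T *m G = G *m Om^T.
  by apply: trmx_inj; rewrite !trmx_mul !trmxK GT FcTh.
have FTh : F^T *m Th0^T = Om^T *m F^T by rewrite -!trmx_mul ThF.
(* Transposition, unlike the adjoint, leaves the characteristic polynomial unchanged. *)
have sepT : (spectrum Om^T `&` (spectrum Th0^T `\` spectrum Om^T))%mset = mset0.
  by rewrite /spectrum !char_poly_tr.
have eqR : Th0 *m F = 1%:M *m F *m Om by rewrite mul1mx.
have eqL : Th0^T *m G = 1%:M *m G *m Om^T by rewrite mul1mx.
have [e1 [k1 [e1_gt0 k1_ge0 pert1]]] := deflating_perturbation eqR FcF (inj _ _ _ _ FcF ThF FcTh sep).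
have [e2 [k2 [e2_gt0 k2_ge0 pert2]]] := deflating_perturbation eqL FG (inj _ _ _ _ FG ThG FTh sepT).
pose f := nrm F; pose g := nrm Fc.
have [f_ge0 g_ge0] : 0 <= f /\ 0 <= g by split; apply: nrm_ge0.
pose kn := k1 * (g + k2) + f * k2.
have kn_ge0 : 0 <= kn by rewrite !(addr_ge0, mulr_ge0).
pose k := k1 + (k2 + (g + k2) * (2 * kn)).
have t1 : 0 <= (g + k2) * (2 * kn) by rewrite !(addr_ge0, mulr_ge0).
exists (Num.min (Num.min 1 (2 * (kn + 1))^-1) (Num.min e1 e2)), k; split.
- by rewrite !lt_min ltr01 e1_gt0 e2_gt0 invr_gt0 mulr_gt0 // ltr_wpDl.
- by rewrite /k !addr_ge0.
move=> e Th; rewrite !le_min => /andP[/andP[e_le1 ekn] /andP[ee1 ee2]] dTh.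
have e_ge0 : 0 <= e by apply: le_trans dTh; apply: nrm_ge0.
have [] := pert1 e Th 1%:M ee1 dTh; first by rewrite subrr nrm0.
move=> tF [tOm [+ _ dF dOm]]; rewrite mul1mx => ThtF.
have [] := pert2 e Th^T 1%:M ee2; [by rewrite -linearB nrm_tr | by rewrite subrr nrm0 |].
move=> tG [tOm' [+ _ dG _]]; rewrite mul1mx => ThtG.
pose tFc0 := map_mx Num.conj tG; pose N := tF ^t* *m tFc0.
have dFc0 : nrm (tFc0 - Fc) <= k2 * e.
  have -> : tFc0 - Fc = map_mx Num.conj (tG - G).
    rewrite map_mxB (_ : map_mx Num.conj G = Fc) //.
    by apply/matrixP => i j; rewrite /G mxE [X in Num.conj X]mxE conjCK.
  by rewrite nrm_conj.
have tFc0_le : nrm tFc0 <= g + k2.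
  rewrite -[tFc0](subrK Fc) addrC (le_trans (nrmD _ _)) // lerD2l (le_trans dFc0) //.
  by rewrite ler_piMr.
have dN : nrm (N - 1%:M) <= kn * e.
  have -> : N - 1%:M = (tF - F) ^t* *m tFc0 + F ^t* *m (tFc0 - Fc).
    by rewrite adjmxB mulmxBl mulmxBr FFc addrA subrK.
  rewrite mulrDl (le_trans (nrmD _ _)) // lerD // (le_trans (nrmM _ _)) // nrm_adj.
    by rewrite mulrAC ler_pM ?nrm_ge0.
  by rewrite -mulrA ler_wpM2l.
have kne : kn * e <= 2^-1.
  apply: le_trans (ler_wpM2l kn_ge0 ekn) _.
  by rewrite invfM mulrCA ler_piMr ?invr_ge0 // ler_pdivrMr ?ltr_wpDl // mul1r lerDl.
have [uN dN'] := unitmx_near1 dN kne.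
have ThtFc0 : Th ^t* *m tFc0 = tFc0 *m map_mx Num.conj tOm'.
  by rewrite -!map_mxM ThtG.
have NOm : N *m map_mx Num.conj tOm' = tOm ^t* *m N.
  by rewrite /N -mulmxA -ThtFc0 !mulmxA -!adjmxM ThtF.
have NE : tF ^t* *m tFc0 = N by [].
clearbody N.
have ON : map_mx Num.conj tOm' *m invmx N = invmx N *m tOm ^t*.
  by apply: (can_inj (mulKmx uN)); rewrite mulKVmx // mulmxA NOm mulmxK.
exists tF, (tFc0 *m invmx N), tOm; split; first exact: ThtF.
- by rewrite mulmxA ThtFc0 -mulmxA ON mulmxA.
- by rewrite mulmxA NE mulmxV.
- by apply: le_trans dF _; rewrite ler_wpM2r // /k lerDl addr_ge0.
split; last by apply: le_trans dOm _; rewrite ler_wpM2r // /k lerDl addr_ge0.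
have -> : tFc0 *m invmx N - Fc = (tFc0 - Fc) + tFc0 *m (invmx N - 1%:M).
  by rewrite mulmxBr mulmx1 [RHS]addrC addrA subrK.
apply: (@le_trans _ _ ((k2 + (g + k2) * (2 * kn)) * e)); last first.
  by rewrite ler_wpM2r // /k lerDr.
rewrite mulrDl (le_trans (nrmD _ _)) // lerD // (le_trans (nrmM _ _)) //.
by rewrite -!mulrA ler_pM ?nrm_ge0 // mulrA.
Qed.

End SpectralSeparation.

(** * Asymptotic expansions *)

Section Orders.
Variables (R : realType) (rho : nat).
Hypothesis rho_gt0 : (0 < rho)%N.
Local Notation C := R[i].

Definition zroot (t : R) : R := t `^ (1 / rho%:R).

Lemma zroot_gt0 t : 0 < t -> 0 < zroot t.
Proof. exact: powR_gt0. Qed.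

Lemma zroot_expn t j : 0 < t -> zroot t ^+ j = t `^ (j%:R / rho%:R).
Proof.
by move=> t0; rewrite /zroot -powR_mulrn ?powR_ge0 // -powRrM mulrC mulrA mulr1.
Qed.

Lemma zroot_rho t : 0 < t -> zroot t ^+ rho = t.
Proof. by move=> t0; rewrite zroot_expn // divff ?powRr1 ?ltW // pnatr_eq0 -lt0n. Qed.

Lemma zroot_le (z0 t : R) : 0 < z0 -> 0 < t -> t < z0 ^+ rho -> zroot t <= z0.
Proof.
move=> z0_gt0 t0 tz; rewrite leNgt; apply/negP => zt.
have := ltrXn2r rho (ltW z0_gt0) zt; rewrite -lt0n rho_gt0 zroot_rho //.
by move=> /(lt_trans tz); rewrite ltxx.
Qed.

Lemma tpow_zroot t j : 0 < t -> tpow t (j%:R / rho%:R) = (zroot t)%:C ^+ j.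
Proof. by move=> t0; rewrite /tpow -zroot_expn // rmorphXn. Qed.

Lemma tpow_zroot1 t : tpow t (1 / rho%:R) = (zroot t)%:C.
Proof. by []. Qed.

Lemma tpow_zroot_pred t : 0 < t -> tpow t (1 - 1 / rho%:R) = (zroot t)%:C ^+ rho.-1.
Proof.
move=> t0; rewrite -tpow_zroot //; congr tpow.
have r0 : rho%:R != 0 :> R by rewrite pnatr_eq0 -lt0n.
rewrite -{1}(divff r0) -mulrBl; congr (_ / _).
by rewrite -[in LHS](prednK rho_gt0) -natr1 addrK.
Qed.

Lemma near_right (P : R -> Prop) (t0 : R) : 0 < t0 ->
  (forall t, 0 < t -> t < t0 -> P t) -> \forall t \near 0^'+, P t.
Proof.
move=> t0_gt0 Pt; near=> t; apply: Pt; near: t; first exact: nbhs_right_gt.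
exact: nbhs_right_lt.
Unshelve. all: by end_near. Qed.

Lemma bigO_zroot a b (M : R -> 'M[C]_(a, b)) (c t0 : R) j : 0 < t0 ->
  (forall t, 0 < t -> t < t0 -> nrm (M t) <= c * zroot t ^+ j) -> bigO M (j%:R / rho%:R).
Proof.
move=> t0_gt0 M_le; exists c; apply: (near_right t0_gt0) => t t_gt0 tt0 i j'.
rewrite tpow_zroot // norm_cabs -rmorphXn -rmorphM lecR.
exact: le_trans (nrm_entry _ _ _) (M_le t t_gt0 tt0).
Qed.

Lemma bigO_zroot_rho a b (M : R -> 'M[C]_(a, b)) (c t0 : R) : 0 < t0 ->
  (forall t, 0 < t -> t < t0 -> nrm (M t) <= c * zroot t ^+ rho) -> bigO M 1.
Proof.
by move=> t0_gt0 /(bigO_zroot t0_gt0); rewrite divff // pnatr_eq0 -lt0n.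
Qed.

(** The excluded blocks, the first ones of chains longer than [rho], have [jexp = 0]; there [delta]
    measures what is left after subtraction of the leading term. *)
Lemma delta_jexp k i : (i < k)%N -> k != rho -> (rho < k)%N ==> (0 < i)%N ->
  delta R rho k i = (jexp rho k i.+1)%:R / rho%:R.
Proof.
have r0 : rho%:R != 0 :> R by rewrite pnatr_eq0 -lt0n.
move=> ik kr; rewrite /delta /jexp /= (negbTE kr).
have [kr'|kr'|kr'] := ltngtP k rho; last by rewrite kr' eqxx in kr.
  move=> _; rewrite -{1}(divff r0) -mulrBl -natrB; last by lia.
  by congr (_%:R / _); lia.
by case: i ik.
Qed.

Lemma delta_first k : (rho < k)%N -> delta R rho k 0 = 1%:R / rho%:R.
Proof. by move=> rk; rewrite /delta /= ltnNge ltnW //= gtn_eqF. Qed.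

Lemma delta_rho i : delta R rho rho i = i.+1%:R / rho%:R.
Proof. by rewrite /delta ltnn eqxx. Qed.

End Orders.

Section Residual.
Variables (K : fieldType) (r m : nat) (s : nat -> nat).
Variables (Xi : forall j i : nat, 'M[K]_(r, s j)) (W : forall j i : nat, 'M[K]_(s j, r)).
Variables (rho l : nat) (G : forall j : nat, 'M[K]_(s j, s rho)) (e : 'M[K]_(s rho, l)).
Variables (Z X : 'M[K]_(r, l)).
Hypothesis rho_range : (1 <= rho <= m)%N.

(* Coordinates of [X] minus those of [lead *m e]; at [k = rho] the latter is
   [e], written [W k 1 *m Z] so that its type depends on [k]. *)
Definition residual (k i : nat) : 'M[K]_(s k, l) :=
  if i == 1%N then
    if (rho < k)%N then W k 1%N *m X - G k *m e
    else if k == rho then W k 1%N *m X - W k 1%N *m Z else W k 1%N *m X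
  else W k i *m X.

Lemma residual_coord k i : k <> rho -> ~~ ((rho < k)%N && (i == 1%N)) ->
  residual k i = W k i *m X.
Proof.
move=> /eqP/negbTE kr; rewrite /residual kr; case: (i =P 1%N) => [->|//].
by rewrite andbT => /negbTE ->.
Qed.

Lemma residual_sum : W rho 1%N *m Z = e ->
  X - (lead m Xi G *m e + frame_sum m Xi residual) = frame_compl m Xi W *m X.
Proof.
move=> WZ; rewrite frame_compl_mul; congr (_ - _).
apply/eqP; rewrite eq_sym -subr_eq frame_sumB; apply/eqP/esym.
have rm : (rho.-1 < m)%N by case/andP: rho_range => r0; rewrite prednK.
have rhoS : rho.-1.+1 = rho by case/andP: rho_range => r0 _; rewrite prednK.
transitivity (\sum_(k < m) Xi k.+1 1%N *m (if (rho < k.+1)%N then G k.+1 *m e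
    else if k.+1 == rho then W k.+1 1%N *m Z else 0)).
  rewrite (bigD1 (Ordinal rm)) //= rhoS ltnn eqxx WZ /lead mulmxDl; congr (_ + _).
  rewrite tail_sum_mul /tail_sum big_mkcond [RHS]big_mkcond; apply: eq_bigr => k _.
  have -> : (k != Ordinal rm) = (k.+1 != rho) by rewrite -val_eqE /= -eqSS rhoS.
  rewrite ltnS; have [kr|kr] := eqVneq k.+1 rho; first by rewrite (_ : (rho <= k)%N = false) //; lia.
  by case: ifP => // _; rewrite mulmx0.
apply: eq_bigr => k _; rewrite big_ord_recl big1 ?addr0 => [|i _]; last first.
  by rewrite /residual /= subrr mulmx0.
congr (_ *m _); rewrite /residual /=; case: ifP => _; first by rewrite opprB addrC subrK.
by case: ifP => _; rewrite ?opprB ?subrr // addrC subrK.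
Qed.

End Residual.

Section GroupSums.
Variables (K : fieldType) (r m : nat) (s : nat -> nat) (l : nat).
Variables (Xi : forall j i : nat, 'M[K]_(r, s j)) (y : forall j i : nat, 'M[K]_(s j, l)).

Lemma grp_sum : \sum_(k < m) grp Xi k.+1 *m (\mxcol_(a < k.+1) y k.+1 a.+1)
  = frame_sum m Xi y.
Proof. by apply: eq_bigr => k _; rewrite /grp mul_mxrow_mxcol. Qed.

Lemma grp_sum_rev : \sum_(k < m) grp Xi k.+1 *m (\mxcol_(a < k.+1) y k.+1 (k.+1 - a)%N)
  = frame_sum m (fun j i => Xi j (j.+1 - i)%N) y.
Proof.
apply: eq_bigr => k _; rewrite /grp mul_mxrow_mxcol (reindex_inj rev_ord_inj) /=.
apply: eq_bigr => a _; have ak := ltn_ord a.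
rewrite (_ : (k.+1 - a.+1).+1 = k.+2 - a.+1)%N; last by lia.
by rewrite (_ : (k.+1 - (k.+1 - a.+1))%N = a.+1) //; lia.
Qed.

End GroupSums.

(** * Coordinate expansions of a basis times a factor *)

Section Expansions.
Variables (R : realType) (n m : nat) (s : nat -> nat).
Local Notation C := R[i].
Variables (Xi Xic : forall j i : nat, 'M[C]_(n + n, s j)) (rho l : nat).
Hypothesis rho_range : (1 <= rho <= m)%N.
Local Notation W1 := (right_dual Xic).
Local Notation W2 := (mirror_dual Xi).
Local Notation Xi2 := (mirror Xic).
Local Notation q := (\sum_(i < rho) s rho)%N.
Local Notation e_ a := (eblk C rho (s rho) a).
Variables (G : forall j, 'M[C]_(s j, s rho)) (k kF t0 : R).
Variables (tX : R -> 'M[C]_(n + n, q)) (tF : R -> 'M[C]_(q, l)) (F : 'M[C]_(q, l)).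
Hypothesis kF_ge0 : 0 <= kF.
Hypothesis t0_gt0 : 0 < t0.
Hypothesis z_le1 : forall t : R, 0 < t -> t < t0 -> zroot rho t <= 1.
Hypothesis dF : forall t : R, 0 < t -> t < t0 -> nrm (tF t - F) <= kF * zroot rho t.

Lemma rho_pos : (0 < rho)%N. Proof. by case/andP: rho_range. Qed.

Lemma factor_le t : 0 < t -> t < t0 -> nrm (tF t) <= nrm F + kF.
Proof.
move=> t_gt0 tt0; rewrite -[tF t](subrK F) addrC (le_trans (nrmD _ _)) // lerD2l.
apply: le_trans (dF t_gt0 tt0) _; rewrite ler_piMr ?z_le1 //.
Qed.

Lemma factor_le_ge0 : 0 <= nrm F + kF.
Proof. by rewrite addr_ge0 ?nrm_ge0. Qed.

Lemma product_le a (A : 'M[C]_(a, q)) t c : 0 < t -> t < t0 -> nrm A <= c ->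
  nrm (A *m tF t) <= c * (nrm F + kF).
Proof.
by move=> t_gt0 tt0 Ac; rewrite (le_trans (nrmM _ _)) // ler_pM ?nrm_ge0 ?factor_le.
Qed.

Lemma product_shift_le a (A B : 'M[C]_(a, q)) t c j : 0 < t -> t < t0 ->
  nrm (A - B) <= c * zroot rho t ^+ j.+1 -> 
  nrm (A *m tF t - B *m F) <= (c * (nrm F + kF)) * zroot rho t ^+ j.+1
     + nrm B * kF * zroot rho t.
Proof.
move=> t_gt0 tt0 AB.
rewrite (_ : _ - _ = (A - B) *m tF t + B *m (tF t - F)); last first.
  by rewrite mulmxBl mulmxBr addrA subrK.
rewrite (le_trans (nrmD _ _)) // lerD //.
  by apply: le_trans (product_le t_gt0 tt0 AB) _; rewrite mulrAC.
by rewrite (le_trans (nrmM _ _)) // -mulrA ler_wpM2l ?nrm_ge0 ?dF.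
Qed.

(** Serves twice: with factor [1] for the structured basis, with [tF] for [L]. The rows at [rho] are
    given by an equality because [perturbed_structured_basis] requires one there. *)
Lemma right_expansion :
  (forall t : R, 0 < t -> t < t0 -> right_estimates m Xi Xic G (zroot rho t) k (tX t)) ->
  exists Lk : forall j : nat, R -> 'M[C]_(\sum_(i < j) s j, l),
  [/\ bigO (fun t => tX t *m tF t - (lead m Xi G *m (e_ 0 *m F)
        + \sum_(j < m) grp Xi j.+1 *m Lk j.+1 t)) 1,
      forall j, (1 <= j <= m)%N -> j <> rho -> bigO_rows (Lk j) (delta R rho j)
    & forall t : R, 0 < t -> t < t0 -> forall a, (a < rho)%N -> e_ a *m Lk rho t =
        if a == 0%N then e_ 0 *m (tF t - F) else (zroot rho t)%:C ^+ a *: (e_ a *m tF t)].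
Proof.
move=> est; pose y t := residual W1 G (e_ 0 *m F) (tX t *m F) (tX t *m tF t).
pose Lk j t : 'M[C]_(\sum_(i < j) s j, l) := \mxcol_(a < j) y t j a.+1.
have nF_ge0 := factor_le_ge0.
exists Lk; split=> [|j jm jrho a|t t_gt0 tt0 a ha].
- apply: (bigO_zroot_rho rho_pos t0_gt0 (c := k * (nrm F + kF))) => t t_gt0 tt0.
  have [X1 _ _ X4 _] := est t t_gt0 tt0.
  rewrite grp_sum residual_sum //.
    rewrite mulmxA; apply: le_trans (product_le t_gt0 tt0 X4) _.
    by rewrite mulrAC.
  by rewrite mulmxA (X1 0%N rho_pos) expr0 scale1r.
- have aj := ltn_ord a; have B : is_block m j a.+1.
    by case/andP: jm => _ jm; rewrite /is_block /= jm andbT.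
  have rowE t : submxcol (Lk j t) a = y t j a.+1 by rewrite mxcolK.
  have [/andP[rj /eqP a0]|] := boolP ((rho < j)%N && (nat_of_ord a == 0%N)).
    rewrite a0 delta_first //.
    apply: (bigO_zroot (j := 1) t0_gt0 (c := k * (nrm F + kF) + nrm (G j *m e_ 0) * kF)).
    move=> t t_gt0 tt0; have [_ _ X3 _ _] := est t t_gt0 tt0.
    have rjm : (rho < j <= m)%N by rewrite rj; case/andP: jm.
    have := X3 j rjm; rewrite -[zroot rho t]expr1 => /(product_shift_le t_gt0 tt0).
    rewrite !expr1 -mulrDl; apply: le_trans.
    by rewrite rowE /y /residual a0 eqxx rj !mulmxA.
  move=> na0; rewrite (delta_jexp R rho_pos aj); last first.
  + by rewrite negb_and in na0; rewrite implybE lt0n.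
  + exact/eqP.
  apply: (bigO_zroot t0_gt0 (c := k * (nrm F + kF))) => t t_gt0 tt0.
  have [_ X2 _ _ _] := est t t_gt0 tt0.
  have -> : submxcol (Lk j t) a = W1 j a.+1 *m (tX t *m tF t).
    by rewrite rowE; apply: residual_coord.
  rewrite mulmxA; apply: le_trans (product_le t_gt0 tt0 (X2 _ _ B)) _.
  by rewrite mulrAC.
have [X1 _ _ _ _] := est t t_gt0 tt0.
rewrite (eblk_mxcol ha) /y /residual /= eqSS; case: eqP => [a0|_].
  by rewrite ltnn eqxx !mulmxA (X1 0%N rho_pos) expr0 scale1r mulmxBr.
by rewrite mulmxA (X1 a ha) -scalemxAl.
Qed.

(** Block [a] of a chain of [Xic], counted from [0], is mirror coordinate [k - a], which turns
    [delta] into [deltac]. [D] is the target at [rho], abstract to cover [Xdiagc] and [Krylovc0];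
    [Z] supplies the leading coordinate subtracted there. *)
Lemma mirror_expansion (D : R -> 'M[C]_(q, l)) :
  (forall t : R, 0 < t -> t < t0 -> mirror_estimates m Xi Xic G (zroot rho t) k (tX t)) ->
  (exists Z : 'M[C]_(n + n, q), W2 rho 1%N *m Z = e_ rho.-1) ->
  (forall t : R, 0 < t -> t < t0 -> forall a, (a < rho)%N -> e_ a *m D t =
     if a.+1 == rho then 0 else (zroot rho t)%:C ^+ (rho - a.+1) *: (e_ a *m F)) ->
  exists Lk : forall j : nat, R -> 'M[C]_(\sum_(i < j) s j, l),
  [/\ bigO (fun t => tX t *m tF t - (lead m Xi2 G *m (e_ rho.-1 *m F)
        + \sum_(j < m) grp Xic j.+1 *m Lk j.+1 t)) 1,
      forall j, (1 <= j <= m)%N -> j <> rho -> bigO_rows (Lk j) (deltac R rho j)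
    & bigO_rows (fun t => Lk rho t - D t) (deltac R rho rho)].
Proof.
move=> est [Z WZ] eD.
pose y t := residual W2 G (e_ rho.-1 *m F) (Z *m F) (tX t *m tF t).
pose Lk j t : 'M[C]_(\sum_(i < j) s j, l) := \mxcol_(a < j) y t j (j - a)%N.
have nF_ge0 := factor_le_ge0.
exists Lk; split=> [|j jm jrho a|a].
- apply: (bigO_zroot_rho rho_pos t0_gt0 (c := k * (nrm F + kF))) => t t_gt0 tt0.
  have [_ _ _ X4 _] := est t t_gt0 tt0.
  rewrite grp_sum_rev residual_sum //; last by rewrite mulmxA WZ.
  rewrite mulmxA; apply: le_trans (product_le t_gt0 tt0 X4) _.
  by rewrite mulrAC.
- have aj := ltn_ord a; have B : is_block m j (j - a).
    by case/andP: jm => _ jm; rewrite /is_block jm andbT subn_gt0 aj leq_subr.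
  have rowE t : submxcol (Lk j t) a = y t j (j - a)%N by rewrite mxcolK.
  have rajS : ((j - a.+1).+1 = j - a)%N by exact: rev_ord_succ.
  rewrite /deltac; have [/andP[rj /eqP a0]|] := boolP ((rho < j)%N && ((j - a.+1)%N == 0%N)).
    rewrite a0 delta_first //.
    apply: (bigO_zroot (j := 1) t0_gt0 (c := k * (nrm F + kF) + nrm (G j *m e_ rho.-1) * kF)).
    move=> t t_gt0 tt0; have [_ _ X3 _ _] := est t t_gt0 tt0.
    have rjm : (rho < j <= m)%N by rewrite rj; case/andP: jm.
    have := X3 j rjm; rewrite -[zroot rho t]expr1 => /(product_shift_le t_gt0 tt0).
    rewrite !expr1 -mulrDl; apply: le_trans.
    by rewrite rowE /y /residual -rajS a0 eqxx rj !mulmxA.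
  move=> na0; rewrite (delta_jexp R rho_pos); last first.
  + by rewrite negb_and in na0; rewrite implybE lt0n.
  + exact/eqP.
  + exact: rev_ord_lt.
  apply: (bigO_zroot t0_gt0 (c := k * (nrm F + kF))) => t t_gt0 tt0.
  have [_ X2 _ _ _] := est t t_gt0 tt0.
  have -> : submxcol (Lk j t) a = W2 j (j - a)%N *m (tX t *m tF t).
    by rewrite rowE; apply: residual_coord; rewrite // -rajS.
  rewrite mulmxA rajS; apply: le_trans (product_le t_gt0 tt0 (X2 _ _ B)) _.
  by rewrite mulrAC.
have ar := ltn_ord a; rewrite /deltac delta_rho; set b := (rho - a.+1)%N.
have rabS : (b.+1 = rho - a)%N by exact: rev_ord_succ.
have rb : (rho - b.+1 = a)%N by rewrite rabS; exact: subKn (ltnW ar).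
have br : (b < rho)%N by exact: rev_ord_lt.
apply: (bigO_zroot t0_gt0 (c := k * (nrm F + kF) + nrm (e_ a) * kF)) => t t_gt0 tt0.
have [X1 _ _ _ _] := est t t_gt0 tt0.
have z_ge0 := ltW (zroot_gt0 rho t_gt0).
have X1b := X1 b br; rewrite rb in X1b.
have -> : submxcol (Lk rho t - D t) a =
    W2 rho b.+1 *m tX t *m tF t - (zroot rho t)%:C ^+ b *: e_ a *m F.
  rewrite submxcol_eblk mulmxBr (eblk_mxcol ar) (eD t t_gt0 tt0 a ar).
  have [ar1|ar1] := eqVneq a.+1 rho.
    have b0 : b = 0%N by rewrite /b ar1 subnn.
    rewrite /= -rabS b0 subr0 expr0 scale1r /y /residual eqxx ltnn eqxx !mulmxA WZ.
    by have -> : rho.-1 = a := congr1 predn (esym ar1).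
  rewrite -scalemxAl; congr (_ - _); rewrite /= -rabS /y /residual.
  case: eqP => [[b0]|_]; last by rewrite mulmxA.
  by exfalso; move: ar1 ar b0; rewrite /b; lia.
apply: le_trans (product_shift_le t_gt0 tt0 X1b) _.
rewrite mulrDl lerD2l nrmZ -rmorphXn cabsR ger0_norm ?exprn_ge0 // exprSr.
by rewrite le_eqVlt; apply/orP; left; apply/eqP; ring.
Qed.

End Expansions.

(** * From the estimates to the theorem *)

Section Assembly.
Variable R : realType.
Local Notation C := R[i].

Lemma eq_bigO a b (M M' : R -> 'M[C]_(a, b)) d : (forall t, M t = M' t) ->
  bigO M d -> bigO M' d.
Proof. by move=> /funext ->. Qed.

Lemma lead_firstE rho r p (G : 'M[C]_(p, r)) :
  lead_first rho G = col_mx 1%:M G *m eblk C rho r 0.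
Proof.
rewrite /lead_first /eblk mul_mxrow; apply/eq_mxrowP => b.
by case: eqP; rewrite ?mulmx1 ?mulmx0.
Qed.

Lemma lead_lastE rho r p (G : 'M[C]_(p, r)) : (0 < rho)%N ->
  lead_last rho G = col_mx 1%:M G *m eblk C rho r rho.-1.
Proof.
move=> r0; rewrite /lead_last /eblk mul_mxrow; apply/eq_mxrowP => b.
have -> : (b.+1 == rho) = (b == rho.-1 :> nat) by rewrite -[RHS]eqSS prednK.
by case: eqP; rewrite ?mulmx1 ?mulmx0.
Qed.

Lemma eblk_mxdiag rho r (B : 'I_rho -> 'M[C]_r) a (ha : (a < rho)%N) :
  eblk C rho r a *m (\mxdiag_(b < rho) B b) = B (Ordinal ha) *m eblk C rho r a.
Proof.
rewrite /eblk mul_mxrow_mxdiag mul_mxrow; apply/eq_mxrowP => b.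
case: eqP => [ba|_]; last by rewrite mul0mx mulmx0.
by rewrite mul1mx mulmx1; congr B; apply: val_inj.
Qed.

Lemma eblk_Xdiag rho r t a : (a < rho)%N -> 0 < t ->
  eblk C rho r a *m Xdiag rho r t =
  if a == 0%N then 0 else (zroot rho t)%:C ^+ a *: eblk C rho r a.
Proof.
move=> ha t_gt0; rewrite /Xdiag (eblk_mxdiag _ ha) /=; case: eqP => _.
  by rewrite mul0mx.
by rewrite tpow_zroot // mul_scalar_mx.
Qed.

Lemma eblk_Xdiagc rho r t a : (a < rho)%N -> 0 < t ->
  eblk C rho r a *m Xdiagc rho r t =
  if a.+1 == rho then 0 else (zroot rho t)%:C ^+ (rho - a.+1) *: eblk C rho r a.
Proof.
move=> ha t_gt0; rewrite /Xdiagc (eblk_mxdiag _ ha) /=; case: eqP => _.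
  by rewrite mul0mx.
by rewrite tpow_zroot // mul_scalar_mx.
Qed.

Lemma expmxZ l (x : C) (A : 'M[C]_l) a : (x *: A) ^+ a = x ^+ a *: A ^+ a.
Proof.
elim: a => [|a IHa]; first by rewrite !expr0 scale1r.
by rewrite !exprS IHa -!mulmxE -scalemxAl -scalemxAr scalerA.
Qed.

Lemma eblk_Krylov rho r l (Q : 'M[C]_(r, l)) (Om : 'M[C]_l) a : (a < rho)%N ->
  eblk C rho r a *m Krylov rho Q Om = Q *m Om ^+ a.
Proof. by move=> ha; rewrite (eblk_mxcol ha). Qed.

Lemma eblk_Krylov0 rho r l (Q : 'M[C]_(r, l)) (Om : 'M[C]_l) (x : C) a : (a < rho)%N ->
  eblk C rho r a *m Krylov0 rho Q (x *: Om) =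
  if a == 0%N then 0 else x ^+ a *: (eblk C rho r a *m Krylov rho Q Om).
Proof.
move=> ha; rewrite eblk_Krylov // (eblk_mxcol ha) /=; case: ifP => // _.
by rewrite expmxZ -scalemxAr.
Qed.

Lemma eblk_Krylovc rho r l (Q : 'M[C]_(r, l)) (Om : 'M[C]_l) a : (a < rho)%N ->
  eblk C rho r a *m Krylovc rho Q Om = (Om ^+ (rho - a.+1) *m Q ^t*) ^t*.
Proof. by move=> ha; rewrite /Krylovc adj_mxrow (eblk_mxcol ha). Qed.

Lemma eblk_Krylovc0 rho r l (Q : 'M[C]_(r, l)) (Om : 'M[C]_l) (x : R) a : (a < rho)%N ->
  eblk C rho r a *m Krylovc0 rho Q (x%:C *: Om) =
  if a.+1 == rho then 0 else x%:C ^+ (rho - a.+1) *: (eblk C rho r a *m Krylovc rho Q Om).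
Proof.
move=> ha; rewrite eblk_Krylovc // /Krylovc0 adj_mxrow (eblk_mxcol ha) /=.
case: ifP => _; first exact: adjmx0.
by rewrite expmxZ -scalemxAl adjmxZ conjCRX.
Qed.

Lemma pair_invariant n p (K : 'M[C]_(n + n)) (X Y : 'M[C]_(n + n, p)) (A : 'M[C]_p) :
  K *m X = X *m A -> K *m Y = Y *m (- A ^t*) ->
  K *m row_mx X Y = row_mx X Y *m diag2 A (- A ^t*).
Proof.
by move=> KX KY; rewrite mul_mx_row mul_row_block !mulmx0 addr0 add0r KX KY.
Qed.

Lemma pair_symplectic n p (X Y : 'M[C]_(n + n, p)) (c : C) : Num.conj c = c ->
  X ^t* *m Jmx C n *m X = 0 -> Y ^t* *m Jmx C n *m Y = 0 ->
  X ^t* *m Jmx C n *m Y = c%:M ->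
  (row_mx X Y) ^t* *m Jmx C n *m row_mx X Y = c *: Jmx C p.
Proof.
move=> cR XX YY XY; have YX : Y ^t* *m Jmx C n *m X = - c%:M.
  apply: (can_inj (@trmxCK _ _ _)); rewrite !adjmxM trmxCK adjmx_Jmx mulNmx mulmxN mulmxA.
  by rewrite XY adjmxN adjmx_scalar cR.
rewrite adjmx_row !mul_col_mx !mul_mx_row XX YY XY YX.
by rewrite -block_mxEv /Jmx scale_block_mx !scaler0 scalerN scalemx1.
Qed.

End Assembly.

Theorem theorem12 (R : realType) (n m : nat) (s : nat -> nat)
    (m_ge1 : (1 <= m)%N) (sm_gt0 : (0 < s m)%N)
    (H T : 'M[R[i]]_(n + n)) (H_ham : Hamiltonian H) (T_ham : Hamiltonian T)
    (lambda : R[i]) (lambda_nonimag : complex.Re lambda != 0)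
    (Xi Xic : forall j i : nat, 'M[R[i]]_(n + n, s j))
    (PhiC : 'M[R[i]]_(n + n, (n - psize m s) + (n - psize m s)))
    (HC : 'M[R[i]]_((n - psize m s) + (n - psize m s)))
    (Phi := row_mx (row_mx (allgrp m Xi) (allgrp m Xic)) PhiC)
    (LN := lambda%:M + Nmx R[i] m s)
    (Phi_inv : invertible_mx Phi)
    (H_Phi : H *m Phi = Phi *m diag2 (diag2 LN (- LN ^t*)) HC)
    (J_Phi : Phi ^t* *m Jmx _ n *m Phi
             = diag2 (Jmx _ (psize m s)) (Jmx _ (n - psize m s)))
    (lambda_HC : ~~ eigenvalue HC lambda)
    (lambdac_HC : ~~ eigenvalue HC (- Num.conj lambda))
    (Psi_inv : forall k : nat, (1 <= k <= m)%N ->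
       Psi Xi Xic T k (m - k).+1 \in unitmx)
    (rho : nat) (rho_range : (1 <= rho <= m)%N)
    (G := Ghat m Xi Xic T rho) (Gc := Ghatc m Xi Xic T rho)
    (S := Shat m Xi Xic T rho)
    (l : nat) (F Fc : 'M[R[i]]_(\sum_(i < rho) s rho, l))
    (F_full : \rank F = l) (Fc_full : \rank Fc = l)
    (Omega : 'M[R[i]]_l) (Q Qc : 'M[R[i]]_(s rho, l))
    (F_def : F = Krylov rho Q Omega)
    (Q_eq : - S *m Q = Q *m Omega ^+ rho)
    (Fc_def : Fc = Krylovc rho Qc Omega)
    (Qc_eq : - S ^t* *m Qc = Qc *m (Omega ^t*) ^+ rho)
    (F_eq : Theta rho (- S) *m F = F *m Omega)
    (Fc_eq : (Theta rho (- S)) ^t* *m Fc = Fc *m Omega ^t*)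
    (F_Fc : F ^t* *m Fc = 1%:M)
    (Omega_sep : (spectrum Omega
                  `&` (spectrum (Theta rho (- S)) `\` spectrum Omega))%mset
                 = mset0) :
  exists (tXi tXic : R -> 'M[R[i]]_(n + n, \sum_(i < rho) s rho))
         (tTheta : R -> 'M[R[i]]_(\sum_(i < rho) s rho)),
    perturbed_structured_basis m H T lambda Xi Xic tXi tXic tTheta /\
  exists (tF tFc : R -> 'M[R[i]]_(\sum_(i < rho) s rho, l))
         (tOmega : R -> 'M[R[i]]_l),
  let L := fun t => tXi t *m tF t in
  let Lc := fun t => tXic t *m tFc t in
  [/\ [/\ bigO (fun t => tF t - F) (1 / rho%:R),
          bigO (fun t => tFc t - Fc) (1 / rho%:R)
        & bigO (fun t => tOmega t - Omega) (1 / rho%:R)],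
      \forall t \near 0^'+,
        [/\ tTheta t *m tF t = tF t *m tOmega t,
            (tTheta t) ^t* *m tFc t = tFc t *m (tOmega t) ^t*
          & (tF t) ^t* *m tFc t = 1%:M],
      \forall t \near 0^'+,
        let P := row_mx (L t) (Lc t) in
        let A := lambda%:M + tpow t (1 / rho%:R) *: tOmega t in
        (H + t%:C *: T) *m P = P *m block_mx A 0 0 (- A ^t*) /\
        P ^t* *m Jmx _ n *m P = tpow t (1 - 1 / rho%:R) *: Jmx _ l,
      exists Lk : forall k : nat, R -> 'M[R[i]]_(\sum_(i < k) s k, l),
        [/\ bigO (fun t => L t
                    - (Ups Xi rho (m - rho).+1 *m col_mx 1%:M G *m Q
                       + \sum_(k < m) grp Xi k.+1 *m Lk k.+1 t)) 1,
            forall k : nat, (1 <= k <= m)%N -> k <> rho ->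
              bigO_rows (Lk k) (delta R rho k)
          & bigO_rows
              (fun t => Lk rho t - Krylov0 rho Q (tpow t (1 / rho%:R) *: Omega))
              (delta R rho rho)]
    & exists Lkc : forall k : nat, R -> 'M[R[i]]_(\sum_(i < k) s k, l),
        [/\ bigO (fun t => Lc t
                    - (Upsc Xic rho (m - rho).+1 *m col_mx 1%:M Gc *m Qc
                       + \sum_(k < m) grp Xic k.+1 *m Lkc k.+1 t)) 1,
            forall k : nat, (1 <= k <= m)%N -> k <> rho ->
              bigO_rows (Lkc k) (deltac R rho k)
          & bigO_rows
              (fun t => Lkc rho t - Krylovc0 rho Qc (tpow t (1 / rho%:R) *: Omega))
              (deltac R rho rho)]].
Proof.
have rho_gt0 : (0 < rho)%N by case/andP: rho_range.
have lam0 : lambda + Num.conj lambda != 0.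
  apply: contra lambda_nonimag => /eqP e.
  have : complex.Re (lambda + Num.conj lambda) = 0 by rewrite e.
  case: (lambda) => a b /= /eqP; rewrite -mulr2n mulrn_eq0 /=.
  by [].
have complement mu : mu = lambda \/ mu = - Num.conj lambda ->
    forall p (Y : 'M[R[i]]_(n + n, p)), H *m Y = mu *: Y ->
    (forall k i, is_block m k i -> (Xi k i) ^t* *m Jmx _ n *m Y = 0) ->
    (forall k i, is_block m k i -> (Xic k i) ^t* *m Jmx _ n *m Y = 0) -> Y = 0.
  move=> muE p Y; apply: (complement_eigen Phi_inv H_Phi J_Phi).
  by case: muE => ->.
have P_head := Psi_inv rho rho_range.
(* For [rho = m] the matrix is empty, with determinant [1]. *)
have P_tail : Psi Xi Xic T rho.+1 (m - rho) \in unitmx.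
  have [rm|rm] := ltnP rho m.
    by rewrite -(subnSK rm); apply: Psi_inv.
  have -> : (m - rho = 0)%N by apply/eqP.
  by rewrite unitmxE det_mx00 unitr1.
have [G1 [G2 [z0 [k [lead1 lead2 /andP[z0_gt0 z0_le1] k_ge0 pair]]]]] :=
  structured_pair rho_range H_ham T_ham lam0 (Xi_J_Xic_same J_Phi) (Xi_J_Xic_diff J_Phi)
    (H_Xi H_Phi) (H_Xic H_Phi) complement P_head P_tail.
have [e0 [k' [e0_gt0 k'_ge0 omega]]] := omega_perturbation F_eq Fc_eq F_Fc Omega_sep.
(* Ensures [k * z <= e0], so that [omega] applies with [e = k * z]; the [+ 1] covers [k = 0]. *)
pose z1 := Num.min z0 (e0 / (k + 1)).
have k1_gt0 : 0 < k + 1 by rewrite ltr_wpDl.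
have z1_gt0 : 0 < z1 by rewrite lt_min z0_gt0 divr_gt0.
pose t0 := z1 ^+ rho.
have t0_gt0 : 0 < t0 by rewrite exprn_gt0.
pose z := zroot rho : R -> R.
have z_gt0 (t : R) : 0 < t -> 0 < z t by apply: zroot_gt0.
have z_le1 (t : R) : 0 < t -> t < t0 -> z t <= 1.
  by move=> ? ?; apply: le_trans z0_le1; apply: le_trans (zroot_le rho_gt0 z1_gt0 _ _) _;
    rewrite ?ge_min ?lexx.
pose kF := k' * k.
have kF_ge0 : 0 <= kF by rewrite mulr_ge0.
pose q := (\sum_(i < rho) s rho)%N.
(* All six matrices are chosen together, as the last three depend on [Th]. For [t] outside the
   interval from [0] to [t0] the claim is vacuous and zeros serve. *)
have data (t : R) : exists d : 'M[R[i]]_(n + n, q) * 'M[R[i]]_(n + n, q) * 'M[R[i]]_q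
    * 'M[R[i]]_(q, l) * 'M[R[i]]_(q, l) * 'M[R[i]]_l,
  let: (X, Y, Th, tF, tFc, tOm) := d in
  0 < t -> t < t0 ->
  let A := lambda%:M + (z t)%:C *: Th in let K := H + (z t)%:C ^+ rho *: T in
  [/\ [/\ K *m X = X *m A, K *m Y = Y *m (- A ^t*)
        & nrm (Th - Theta rho (- S)) <= k * z t],
      [/\ X ^t* *m Jmx _ n *m X = 0, Y ^t* *m Jmx _ n *m Y = 0
        & X ^t* *m Jmx _ n *m Y = ((z t)%:C ^+ rho.-1)%:M],
      right_estimates m Xi Xic G1 (z t) k X /\ mirror_estimates m Xi Xic G2 (z t) k Y,
      exists Z, mirror_dual Xi rho 1%N *m Z = eblk R[i] rho (s rho) rho.-1
    & [/\ Th *m tF = tF *m tOm, Th ^t* *m tFc = tFc *m tOm ^t*, tF ^t* *m tFc = 1%:M,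
          nrm (tF - F) <= kF * z t
        & nrm (tFc - Fc) <= kF * z t /\ nrm (tOm - Omega) <= kF * z t]].
  have [t_gt0|t_le0] := ltP 0 t; last first.
    by exists (0, 0, 0, 0, 0, 0).
  have [tt0|tt0] := ltP t t0; last first.
    by exists (0, 0, 0, 0, 0, 0).
  have zz1 : z t <= z1 by apply: zroot_le.
  have zz0 : z t <= z0 by apply: le_trans zz1 _; rewrite ge_min lexx.
  have [X [Y [Th [inv iso est1 est2 Z]]]] := pair (z t) (z_gt0 t t_gt0) zz0.
  have kz : k * z t <= e0.
    have : z t <= e0 / (k + 1) by apply: le_trans zz1 _; rewrite ge_min lexx orbT.
    rewrite ler_pdivlMr // => /(le_trans _); apply.
    by rewrite mulrC ler_wpM2l ?lerDl // ltW ?z_gt0.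
  have [_ _ dTh] := inv.
  have [tF [tFc [tOm om]]] := omega _ _ kz dTh.
  rewrite -/S -/q !mulrA -/kF in om.
  by exists (X, Y, Th, tF, tFc, tOm).
have [d dP] := choice data.
pose tX t := (d t).1.1.1.1.1; pose tY t := (d t).1.1.1.1.2; pose tTh t := (d t).1.1.1.2.
pose tF t := (d t).1.1.2; pose tFc t := (d t).1.2; pose tOm t := (d t).2.
have {}dP (t : R) : 0 < t -> t < t0 ->
  let A := lambda%:M + (z t)%:C *: tTh t in let K := H + (z t)%:C ^+ rho *: T in
  [/\ [/\ K *m tX t = tX t *m A, K *m tY t = tY t *m (- A ^t*)
        & nrm (tTh t - Theta rho (- S)) <= k * z t],
      [/\ (tX t) ^t* *m Jmx _ n *m tX t = 0, (tY t) ^t* *m Jmx _ n *m tY t = 0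
        & (tX t) ^t* *m Jmx _ n *m tY t = ((z t)%:C ^+ rho.-1)%:M],
      right_estimates m Xi Xic G1 (z t) k (tX t)
        /\ mirror_estimates m Xi Xic G2 (z t) k (tY t),
      exists Z, mirror_dual Xi rho 1%N *m Z = eblk R[i] rho (s rho) rho.-1
    & [/\ tTh t *m tF t = tF t *m tOm t, (tTh t) ^t* *m tFc t = tFc t *m (tOm t) ^t*,
          (tF t) ^t* *m tFc t = 1%:M, nrm (tF t - F) <= kF * z t
        & nrm (tFc t - Fc) <= kF * z t /\ nrm (tOm t - Omega) <= kF * z t]].
  by move: (dP t); rewrite /tX /tY /tTh /tF /tFc /tOm; case: (d t) => [[[[[]]]]].
clearbody tX tY tTh tF tFc tOm; clear d.
have tC (t : R) : 0 < t -> t%:C = (z t)%:C ^+ rho.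
  by move=> t_gt0; rewrite -{1}(zroot_rho rho_gt0 t_gt0) rmorphXn.
have estX (t : R) : 0 < t -> t < t0 -> right_estimates m Xi Xic G1 (z t) k (tX t).
  by move=> t1 t2; have [_ _ []] := dP t t1 t2.
have estY (t : R) : 0 < t -> t < t0 -> mirror_estimates m Xi Xic G2 (z t) k (tY t).
  by move=> t1 t2; have [_ _ []] := dP t t1 t2.
(* The relation does not involve [t]; any admissible value, here [t0 / 2], provides the witness. *)
have hasZ : exists Z, mirror_dual Xi rho 1%N *m Z = eblk R[i] rho (s rho) rho.-1.
  have t2 : t0 / 2 < t0 by rewrite ltr_pdivrMr // mulr_natr mulr2n ltrDl.
  have t1 : 0 < t0 / 2 by rewrite divr_gt0.
  by have [_ _ _ Z _] := dP _ t1 t2.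
have dF (t : R) : 0 < t -> t < t0 -> nrm (tF t - F) <= kF * z t.
  by move=> t1 t2; have [_ _ _ _ []] := dP t t1 t2.
have dFc (t : R) : 0 < t -> t < t0 -> nrm (tFc t - Fc) <= kF * z t.
  by move=> t1 t2; have [_ _ _ _ [_ _ _ _ []]] := dP t t1 t2.
(* The constant factor [1], with error constant [0], specializes the expansions to the basis
   itself. *)
have d1 (t : R) : 0 < t -> t < t0 -> nrm (1%:M - 1%:M : 'M[R[i]]_q) <= 0 * z t.
  by move=> _ _; rewrite subrr nrm0 mul0r.
have [X [X_sum X_rows X_rho]] := right_expansion rho_range (lexx 0) t0_gt0 z_le1 d1 estX.
have [Xc [Xc_sum Xc_rows Xc_rho]] :=
  mirror_expansion rho_range (lexx 0) t0_gt0 z_le1 d1 (D := Xdiagc rho (s rho)) estY hasZ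
   (fun t t_gt0 _ a ha => etrans (eblk_Xdiagc (s rho) ha t_gt0)
      (congr1 (fun B => if a.+1 == rho then 0 else _ *: B) (esym (mulmx1 _)))).
have [Lk [L_sum L_rows L_rho]] := right_expansion rho_range kF_ge0 t0_gt0 z_le1 dF estX.
have [Lkc [Lc_sum Lc_rows Lc_rho]] :=
  mirror_expansion rho_range kF_ge0 t0_gt0 z_le1 dFc
   (D := fun t => Krylovc0 rho Qc (tpow t (1 / rho%:R) *: Omega)) estY hasZ
   (fun t t_gt0 _ a ha => etrans (eblk_Krylovc0 Qc Omega (z t) ha)
      (congr1 (fun B => if a.+1 == rho then 0 else _ *: (eblk R[i] rho (s rho) a *m B)) (esym Fc_def))).
have e0F : eblk R[i] rho (s rho) 0 *m F = Q by rewrite F_def eblk_Krylov // expr0 mulmx1.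
have eF : eblk R[i] rho (s rho) rho.-1 *m Fc = Qc.
  by rewrite Fc_def eblk_Krylovc prednK // subnn expr0 mul1mx trmxCK.
exists tX, tY, tTh; split.
  split.
  - by apply: (bigO_zroot (j := 1) t0_gt0 (c := k)) => t t1 t2; have [[_ _]] := dP t t1 t2.
  - exists X; split; [|exact: X_rows|].
      apply: eq_bigO X_sum => t; rewrite !mulmx1 lead_firstE -lead1.
      by rewrite !mulmxA.
    apply: (near_right t0_gt0) => t t1 t2; apply: eblk_ext => a ha.
    rewrite X_rho // eblk_Xdiag //; case: eqP => _; first by rewrite subrr mulmx0.
    by rewrite mulmx1.
  - exists Xc; split; [|exact: Xc_rows|exact: Xc_rho].
    apply: eq_bigO Xc_sum => t; rewrite !mulmx1 (lead_lastE _ rho_gt0) -lead2.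
    by rewrite !mulmxA.
  - apply: (near_right t0_gt0) => t t1 t2; rewrite tC //.
    by have [[KX KY _] _ _ _ _] := dP t t1 t2; apply: pair_invariant.
  apply: (near_right t0_gt0) => t t1 t2; rewrite tpow_zroot_pred //.
  have [_ [XX YY XY] _ _ _] := dP t t1 t2; apply: pair_symplectic => //.
  exact: conjCRX.
exists tF, tFc, tOm => L Lc; split.
- split; apply: (bigO_zroot (j := 1) t0_gt0 (c := kF)) => t t1 t2; rewrite expr1.
  + exact: dF.
  + exact: dFc.
  by have [_ _ _ _ [_ _ _ _ []]] := dP t t1 t2.
- apply: (near_right t0_gt0) => t t1 t2.
  by have [_ _ _ _ []] := dP t t1 t2.
- apply: (near_right t0_gt0) => t t1 t2; rewrite tC // tpow_zroot_pred //.
  have [[KX KY _] [XX YY XY] _ _ [ThF ThFc FFc _ _]] := dP t t1 t2; split.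
    apply: pair_invariant; rewrite /L /Lc mulmxA ?KX ?KY -!mulmxA; congr (_ *m _).
      by rewrite mulmxDl mulmxDr mul_scalar_mx mul_mx_scalar -scalemxAl -scalemxAr ThF.
    rewrite mulNmx mulmxN; congr (- _); rewrite !adjmxD !adjmx_scalar !adjmxZ mulmxDl mulmxDr.
    by rewrite mul_scalar_mx mul_mx_scalar -scalemxAl -scalemxAr ThFc.
  have sandwich (U V : 'M[R[i]]_(q, l)) (A B : 'M[R[i]]_(n + n, q)) :
      (A *m U) ^t* *m Jmx _ n *m (B *m V) = U ^t* *m (A ^t* *m Jmx _ n *m B) *m V.
    by rewrite adjmxM !mulmxA.
  apply: pair_symplectic; first exact: conjCRX.
  + by rewrite sandwich XX mulmx0 mul0mx.
  + by rewrite sandwich YY mulmx0 mul0mx.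
  by rewrite sandwich XY mul_mx_scalar -scalemxAl FFc scalemx1.
- exists Lk; split; [|exact: L_rows|].
    by apply: eq_bigO L_sum => t; rewrite e0F lead1.
  move=> a; have ha := ltn_ord a; rewrite delta_rho.
  pose ea := eblk R[i] rho (s rho) a.
  apply: (bigO_zroot t0_gt0 (c := nrm ea * kF)) => t t1 t2.
  rewrite submxcol_eblk mulmxBr L_rho // tpow_zroot1 eblk_Krylov0 // -F_def.
  have z_ge0 := ltW (z_gt0 t t1).
  have Fle : nrm (ea *m (tF t - F)) <= nrm ea * kF * z t.
    by rewrite (le_trans (nrmM _ _)) // -mulrA ler_wpM2l ?nrm_ge0 ?dF.
  have [a0|_] := eqVneq (nat_of_ord a) 0%N.
    by rewrite subr0 a0 expr1; move: Fle; rewrite /ea a0.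
  rewrite -scalerBr -mulmxBr nrmZ -rmorphXn cabsR ger0_norm ?exprn_ge0 //.
  by rewrite exprS mulrA [leRHS]mulrC ler_wpM2l ?exprn_ge0.
exists Lkc; split; [|exact: Lc_rows|exact: Lc_rho].
by apply: eq_bigO Lc_sum => t; rewrite eF lead2.
Qed.
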